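(* Let $(u_\varepsilon)$ be a bounded sequence in $\mathscr{B}^p=L^p(\Omega\times Q)$. Then there exist a subsequence (still denoted by $\varepsilon$) and a Young measure $\boldsymbol{\nu}=\{\nu_\omega\}_{\omega\in\Omega}$ on $\mathscr{B}^p$ such that for all $\omega_0\in\Omega_0$, $$\nu_{\omega_0}\text{ is concentrated on }\mathscr{C\!P}\big(\omega_0,(u_\varepsilon(\omega_0,\cdot))\big),$$ and $$\liminf_{\varepsilon\to0}\|u_\varepsilon\|^p_{\mathscr{B}^p}\ge\int_\Omega\Big(\int_{\mathscr{B}^p}\|v\|^p_{\mathscr{B}^p}\,d\nu_\omega(v)\Big)dP(\omega).$$ Moreover, $$u_\varepsilon\overset{2s}{\rightharpoonup}u,\qquad\text{where }u:=\int_\Omega\int_{\mathscr{B}^p}v\,d\nu_\omega(v)\,dP(\omega).$$ Finally, if there exists a measurable $v:\Omega\to\mathscr{B}^p$ with $\nu_\omega=\delta_{v(\omega)}$ for $P$-a.e. $\omega\in\Omega$, then, up to extraction of a further subsequence (still denoted by $\varepsilon$), $$u_\varepsilon(\omega)\overset{2s}{\rightharpoonup}_{\omega}v(\omega)\qquad\text{for }P\text{-a.e. }\omega\in\Omega.$$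
   Context: Standing assumptions: $(\Omega,\mathcal{F},P)$ is a probability space with countably generated $\sigma$-algebra, and $\tau=\{\tau_x\}_{x\in\mathbb{R}^d}$ is a group of measurable bijections of $\Omega$ with $\tau_0=\mathrm{Id}$, $\tau_{x+y}=\tau_x\circ\tau_y$, $P(\tau_xA)=P(A)$ for $A\in\mathcal{F}$, and $(\omega,x)\mapsto\tau_x\omega$ is $\mathcal{F}\otimes\mathcal{L}$-measurable ($\mathcal{L}$ the Lebesgue $\sigma$-algebra on $\mathbb{R}^d$); $P$ is ergodic: every $A\in\mathcal{F}$ with $\tau_xA=A$ for all $x$ has $P(A)\in\{0,1\}$. $\langle\cdot\rangle=\int_\Omega\cdot\,dP$. $p\in(1,\infty)$, $q=\frac{p}{p-1}$, $Q\subset\mathbb{R}^d$ is open and bounded, $\mathscr{B}^r:=L^r(\Omega\times Q)$. For $(u_\varepsilon)$ in $\mathscr{B}^p$, $u_\varepsilon(\omega)=u_\varepsilon(\omega,\cdot)$ denotes the realization at $\omega$; the functions $u_\varepsilon$ are understood to be modified on a null set of $\Omega\times Q$ so that $u_\varepsilon(\omega,\cdot)\in L^p(Q)$ for all $\omega\in\Omega$. Test functions: $\mathscr{D}_\Omega$ is a fixed countable set of bounded measurable functions on $\Omega$ containing $\mathbf{1}_\Omega\equiv1$ and dense in $L^1(\Omega)$ (hence in $L^r(\Omega)$, $1\le r<\infty$); $\mathscr{D}_Q\subset C(\overline{Q})$ is a fixed countable set containing $\mathbf{1}_Q\equiv1$ and dense in $L^1(Q)$ (hence in $L^r(Q)$,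 $1\le r<\infty$). $\mathscr{A}:=\{\varphi_\Omega(\omega)\varphi_Q(x):\varphi_\Omega\in\mathscr{D}_\Omega,\varphi_Q\in\mathscr{D}_Q\}$, $\mathscr{D}_0$ is the $\mathbb{Q}$-linear span of $\mathscr{A}$, $\mathscr{D}:=\mathrm{span}\,\mathscr{A}$. For $\varphi\in\mathscr{D}$ (and products of such functions), $(\mathcal{T}^*_\varepsilon\varphi)(\omega,x):=\varphi(\tau_{\frac{x}{\varepsilon}}\omega,x)$. $\Omega_0\subset\Omega$ is a fixed measurable set with $P(\Omega_0)=1$ such that for all $\varphi,\varphi'\in\mathscr{A}$, $\omega_0\in\Omega_0$, $r\in\{p,q\}$: $\limsup_{\varepsilon\to0}\|(\mathcal{T}^*_\varepsilon\varphi)(\omega_0,\cdot)\|_{L^r(Q)}\le\|\varphi\|_{\mathscr{B}^r}$ and $\lim_{\varepsilon\to0}\int_Q\mathcal{T}^*_\varepsilon(\varphi\varphi')(\omega_0,x)\,dx=\langle\int_Q\varphi\varphi'\,dx\rangle$ (such a set exists by Birkhoff's ergodic theorem). Quenched two-scale convergence: for $\omega_0\in\Omega_0$, a sequence $(u_\varepsilon)$ in $L^p(Q)$ and $u\in\mathscr{B}^p$, $u_\varepsilon\overset{2s}{\rightharpoonup}_{\omega_0}u$ means that $(u_\varepsilon)$ is bounded in $L^p(Q)$ and $\lim_{\varepsilon\to0}\int_Qu_\varepsilon(x)(\mathcal{T}^*_\varepsilon\varphi)(\omega_0,x)\,dx=\int_\Omega\int_Qu\varphi\,dx\,dP$ for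 all $\varphi\in\mathscr{D}$. Metric space: $\mathrm{Lin}(\mathscr{D})$ is the space of linear functionals $\mathscr{D}\to\mathbb{R}$ with metric $d(U,V)=\sum_{j\in\mathbb{N}}2^{-j}\frac{|U(\varphi_j)-V(\varphi_j)|}{|U(\varphi_j)-V(\varphi_j)|+1}$, where $\{\varphi_j\}_{j\in\mathbb{N}}$ enumerates $\{\varphi/\|\varphi\|_{\mathscr{B}^q}:\varphi\in\mathscr{D}_0,\ \varphi\neq0\}$. $J^{\omega_0}_\varepsilon:L^p(Q)\to\mathrm{Lin}(\mathscr{D})$, $(J^{\omega_0}_\varepsilon u)(\varphi)=\int_Qu(x)(\mathcal{T}^*_\varepsilon\varphi)(\omega_0,x)\,dx$; $J_0:\mathscr{B}^p\to\mathrm{Lin}(\mathscr{D})$, $(J_0u)(\varphi)=\langle\int_Qu\varphi\rangle$. For a bounded sequence $(u_\varepsilon)$ in $L^p(Q)$ and $\omega_0\in\Omega_0$, the set of quenched $\omega_0$-two-scale cluster points $\mathscr{C\!P}(\omega_0,(u_\varepsilon))$ is the set of $u\in\mathscr{B}^p$ with $J_0u\in\bigcap_{k=1}^\infty\overline{\{J^{\omega_0}_\varepsilon u_\varepsilon:\varepsilon<\frac1k\}}$ (closure in $\mathrm{Lin}(\mathscr{D})$). Young measure on $\mathscr{B}^p$: a family $\{\nu_\omega\}_{\omega\in\Omega}$ of Borel probability measures on $\mathscr{B}^p$ (equipped with the weak topology) such that $\omega\mapsto\nu_\omega(B)$ is measurable for all Borel sets $B\subset\mathscr{B}^p$ (with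 respect to the weak topology). Two-scale convergence in the mean: $u_\varepsilon\overset{2s}{\rightharpoonup}u$ in $\mathscr{B}^p$ means $\mathcal{T}_\varepsilon u_\varepsilon\rightharpoonup u$ weakly in $\mathscr{B}^p$, where $\mathcal{T}_\varepsilon:\mathscr{B}^p\to\mathscr{B}^p$ is the unique linear isometric isomorphism with $(\mathcal{T}_\varepsilon u)(\omega,x)=u(\tau_{-\frac{x}{\varepsilon}}\omega,x)$ a.e. for $u$ in the algebraic tensor product of $L^p(\Omega)$ and $L^p(Q)$.
   Formalization: The null-set modification of the realizations is chosen with the subsequence; in the final claim the common further subsequence gives convergence of all pairings, while boundedness in L^p(Q) holds only along an ω-dependent further subsequence, since common boundedness can fail. *)

(* Defs.v *)
From HB Require Import structures.
From mathcomp Require Import all_boot all_order all_algebra.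
From mathcomp Require Import all_classical all_reals all_analysis.
From mathcomp Require Import measurable_realfun ess_sup_inf.
From mathcomp Require Import lra.

Set Implicit Arguments.
Unset Strict Implicit.
Unset Printing Implicit Defensive.

Import Order.TTheory GRing.Theory Num.Theory numFieldNormedType.Exports.

Local Open Scope classical_set_scope.
Local Open Scope ring_scope.

(** The library's quotient [LspaceType mu p1] carries no algebraic structure;
    it is made a normed module here. *)
Section lspace_normed.
Context d (T : measurableType d) (R : realType).
Variables (mu : {measure set T -> \bar R}) (p : \bar R) (p1 : (1 <= p)%E).
Local Notation E := (LspaceType mu p1).
Local Notation F := (LfunType mu p1).

Let Lfun_of_subproof (v : E) : (v : T -> R) \in Lfun mu p.
Proof.
rewrite inE; apply/andP; split; rewrite inE /=.
  exact: (@measurable_funPT _ _ _ _ (repr (LebesgueSpace.sort v))).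
case: v => v [[vfin]] /=; exact: vfin.
Qed.

Lemma measurable_Lspace (v : E) : measurable_fun setT (v : T -> R).
Proof. exact: (@measurable_funPT _ _ _ _ (repr (LebesgueSpace.sort v))). Qed.

Definition Lfun_of (v : E) : F := Lfun_Sub p1 (Lfun_of_subproof v).

Local Open Scope quotient_scope.

Let mfun_of (f : F) : {mfun T >-> measurableTypeR R} :=
  HB.pack_for {mfun T >-> measurableTypeR R} (f : T -> R)
    (@isMeasurableFun.Build _ _ T (measurableTypeR R) (f : T -> R)
       (measurable_funPT f)).

Let pi_ae (f : {mfun T >-> measurableTypeR R}) :
  (repr (\pi_({mfun_ mu, T >-> measurableTypeR R}) f) : T -> R) = f %[ae mu].
Proof. by apply/asboolP; have /eqmodP := reprK (\pi_({mfun_ mu, T >-> measurableTypeR R}) f). Qed.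

Lemma eq_ae_Lnorm (f g : T -> R) :
  measurable_fun setT f -> measurable_fun setT g -> f = g %[ae mu] ->
  Lnorm mu p (EFin \o f) = Lnorm mu p (EFin \o g).
Proof.
move=> mf mg fg; rewrite unlock; case: p p1 => [r| |] // _; last first.
  case: ifPn => // _; apply: eq_ess_sup.
  by apply: filterS fg => x /= ->.
congr (_ `^ _)%E; apply: ae_eq_integral => //.
- apply/measurable_EFinP/(@measurableT_comp _ _ _ _ _ _ (@powR R ^~ r)) => //.
  exact: measurableT_comp.
- apply/measurable_EFinP/(@measurableT_comp _ _ _ _ _ _ (@powR R ^~ r)) => //.
  exact: measurableT_comp.
- by apply: filterS fg => x /= ->.
Qed.

Let Lspace_of_subproof (f : F) :
  finite_norm mu p
    (\pi_({mfun_ mu, T >-> measurableTypeR R}) (mfun_of f) :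
      {mfun_ mu, T >-> measurableTypeR R}).
Proof.
rewrite /finite_norm (@eq_ae_Lnorm _ f).
- exact: (@Lfunction_finite _ _ _ _ _ p1 f).
- exact: (@measurable_funPT _ _ _ _ (repr (\pi_({mfun_ mu, T >-> measurableTypeR R}) (mfun_of f)))).
- exact: measurable_funPT.
- exact: (pi_ae (mfun_of f)).
Qed.

Definition Lspace_of (f : F) : E :=
  HB.pack_for E (\pi_({mfun_ mu, T >-> measurableTypeR R}) (mfun_of f) :
      {mfun_ mu, T >-> measurableTypeR R})
    (isFinLebesgue.Build _ _ _ _ _ _ _ (Lspace_of_subproof f)).

Lemma Lspace_ofE (f : F) : (Lspace_of f : T -> R) = f %[ae mu].
Proof. exact: (pi_ae (mfun_of f)). Qed.

Lemma Lspace_eqP (u v : E) : u = v <-> (u : T -> R) = v %[ae mu].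
Proof.
split=> [->|]; first exact: ae_eq_refl.
case: u v => [u [[pu]]] [v [[pv]]] uv.
have uvE : u = v.
  by rewrite -[u]reprK -[v]reprK; apply/eqmodP/asboolP.
by subst v; rewrite (Prop_irrelevance pu pv).
Qed.


Lemma LspaceP (u v : E) : (u : T -> R) = v %[ae mu] -> u = v.
Proof. by move/Lspace_eqP. Qed.

HB.instance Definition _ := gen_eqMixin E.
HB.instance Definition _ := gen_choiceMixin E.

Definition Lspace_add (u v : E) : E := Lspace_of (Lfun_of u + Lfun_of v).
Definition Lspace_opp (u : E) : E := Lspace_of (- Lfun_of u).
Definition Lspace_zero : E := Lspace_of 0.
Definition Lspace_scale (a : R) (u : E) : E := Lspace_of (a *: Lfun_of u).
Definition Lspace_norm (u : E) : R := fine (Lnorm mu p (EFin \o u)).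

Lemma Lspace_addE u v : (Lspace_add u v : T -> R) = (u : T -> R) \+ v %[ae mu].
Proof. exact: Lspace_ofE. Qed.

Lemma Lspace_oppE u : (Lspace_opp u : T -> R) = \- (u : T -> R) %[ae mu].
Proof. exact: Lspace_ofE. Qed.

Lemma Lspace_zeroE : (Lspace_zero : T -> R) = cst 0 %[ae mu].
Proof. exact: Lspace_ofE. Qed.

Lemma Lspace_scaleE a u : (Lspace_scale a u : T -> R) = a \*: (u : T -> R) %[ae mu].
Proof. exact: Lspace_ofE. Qed.

Let addA : associative Lspace_add.
Proof.
move=> u v w; apply: LspaceP.
near=> x => _.
have -> : (Lspace_add u (Lspace_add v w) : T -> R) x = u x + (v x + w x).
  rewrite (near (Lspace_addE u (Lspace_add v w)) x) //=; congr (_ + _).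
  by rewrite (near (Lspace_addE v w) x).
rewrite (near (Lspace_addE (Lspace_add u v) w) x) //= addrA; congr (_ + _).
by rewrite (near (Lspace_addE u v) x).
Unshelve. all: by end_near. Qed.

Let addC : commutative Lspace_add.
Proof. by move=> u v; rewrite /Lspace_add addrC. Qed.

Let add0 : left_id Lspace_zero Lspace_add.
Proof.
move=> u; apply: LspaceP; near=> x => _.
rewrite (near (Lspace_addE Lspace_zero u) x) //=.
by rewrite (near Lspace_zeroE x) //= add0r.
Unshelve. all: by end_near. Qed.

Let addN : left_inverse Lspace_zero Lspace_opp Lspace_add.
Proof.
move=> u; apply: LspaceP; near=> x => _.
rewrite (near (Lspace_addE (Lspace_opp u) u) x) //=.
rewrite (near (Lspace_oppE u) x) //= addNr.
by rewrite (near Lspace_zeroE x).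
Unshelve. all: by end_near. Qed.

HB.instance Definition _ := GRing.isZmodule.Build E addA addC add0 addN.

Let scaleA a b (u : E) :
  Lspace_scale a (Lspace_scale b u) = Lspace_scale (a * b) u.
Proof.
apply: LspaceP; near=> x => _.
rewrite (near (Lspace_scaleE a (Lspace_scale b u)) x) //=.
rewrite (near (Lspace_scaleE b u) x) //=.
by rewrite (near (Lspace_scaleE (a * b) u) x) //= scalerA.
Unshelve. all: by end_near. Qed.

Let scale1 : left_id 1 Lspace_scale.
Proof.
move=> u; apply: LspaceP; near=> x => _.
by rewrite (near (Lspace_scaleE 1 u) x) //= scale1r.
Unshelve. all: by end_near. Qed.

Let scaleDr : right_distributive Lspace_scale +%R.
Proof.
move=> a u v; apply: LspaceP; near=> x => _.
rewrite (near (Lspace_scaleE a (u + v)) x) //=.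
rewrite (near (Lspace_addE u v) x) //= scalerDr.
rewrite (near (Lspace_addE (Lspace_scale a u) (Lspace_scale a v)) x) //=.
rewrite (near (Lspace_scaleE a u) x) //=.
by rewrite (near (Lspace_scaleE a v) x).
Unshelve. all: by end_near. Qed.

Let scaleDl (u : E) : {morph Lspace_scale^~ u : a b / a + b}.
Proof.
move=> a b; apply: LspaceP; near=> x => _.
rewrite (near (Lspace_scaleE (a + b) u) x) //= scalerDl.
rewrite (near (Lspace_addE (Lspace_scale a u) (Lspace_scale b u)) x) //=.
rewrite (near (Lspace_scaleE a u) x) //=.
by rewrite (near (Lspace_scaleE b u) x).
Unshelve. all: by end_near. Qed.

HB.instance Definition _ := GRing.Zmodule_isLmodule.Build R E
  scaleA scale1 scaleDr scaleDl.

Let normD (u v : E) : Lspace_norm (u + v) <= Lspace_norm u + Lspace_norm v.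
Proof.
have -> : Lspace_norm (u + v) =
    fine (Lnorm mu p (EFin \o (Lfun_of u + Lfun_of v))).
  congr fine; apply: eq_ae_Lnorm.
  - exact: measurable_Lspace.
  - exact: measurable_funPT.
  - exact: Lspace_ofE.
exact: ler_LnormD.
Qed.

Let normZ a (u : E) : Lspace_norm (a *: u) = `|a| * Lspace_norm u.
Proof.
have -> : Lspace_norm (a *: u) = fine (Lnorm mu p (EFin \o (a \*: Lfun_of u))).
  congr fine; apply: eq_ae_Lnorm.
  - exact: measurable_Lspace.
  - exact: (measurable_funPT (a *: Lfun_of u)).
  - exact: Lspace_ofE.
by rewrite LnormZ -finite_norm_fine -EFinM.
Qed.

Let norm0 (u : E) : Lspace_norm u = 0 -> u = 0.
Proof.
move/(@fine_Lnormr_eq0 _ _ _ _ _ _ (Lfun_of u)) => u0.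
apply: LspaceP; near=> x => _.
rewrite [LHS](near u0 x) //.
by rewrite (near Lspace_zeroE x).
Unshelve. all: by end_near. Qed.

HB.instance Definition _ := Lmodule_isNormed.Build R E normD normZ norm0.

End lspace_normed.

Section lebesgue_rV.
Context (R : realType) (d : nat).
Local Notation Rd := 'rV[R]_d.

Definition box (a b : Rd) : set Rd :=
  [set x | forall i, a ord0 i <= x ord0 i < b ord0 i].

Definition vol (a b : Rd) : R :=
  \prod_(i < d) Num.max 0 (b ord0 i - a ord0 i).

(** [set0] is given its own clause because every box is nonempty when
    [d = 0]. *)
Definition box_cost (A : set Rd) : \bar R :=
  ereal_inf [set c | (A = set0 /\ c = 0%E) \/
                     (exists a b, A = box a b /\ c = (vol a b)%:E)].

(** Every set is measurable for [g_sigma_algebraType setT], so [mu_ext] takes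
    the infimum over all countable covers by (possibly empty) boxes. *)
Definition lebesgue_outer : set Rd -> \bar R :=
  mu_ext (box_cost : set (g_sigma_algebraType [set: set Rd]) -> \bar R).

Lemma vol_ge0 a b : 0 <= vol a b.
Proof. by apply: prodr_ge0 => i _; rewrite le_max lexx. Qed.

Lemma box_cost_ge0 A : (0 <= box_cost A)%E.
Proof.
by apply: le_ereal_inf_tmp => _ [[_ ->]//|[a [b [_ ->]]]]; rewrite lee_fin vol_ge0.
Qed.

Lemma box_cost0 : box_cost set0 = 0%E.
Proof.
apply/eqP; rewrite eq_le box_cost_ge0 andbT.
by apply: ereal_inf_lbound; left.
Qed.

Lemma box_cost_box a b : (box_cost (box a b) <= (vol a b)%:E)%E.
Proof. by apply: ereal_inf_lbound; right; exists a, b. Qed.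

Let allsets := g_sigma_algebraType [set: set Rd].

Let lebesgue_outer0 : lebesgue_outer set0 = 0%E.
Proof. exact: (@mu_ext0 _ allsets _ _ box_cost0 box_cost_ge0). Qed.

Let lebesgue_outer_ge0 A : (0 <= lebesgue_outer A)%E.
Proof. exact: (@mu_ext_ge0 _ allsets _ _ box_cost_ge0). Qed.

Let le_lebesgue_outer : {homo lebesgue_outer : A B / A `<=` B >-> (A <= B)%E}.
Proof. exact: (@le_mu_ext _ allsets). Qed.

Let lebesgue_outer_sigma_subadditive : sigma_subadditive lebesgue_outer.
Proof. exact: (@mu_ext_sigma_subadditive _ allsets _ _ box_cost_ge0). Qed.

HB.instance Definition _ := isOuterMeasure.Build R Rd lebesgue_outer
  lebesgue_outer0 lebesgue_outer_ge0 le_lebesgue_outer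
  lebesgue_outer_sigma_subadditive.

(** [Rd] with its Lebesgue sigma-algebra. *)
Definition RdL := caratheodory_type lebesgue_outer.

Definition lebesgue_rV : set RdL -> \bar R := lebesgue_outer.

HB.instance Definition _ := isMeasure.Build _ _ _ lebesgue_rV
  (@caratheodory_measure0 R Rd lebesgue_outer)
  (@caratheodory_measure_ge0 R Rd lebesgue_outer)
  (@caratheodory_measure_sigma_additive R Rd lebesgue_outer).

Let cut (a : Rd) i c : Rd := \row_j (if j == i then c else a ord0 j).

Lemma vol_split a b i c :
  vol a (cut b i (Num.min (b ord0 i) c)) + vol (cut a i (Num.max (a ord0 i) c)) b
  = vol a b.
Proof.
rewrite /vol (bigD1 i)//= [in X in _ + X](bigD1 i)//= [in RHS](bigD1 i)//=.
rewrite !mxE eqxx.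
under eq_bigr => j ji do rewrite mxE (negbTE ji).
under [X in _ + _ * X]eq_bigr => j ji do rewrite mxE (negbTE ji).
rewrite -mulrDl; congr (_ * _).
set x := a _ _; set y := b _ _.
by rewrite /Num.max /Num.min; repeat case: ifPn; lra.
Qed.

Let half i c : set Rd := [set x | x ord0 i < c].

Let box_half a b i c :
  box a b `&` half i c = box a (cut b i (Num.min (b ord0 i) c)).
Proof.
rewrite /box /half; apply/seteqP; split=> x /=.
  move=> [abx xc] j; rewrite mxE; case: eqVneq => [->|_]; last exact: abx.
  by have /andP[-> xb] := abx i; rewrite lt_min xb xc.
move=> abx; split; last first.
  by have := abx i; rewrite mxE eqxx lt_min => /andP[_ /andP[]].
move=> j; have := abx j; rewrite mxE; case: eqVneq => // ->.
by rewrite lt_min => /andP[-> /andP[->]].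
Qed.

Let box_halfC a b i c :
  box a b `&` ~` half i c = box (cut a i (Num.max (a ord0 i) c)) b.
Proof.
rewrite /box /half; apply/seteqP; split=> x /=.
  move=> [abx /negP]; rewrite -leNgt => xc j; rewrite mxE.
  case: eqVneq => [->|_]; last exact: abx.
  by have /andP[xb ->] := abx i; rewrite ge_max xb xc.
move=> abx; split; last first.
  have := abx i; rewrite mxE eqxx ge_max => /andP[/andP[_ cx] _].
  by apply/negP; rewrite -leNgt.
move=> j; have := abx j; rewrite mxE; case: eqVneq => // ->.
by rewrite ge_max => /andP[/andP[-> _] ->].
Qed.

Let box_cost_split A i c :
  (box_cost (A `&` half i c) + box_cost (A `&` ~` half i c) <= box_cost A)%E.
Proof.
apply: le_ereal_inf_tmp => _ [[-> ->]|[a [b [-> ->]]]].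
  by rewrite !set0I box_cost0 adde0.
by rewrite box_half box_halfC -(vol_split a b i c) EFinD leeD ?box_cost_box.
Qed.

Let half_measurable i c : measurable (half i c : set RdL).
Proof.
apply: le_caratheodory_measurable => X.
apply: le_ereal_inf_tmp => _ [F [_ XF] <-].
have cF B k : (0 <= box_cost (F k `&` B))%E by exact: box_cost_ge0.
apply: (@le_trans _ _ (\sum_(k <oo) box_cost (F k `&` half i c) +
                       \sum_(k <oo) box_cost (F k `&` ~` half i c))%E).
  apply: leeD; apply: ereal_inf_lbound; eexists => //; split=> //.
  - by move=> ?; exact: sub_sigma_algebra.
  - by move=> x [/XF[k _ Fx] hx]; exists k.
  - by move=> ?; exact: sub_sigma_algebra.
  - by move=> x [/XF[k _ Fx] hx]; exists k.
rewrite -nneseriesD//.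
apply: lee_nneseries => k _; last exact: box_cost_split.
by rewrite adde_ge0.
Qed.

Lemma measurable_coord i : measurable_fun setT (fun x : RdL => x ord0 i).
Proof.
apply: (measurability _ (RGenInftyO.measurableE R)) => //.
by move=> _ [_ [c ->] <-]; rewrite setTI; exact: half_measurable.
Qed.

Lemma open_measurable_RdL (U : set Rd) : open U -> measurable (U : set RdL).
Proof.
move=> oU.
pose C (z : 'rV[rat]_d * nat) : set RdL :=
  \bigcap_(i in [set: 'I_d])
    (fun x : RdL => x ord0 i) @^-1` ball (ratr (z.1 ord0 i) : R) z.2.+1%:R^-1.
have mC z : measurable (C z).
  apply: fin_bigcap_measurable => // i _.
  rewrite -[X in measurable X]setTI.
  apply: (measurable_coord i) => //.
  exact: (@measurable_ball).
suff -> : U = \bigcup_z (if `[< C z `<=` U >] then C z else set0).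
  apply: countable_bigcupT_measurable; first exact: countableP.
  by move=> z; case: ifP.
apply/seteqP; split=> x; last by move=> [z _]; case: asboolP => // CU /CU.
move=> Ux; have /nbhs_ballP[e /= e0 xeU] := open_nbhs_nbhs (conj oU Ux).
have e20 : 0 < e / 2 by rewrite divr_gt0.
have [n _ /(_ n (leqnn n)) /= ne] := near_infty_natSinv_lt (PosNum e20).
have qP i : exists q : rat, ball (ratr q : R) n.+1%:R^-1 (x ord0 i).
  have [q] := @rat_in_itvoo R (x ord0 i - n.+1%:R^-1) (x ord0 i) ltac:(by rewrite ltrBlDr ltrDl invr_gt0).
  rewrite in_itv/= => /andP[q1 q2]; exists q; rewrite /ball/= distrC.
  by rewrite ger0_norm ?subr_ge0 ?(ltW q2)// ltrBlDr -ltrBlDl.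
have [q qx] := choice qP.
pose z : 'rV[rat]_d * nat := (\row_i q i, n).
have Cx : C z x by move=> i _ /=; rewrite mxE.
exists z => //; case: asboolP => // -[] y Cy; apply: xeU.
split=> // k i; rewrite (ord1 k).
have /= := Cy i Logic.I; rewrite /z/= mxE => yq.
apply: (@le_ball _ _ _ (n.+1%:R^-1 + n.+1%:R^-1)).
  by rewrite [leRHS]splitr lerD// ltW.
exact: ball_triangle (ball_sym (qx i)) yq.
Qed.

Let lebesgue_outer_box a b : (lebesgue_outer (box a b) < +oo)%E.
Proof.
apply: (@le_lt_trans _ _ (vol a b)%:E); last exact: ltry.
apply: le_trans (box_cost_box a b).
apply: ereal_inf_lbound; exists (fun k : nat => if k == 0%N then box a b else set0).
  split=> [k|x abx]; first exact: sub_sigma_algebra.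
  by exists 0%N.
apply: lim_near_cst => //; near=> n.
rewrite big_ltn; last by near: n; exists 1%N.
rewrite big_nat_cond big1 ?adde0// => -[|k]//.
by rewrite box_cost0.
Unshelve. all: by end_near. Qed.

Lemma bounded_lebesgue_fin (A : set Rd) :
  bounded_set A -> (lebesgue_rV A < +oo)%E.
Proof.
move=> /ex_strict_bound_gt0[M M0 AM].
apply: le_lt_trans (lebesgue_outer_box (const_mx (- M)) (const_mx M)).
apply: le_outer_measure => x /AM /= xM i; rewrite !mxE.
suff : `|x ord0 i| < M by rewrite ltr_norml => /andP[/ltW -> ->].
apply: le_lt_trans xM.
rewrite [leRHS]/Num.norm/= mx_normrE.
exact: (le_bigmax _ (fun ij => `|x ij.1 ij.2|) (ord0, i)).
Qed.

End lebesgue_rV.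

(** * Bounded open sets and the spaces [L^p(Omega x Q)] *)

Record bounded_open (R : realType) (d : nat) := BoundedOpen {
  bopen_set :> set 'rV[R]_d ;
  bopen_open : open bopen_set ;
  bopen_bounded : bounded_set bopen_set }.
Arguments bopen_open {R d} b.
Arguments bopen_bounded {R d} b.

(** [L^r(Q)] is [L^r] of [RdL R d] for the Lebesgue measure restricted to [Q];
    accordingly, integrals over [Q] are integrals over the whole space with
    respect to [lebesgue_on Q]. *)
Definition lebesgue_on (R : realType) (d : nat) (Q : bounded_open R d) :
    set (RdL R d) -> \bar R :=
  mfrestr (f := lebesgue_rV (R := R) (d := d))
    (open_measurable_RdL (bopen_open Q))
    (bounded_lebesgue_fin (bopen_bounded Q)).

HB.instance Definition _ (R : realType) (d : nat) (Q : bounded_open R d) :=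
  FiniteMeasure.copy (lebesgue_on Q)
    (mfrestr (f := lebesgue_rV (R := R) (d := d))
      (open_measurable_RdL (bopen_open Q))
      (bounded_lebesgue_fin (bopen_bounded Q))).

Lemma EFin_ge1 (R : realType) (p : R) : 1 < p -> (1 <= p%:E)%E.
Proof. by rewrite lee_fin => /ltW. Qed.

(** The space [L^p(Omega x Q)]. *)
Definition Bspace dO (Omega : measurableType dO) (R : realType) (d : nat)
    (P : probability Omega R) (Q : bounded_open R d) (p : R) (p1 : 1 < p) :=
  LspaceType (P \x lebesgue_on Q)%E (EFin_ge1 p1).

HB.instance Definition _ dO (Omega : measurableType dO) (R : realType) (d : nat)
    (P : probability Omega R) (Q : bounded_open R d) (p : R) (p1 : 1 < p) :=
  NormedModule.copy (Bspace P Q p1)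
    (LspaceType (P \x lebesgue_on Q)%E (EFin_ge1 p1)).

(** * Weak topology of a normed module, and its Borel sigma-algebra *)

Definition dual (R : realType) (V : normedModType R) :=
  {f : {scalar V} | continuous f}.

Definition weak_space (R : realType) (V : normedModType R) :=
  initial_topology
    (fun v : V => (fun f : dual V => sval f v) : prod_topology (fun _ => R^o)).

HB.instance Definition _ (R : realType) (V : normedModType R) :=
  PointedTopological.on (weak_space V).

Definition weak_borel (R : realType) (V : normedModType R) :=
  g_sigma_algebraType (@open (weak_space V)).

HB.instance Definition _ (R : realType) (V : normedModType R) :=
  Measurable.on (weak_borel V).

(** * Bochner integral *)

(** A finite list of pairs (set, value) stands for a simple function. *)
Definition simple_eval (T : Type) (R : realType) (V : lmodType R)
    (s : seq (set T * V)) (t : T) : V :=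
  \sum_(a <- s) \1_(a.1) t *: a.2.

Definition simple_integral dT (T : measurableType dT) (R : realType)
    (V : lmodType R) (mu : set T -> \bar R) (s : seq (set T * V)) : V :=
  \sum_(a <- s) fine (mu a.1) *: a.2.

Definition is_bochner_integral dT (T : measurableType dT) (R : realType)
    (V : normedModType R) (mu : {measure set T -> \bar R})
    (f : T -> V) (I : V) : Prop :=
  exists s : nat -> seq (set T * V),
    [/\ forall k, {in s k, forall a, measurable a.1 /\ (mu a.1 < +oo)%E},
        {ae mu, forall t, simple_eval (s k) t @[k --> \oo] --> f t},
        (\int[mu]_t (`|f t - simple_eval (s k) t|)%:E)%E @[k --> \oo] --> 0%E
      & simple_integral mu (s k) @[k --> \oo] --> I].

(** * The dynamical system and the test functions *)

Definition countably_generated dO (Omega : measurableType dO) : Prop :=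
  exists G : nat -> set Omega, (@measurable _ Omega) = <<s range G >>.

Record ergodic_system dO (Omega : measurableType dO) (R : realType) (d : nat)
    (P : probability Omega R) (tau : 'rV[R]_d -> Omega -> Omega) : Prop := {
  sys_id : tau 0 = id ;
  sys_add : forall x y, tau (x + y) = tau x \o tau y ;
  sys_measurable : forall x, measurable_fun setT (tau x) ;
  sys_preserving : forall x A, measurable A -> P (tau x @` A) = P A ;
  sys_joint : measurable_fun setT (fun z : Omega * RdL R d => tau z.2 z.1) ;
  sys_ergodic : forall A, measurable A -> (forall x, tau x @` A = A) ->
    P A = 0%E \/ P A = 1%E }.

Section two_scale.
Context dO (Omega : measurableType dO) (R : realType) (d : nat).
Variables (P : probability Omega R) (tau : 'rV[R]_d -> Omega -> Omega).
Variables (Q : bounded_open R d) (p : R) (p1 : 1 < p).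

Local Notation X := (Omega * RdL R d)%type.
Local Notation B := (Bspace P Q p1).
Implicit Types (DO : set (Omega -> R)) (DQ : set (RdL R d -> R)).
Implicit Types (phi psi : X -> R) (D : set (X -> R)).

(** Elements of [C(closure Q)] are represented by their extension by zero,
    so that [1_Q] is the indicator function of [closure Q]. *)
Record test_families DO DQ : Prop := {
  testO_countable : countable DO ;
  testO_bounded : forall f, DO f ->
    measurable_fun setT f /\ exists M : R, forall w, `|f w| <= M ;
  testO_one : DO (cst 1) ;
  testO_dense : forall f, f \in Lfun P 1%E -> forall e : R, 0 < e ->
    exists2 g, DO g & (Lnorm P 1 (fun w => (f w - g w)%:E) < e%:E)%E ;
  testQ_countable : countable DQ ;
  testQ_continuous : forall f, DQ f ->
    {within closure Q, continuous (f : 'rV[R]_d -> R)} /\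
    (forall x, ~ closure Q x -> f x = 0) ;
  testQ_one : DQ \1_(closure Q) ;
  testQ_dense : forall f, f \in Lfun (lebesgue_on Q) 1%E ->
    forall e : R, 0 < e ->
    exists2 g, DQ g & 
      (Lnorm (lebesgue_on Q) 1 (fun x => (f x - g x)%:E) < e%:E)%E }.

Definition tensors DO DQ : set (X -> R) :=
  [set phi | exists f g, [/\ DO f, DQ g & phi = fun z => f z.1 * g z.2]].

Definition Rspan (A : set (X -> R)) : set (X -> R) :=
  [set phi | exists n (c : 'I_n -> R) (a : 'I_n -> X -> R),
    (forall i, A (a i)) /\ phi = fun z => \sum_(i < n) c i * a i z].

Definition Qspan (A : set (X -> R)) : set (X -> R) :=
  [set phi | exists n (c : 'I_n -> rat) (a : 'I_n -> X -> R),
    (forall i, A (a i)) /\ phi = fun z => \sum_(i < n) ratr (c i) * a i z].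

Definition Tstar (eps : R) phi : X -> R :=
  fun z => phi (tau (eps^-1 *: (z.2 : 'rV[R]_d)) z.1, z.2).

Definition mean_integral phi : R :=
  \int[P]_w (\int[lebesgue_on Q]_x phi (w, x)).

Definition product_norm (r : R) phi : \bar R :=
  Lnorm (P \x lebesgue_on Q)%E r%:E (EFin \o phi).

Definition admissible_points DO DQ (Omega0 : set Omega) : Prop :=
  [/\ measurable Omega0, P Omega0 = 1%E &
    forall phi psi w, tensors DO DQ phi -> tensors DO DQ psi -> Omega0 w ->
      (forall r, r = p \/ r = p / (p - 1) ->
        (limf_esup (fun eps => Lnorm (lebesgue_on Q) r%:E
           (fun x => (Tstar eps phi (w, x))%:E)) 0^'+ <= product_norm r phi)%E)
      /\ (\int[lebesgue_on Q]_x Tstar eps (phi \* psi) (w, x)) @[eps --> 0^'+]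
           --> mean_integral (phi \* psi)].

Definition enumerates_normalized (D0 : set (X -> R)) (phi_ : nat -> X -> R) :=
  range phi_ = [set psi | exists phi, [/\ D0 phi,
    product_norm (p / (p - 1)) phi <> 0%E &
    psi = fun z => phi z / fine (product_norm (p / (p - 1)) phi)]].

(** ** Functionals on the span of the test functions *)

Definition Lin D : set ((X -> R) -> R) :=
  [set U | forall a phi psi, D phi -> D psi ->
    U (fun z => a * phi z + psi z) = a * U phi + U psi].

Definition dist_Lin (phi_ : nat -> X -> R) (U V : (X -> R) -> R) : R :=
  limn (series (fun j => 2^-1 ^+ j *
    (`|U (phi_ j) - V (phi_ j)| / (`|U (phi_ j) - V (phi_ j)| + 1)))).

Definition closure_Lin D (phi_ : nat -> X -> R) (S : set ((X -> R) -> R)) :=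
  [set U | Lin D U /\ forall e : R, 0 < e ->
    exists2 V, S V & dist_Lin phi_ U V < e].

Definition Jeps (eps : R) (w : Omega) (u : RdL R d -> R) : (X -> R) -> R :=
  fun phi => \int[lebesgue_on Q]_x (u x * Tstar eps phi (w, x)).

Definition J0 (u : B) : (X -> R) -> R :=
  fun phi => mean_integral (fun z => u z * phi z).

(** Here and below, a sequence indexed by [eps -> 0] is given as two sequences
    [eps_ : nat -> R] and [u_]. Boundedness of [u_] is not required: the
    realizations of a bounded sequence in [L^p(Omega x Q)] need not be bounded
    in [L^p(Q)]. *)
Definition cluster_points D (phi_ : nat -> X -> R) (eps_ : nat -> R)
    (w : Omega) (u_ : nat -> RdL R d -> R) : set B :=
  [set u | forall k : nat, closure_Lin D phi_
    [set Jeps (eps_ j) w (u_ j) | j in [set j | eps_ j < k.+1%:R^-1]] (J0 u)].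

Definition quenched_limit D (eps_ : nat -> R) (w : Omega)
    (u_ : nat -> RdL R d -> R) (u : B) : Prop :=
  forall phi, D phi -> Jeps (eps_ k) w (u_ k) phi @[k --> \oo] --> J0 u phi.

(** Quenched two-scale convergence; [quenched_limit] is this notion without the
    boundedness requirement. *)
Definition quenched_two_scale D (eps_ : nat -> R) (w : Omega)
    (u_ : nat -> RdL R d -> R) (u : B) : Prop :=
  (exists C : R, forall k,
    (Lnorm (lebesgue_on Q) p%:E (EFin \o u_ k) <= C%:E)%E) /\
  quenched_limit D eps_ w u_ u.

(** ** Two-scale convergence in the mean *)

(** The map [T_eps]: the isometric isomorphism extending composition with the
    inverse shear on the algebraic tensor product. *)
Definition is_unfolding (eps : R) (T : {linear B -> B}) : Prop :=
  [/\ forall u, `|T u| = `|u|, bijective T &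
    forall n (f : 'I_n -> Omega -> R) (g : 'I_n -> RdL R d -> R) (u : B),
      (forall i, f i \in Lfun P p%:E) ->
      (forall i, g i \in Lfun (lebesgue_on Q) p%:E) ->
      (u : X -> R) = (fun z => \sum_(i < n) f i z.1 * g i z.2)
        %[ae (P \x lebesgue_on Q)%E] ->
      (T u : X -> R) =
        (fun z => \sum_(i < n)
          f i (tau (- (eps^-1 *: (z.2 : 'rV[R]_d))) z.1) * g i z.2)
        %[ae (P \x lebesgue_on Q)%E]].

Definition mean_two_scale (eps_ : nat -> R) (u_ : nat -> B) (u : B) : Prop :=
  exists T_ : nat -> {linear B -> B},
    (forall k, is_unfolding (eps_ k) (T_ k)) /\
    (T_ k (u_ k) : weak_space B) @[k --> \oo] --> (u : weak_space B).

(** A choice of representative all of whose realizations are in [L^p(Q)]. *)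
Definition representative (u : B) (f : X -> R) : Prop :=
  [/\ measurable_fun setT f,
      forall w, (fun x => f (w, x)) \in Lfun (lebesgue_on Q) p%:E &
      (u : X -> R) = f %[ae (P \x lebesgue_on Q)%E]].

End two_scale.

(** A Young measure on [Bspace P Q p1] is a probability kernel from [Omega] to
    [weak_borel (Bspace P Q p1)]. *)
Definition is_barycenter dO (Omega : measurableType dO) (R : realType)
    (P : probability Omega R) (V : normedModType R)
    (nu : R.-pker Omega ~> weak_borel V) (u : V) : Prop :=
  exists2 b : Omega -> V,
    {ae P, forall w, is_bochner_integral (nu w)
                       (fun v : weak_borel V => (v : V)) (b w)} &
    is_bochner_integral P b u.

(* Main.v *)
Require Import Defs.
From HB Require Import structures.
From mathcomp Require Import all_boot all_order all_algebra.
From mathcomp Require Import finmap.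
From mathcomp Require Import all_classical all_reals all_analysis.
From mathcomp Require Import measurable_realfun ess_sup_inf.
From mathcomp Require Import ring lra.

Set Implicit Arguments.
Unset Strict Implicit.
Unset Printing Implicit Defensive.

Import Order.TTheory GRing.Theory Num.Theory numFieldNormedType.Exports.
Import HBNNSimple.

Local Open Scope classical_set_scope.
Local Open Scope ring_scope.

(** The Young measure is the law of a random limit.  Pass to a subsequence along
    which the norms of [u_k] and their pairings with the oscillating test
    functions converge, and along which, for almost every [w], the [L^q(Q)]
    norms of [T*f (w, .)] converge to the norm of [f], for all [f] in a countable
    space of bounded functions that contains the test functions and is dense in
    every [L^r].  The last point is a mean ergodic theorem, which the limits at
    the points of [Omega0] imply by density and stationarity.

    Let [J_k w] denote the functional [f |-> int_Q u_k(w, x) T*f(w, x) dx].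
    There are convex weights [a n] supported on [n <= k < N n] such that the laws of
    [J_k w] for [k] drawn from [a n] converge for almost every [w], and by
    Skorokhod's coupling there are indices [kap n (w, t) >= n], with [t] uniform
    on [0 <= t < 1], such that [k = kap n (w, t)] has law [a n] and [J_k w f]
    converges for all [f] as [n] tends to infinity.  By Fatou's lemma the limiting
    functional is bounded, so by Riesz's theorem it is the pairing with some
    [V (w, t)] in [L^p].  The Young measure at [w] is the law of [V (w, .)]; on
    a null set of [w] the realizations and [V] are replaced by [0].

    Since [kap n >= n], the values of [V (w, .)] are cluster points.  Fatou's
    lemma gives the inequality between the norms, and uniform integrability
    identifies the barycenter as the mean two-scale limit.  If the law of
    [V (w, .)] is a Dirac mass at [v w], then the averages with weights [a n] of
    the expected truncated distances between [J_k w f] and its limit tend to [0];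
    hence so does some sequence of these expectations, and a subsequence
    converges almost everywhere. *)

(** * Norms in [L^r] of a finite measure *)

(** Convex weights are needed because the values of a sequence at a fixed [w] may oscillate, and no
    single subsequence need settle them at almost every [w]. In a Hilbert space, however, convex
    combinations of tails converge in norm; applied to the indicators of [z k w <= q], this yields
    weighted distribution functions that converge almost everywhere. The quantile coupling handles
    one real sequence, so the countably many pairings are packed into one point of the Cantor set,
    from which the behaviour of each is recovered. Realizations need not be bounded in [L^p(Q)] at a
    given [w]; only the lower limit of their norms along random indices is finite almost surely.
    Pairings are therefore first shown to converge in the extended reals, and then to have finite
    limits. Bounding the limiting functional requires convergence of the norms of all test
    functions, whereas the bounds assumed on [Omega0] concern tensors only. Truncations are included
    among the test functions because an approximation in [L^1] does not control [L^q] norms. *)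

Section bounded_measurable.
Context d (T : measurableType d) (R : realType).
Variable mu : {finite_measure set T -> \bar R}.
Implicit Types (f g : T -> R) (r : R).

Definition bddm f := measurable_fun setT f /\ exists M : R, forall x, `|f x| <= M.

Definition nm r f : R := fine (Lnorm mu r%:E (EFin \o f)).

Lemma measurable_normpow r f : measurable_fun setT f ->
  measurable_fun setT (fun x => `|f x| `^ r).
Proof.
move=> mf; apply: (@measurableT_comp _ _ _ _ _ _ (@powR R ^~ r)) => //.
exact: measurableT_comp.
Qed.

Lemma Lfun_measurable r f : f \in Lfun mu r%:E -> measurable_fun setT f.
Proof. by move=> /sub_Lfun_mfun; rewrite inE. Qed.

Lemma nmE r f : f \in Lfun mu r%:E -> (nm r f)%:E = Lnorm mu r%:E (EFin \o f).
Proof.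
move=> /sub_Lfun_finLfun; rewrite inE /= => ff.
by rewrite /nm fineK// ge0_fin_numE// Lnorm_ge0.
Qed.

Lemma nm_ge0 r f : 0 <= nm r f.
Proof. by rewrite fine_ge0// Lnorm_ge0. Qed.

Lemma Lfun_pow r f : 1 <= r -> measurable_fun setT f ->
  (\int[mu]_x (`|f x| `^ r)%:E < +oo)%E -> f \in Lfun mu r%:E.
Proof.
move=> r1 mf foo; rewrite inE; apply/andP; split; rewrite inE//=.
rewrite /finite_norm unlock /=; apply: poweR_lty.
by under eq_integral do rewrite /= ?poweR_EFin.
Qed.

Lemma nm_pow r f : 1 <= r -> f \in Lfun mu r%:E ->
  nm r f `^ r = \int[mu]_x (`|f x| `^ r).
Proof.
move=> r1 fL; have r0 : r != 0 by rewrite gt_eqF// (lt_le_trans ltr01).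
apply: EFin_inj; rewrite -poweR_EFin nmE// poweR_Lnorm//.
have /integrable_fin_num := Lfun_integrable r1 fL.
by move=> /(_ measurableT) /fineK <-.
Qed.

Lemma LnormE r f : f \in Lfun mu r%:E -> 1 <= r ->
  (\int[mu]_x (`|f x| `^ r)%:E)%E = (nm r f `^ r)%:E.
Proof.
move=> fL r1; rewrite nm_pow// fineK//.
by have /integrable_fin_num := Lfun_integrable r1 fL; exact.
Qed.

Lemma bddm_integrable f : bddm f -> mu.-integrable setT (EFin \o f).
Proof.
move=> [mf [M fM]]; apply: measurable_bounded_integrable => //.
  by rewrite ltey_eq fin_num_measure.
exists M; split; first by rewrite num_real.
by move=> y My x _; apply: le_trans (fM x) (ltW My).
Qed.

Lemma bddm_Lfun r f : 1 <= r -> bddm f -> f \in Lfun mu r%:E.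
Proof.
move=> r1 [mf [M fM]]; apply: Lfun_pow => //.
have r0 : 0 <= r by rewrite (le_trans ler01).
have : mu.-integrable setT (EFin \o (fun x => `|f x| `^ r)).
  apply: bddm_integrable; split.
    exact: measurable_normpow.
  exists (M `^ r) => x; rewrite ger0_norm ?powR_ge0//.
  by apply: ge0_ler_powR => //; rewrite nnegrE ?(le_trans _ (fM x)).
move=> /integrableP[_]; apply: le_lt_trans.
apply: ge0_le_integral => //=.
- exact/measurable_EFinP/measurable_normpow.
- by apply/measurable_EFinP/measurableT_comp => //; exact: measurable_normpow.
- by move=> x _; rewrite lee_fin ler_norm.
Qed.

Lemma LfunZD r a f g : 1 <= r -> f \in Lfun mu r%:E -> g \in Lfun mu r%:E ->
  (fun x => a * f x + g x) \in Lfun mu r%:E.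
Proof.
by move=> r1 fL gL; have [_ /(_ a f g fL gL)] := @Lfun_submod_closed _ _ _ mu r%:E r1.
Qed.

Lemma LfunD r f g : 1 <= r -> f \in Lfun mu r%:E -> g \in Lfun mu r%:E ->
  (fun x => f x + g x) \in Lfun mu r%:E.
Proof.
move=> r1 fL gL; rewrite (_ : (fun x => _) = fun x => 1 * f x + g x) ?LfunZD//.
by apply/funext => x; rewrite mul1r.
Qed.

Lemma LfunB r f g : 1 <= r -> f \in Lfun mu r%:E -> g \in Lfun mu r%:E ->
  (fun x => f x - g x) \in Lfun mu r%:E.
Proof.
move=> r1 fL gL; rewrite (_ : (fun x => _) = fun x => -1 * g x + f x) ?LfunZD//.
by apply/funext => x; rewrite mulN1r addrC.
Qed.

Lemma LfunZ r a f : 1 <= r -> f \in Lfun mu r%:E ->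
  (fun x => a * f x) \in Lfun mu r%:E.
Proof.
move=> r1 fL; rewrite (_ : (fun x => _) = fun x => (a - 1) * f x + f x) ?LfunZD//.
by apply/funext => x; rewrite mulrBl mul1r subrK.
Qed.

Lemma nmD r f g : 1 <= r -> f \in Lfun mu r%:E -> g \in Lfun mu r%:E ->
  nm r (fun x => f x + g x) <= nm r f + nm r g.
Proof.
move=> r1 fL gL; rewrite -lee_fin EFinD !nmE ?LfunD//.
by apply: minkowski_EFin => //; exact: (@Lfun_measurable r).
Qed.

Lemma nmZ r a f : 1 <= r -> f \in Lfun mu r%:E ->
  nm r (fun x => a * f x) = `|a| * nm r f.
Proof.
move=> r1 fL.
have r1' : (1 <= r%:E)%E by [].
have := LnormZ (Lfun_Sub r1' fL) a.
rewrite /= -nmE ?LfunZ// => /(congr1 fine).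
by rewrite -[in X in _ = X](nmE fL)//.
Qed.

Lemma nmN r f : 1 <= r -> f \in Lfun mu r%:E -> nm r (fun x => - f x) = nm r f.
Proof.
move=> r1 fL; rewrite -[RHS]mul1r -(normrN1 R) -nmZ//.
by congr (nm r _); apply/funext => x; rewrite mulN1r.
Qed.

Lemma nmBC r f g : 1 <= r -> f \in Lfun mu r%:E -> g \in Lfun mu r%:E ->
  nm r (fun x => f x - g x) = nm r (fun x => g x - f x).
Proof.
move=> r1 fL gL; rewrite -nmN ?LfunB//.
by congr (nm r _); apply/funext => x; rewrite opprB.
Qed.

Lemma nm_triangle r f g h : 1 <= r -> f \in Lfun mu r%:E -> g \in Lfun mu r%:E ->
  h \in Lfun mu r%:E ->
  nm r (fun x => f x - h x) <= nm r (fun x => f x - g x) + nm r (fun x => g x - h x).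
Proof.
move=> r1 fL gL hL; rewrite (_ : (fun x => f x - h x) =
  fun x => (f x - g x) + (g x - h x)); last by apply/funext => x; rewrite addrA subrK.
by apply: nmD; rewrite ?LfunB.
Qed.

Lemma nm_ae r f g : 1 <= r -> measurable_fun setT f -> measurable_fun setT g ->
  (f = g %[ae mu]) -> nm r f = nm r g.
Proof.
by move=> r1 mf mg fg; congr fine; apply: eq_ae_Lnorm => //; rewrite lee_fin.
Qed.

Lemma Lfun_ae r f g : 1 <= r -> measurable_fun setT g ->
  (f = g %[ae mu]) -> f \in Lfun mu r%:E -> g \in Lfun mu r%:E.
Proof.
move=> r1 mg fg fL.
have mf := Lfun_measurable fL; apply: Lfun_pow => //.
have := Lfun_integrable r1 fL; move=> /integrableP[m1 m2].
have mE := (measurable_EFinP _ _).2 (measurable_normpow r mg).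
apply: le_lt_trans m2; rewrite le_eqVlt; apply/orP; left; apply/eqP.
apply: ae_eq_integral => //.
  by under eq_fun do rewrite gee0_abs ?lee_fin ?powR_ge0//.
apply: filterS fg => x /= /(_ Logic.I) -> _.
by rewrite [in RHS]ger0_norm ?powR_ge0.
Qed.

Lemma bddmD f g : bddm f -> bddm g -> bddm (fun x => f x + g x).
Proof.
move=> [mf [M fM]] [mg [N gN]]; split; first exact: measurable_funD.
by exists (M + N) => x; rewrite (le_trans (ler_normD _ _))// lerD.
Qed.

Lemma bddmZ a f : bddm f -> bddm (fun x => a * f x).
Proof.
move=> [mf [M fM]]; split; first exact: measurable_funM.
by exists (`|a| * M) => x; rewrite normrM ler_wpM2l.
Qed.

Lemma bddmB f g : bddm f -> bddm g -> bddm (fun x => f x - g x).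
Proof.
move=> bf bg; rewrite (_ : (fun x => _) = fun x => f x + -1 * g x).
  by apply: bddmD => //; exact: bddmZ.
by apply/funext => x; rewrite mulN1r.
Qed.

Lemma bddmM f g : bddm f -> bddm g -> bddm (fun x => f x * g x).
Proof.
move=> [mf [M fM]] [mg [N gN]]; split; first exact: measurable_funM.
by exists (M * N) => x; rewrite normrM ler_pM.
Qed.

Lemma bddm_indic A : measurable A -> bddm \1_A.
Proof.
move=> mA; split; first exact: measurable_indic.
by exists 1 => x; rewrite indicE; case: (x \in A); rewrite ?normr1 ?normr0.
Qed.

Lemma bddm_cst a : bddm (cst a).
Proof. by split => //; exists `|a|. Qed.

Lemma integrable_bddmM f g : bddm f -> mu.-integrable setT (EFin \o g) ->
  mu.-integrable setT (fun x => (f x * g x)%:E).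
Proof.
move=> [mf [M fM]] ig.
apply: (@integrableMr _ _ _ mu setT measurableT f (EFin \o g)) => //.
exists M; split; first by rewrite num_real.
by move=> y My x _; apply: le_trans (fM x) (ltW My).
Qed.

End bounded_measurable.

(** * Hoelder's inequality and dominated convergence for real-valued integrals *)

Section hoelder_real.
Context d (T : measurableType d) (R : realType).
Variable mu : {finite_measure set T -> \bar R}.
Implicit Types (f g : T -> R) (p q r : R).

Lemma hoelder_integrable p q f g : 1 < p -> 1 < q -> p^-1 + q^-1 = 1 ->
  f \in Lfun mu p%:E -> g \in Lfun mu q%:E ->
  mu.-integrable setT (fun x => (f x * g x)%:E).
Proof.
move=> p1 q1 pq fL gL.
have mf := Lfun_measurable fL; have mg := Lfun_measurable gL.
apply/integrableP; split; first exact/measurable_EFinP/measurable_funM.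
have := hoelder mu mf mg (lt_trans ltr01 p1) (lt_trans ltr01 q1) pq.
rewrite Lnorm1 -!nmE// => h; apply: le_lt_trans h _.
by rewrite -EFinM ltry.
Qed.

Lemma hoelder_le p q f g : 1 < p -> 1 < q -> p^-1 + q^-1 = 1 ->
  f \in Lfun mu p%:E -> g \in Lfun mu q%:E ->
  `|\int[mu]_x (f x * g x)| <= nm mu p f * nm mu q g.
Proof.
move=> p1 q1 pq fL gL.
have mf := Lfun_measurable fL; have mg := Lfun_measurable gL.
have ifg := hoelder_integrable p1 q1 pq fL gL.
rewrite -lee_fin EFin_normr_Rintegral//.
apply: (le_trans (le_abse_integral mu measurableT _)).
  by case/integrableP : ifg.
have := hoelder mu mf mg (lt_trans ltr01 p1) (lt_trans ltr01 q1) pq.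
by rewrite Lnorm1 -!nmE.
Qed.

Lemma RintegralDZ a f g : mu.-integrable setT (EFin \o f) ->
  mu.-integrable setT (EFin \o g) ->
  \int[mu]_x (a * f x + g x) = a * \int[mu]_x f x + \int[mu]_x g x.
Proof.
move=> If Ig; rewrite RintegralD//; last exact: (integrableZl measurableT a If).
by rewrite RintegralZl.
Qed.

Lemma ae_eq_Rintegral f g : measurable_fun setT f -> measurable_fun setT g ->
  (f = g %[ae mu]) -> \int[mu]_x f x = \int[mu]_x g x.
Proof.
move=> mf mg fg; congr fine; apply: ae_eq_integral => //; try exact/measurable_EFinP.
by apply: filterS fg => x /= ->.
Qed.

Lemma dominated_Rintegral (f_ : nat -> T -> R) f g :
  (forall n, measurable_fun setT (f_ n)) -> measurable_fun setT f ->
  {ae mu, forall x, f_ n x @[n --> \oo] --> f x} ->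
  mu.-integrable setT (EFin \o g) ->
  (forall n x, `|f_ n x| <= g x) ->
  \int[mu]_x f_ n x @[n --> \oo] --> \int[mu]_x f x.
Proof.
move=> mf_ mf cf ig fg.
have [If _ c] := @dominated_convergence _ _ _ mu setT measurableT
  (fun n => EFin \o f_ n) (EFin \o f) (EFin \o g)
  (fun n => (measurable_EFinP _ _).2 (mf_ n)) ((measurable_EFinP _ _).2 mf)
  ltac:(by apply: filterS cf => x /= cx _; apply/fine_cvgP; split; [exact: nearW|exact: cx]) ig
  ltac:(by apply: nearW => x n _ /=; rewrite lee_fin).
apply: fine_cvg; rewrite fineK; first exact: c.
exact: (@integrable_fin_num _ _ _ mu setT measurableT _ If).
Qed.

Lemma dominated_nm r (f_ : nat -> T -> R) f g : 1 <= r ->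
  (forall n, measurable_fun setT (f_ n)) -> measurable_fun setT f ->
  {ae mu, forall x, f_ n x @[n --> \oo] --> f x} ->
  g \in Lfun mu r%:E ->
  (forall n x, `|f_ n x - f x| <= g x) ->
  nm mu r (fun x => f_ n x - f x) @[n --> \oo] --> 0.
Proof.
move=> r1 mf_ mf cf gL fg.
have r0 : 0 < r by rewrite (lt_le_trans ltr01).
have g0 x : 0 <= g x by rewrite (le_trans _ (fg 0%N x)).
have fL n : (fun x => f_ n x - f x) \in Lfun mu r%:E.
  apply: Lfun_pow => //; first exact: measurable_funB.
  have /integrableP[_] := Lfun_integrable r1 gL; apply: le_lt_trans.
  apply: ge0_le_integral => //=.
  - by apply/measurable_EFinP/measurable_normpow/measurable_funB.
  - apply/measurable_EFinP/measurableT_comp => //; apply: measurable_normpow.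
    exact: (Lfun_measurable gL).
  - move=> x _; rewrite lee_fin (ger0_norm (powR_ge0 _ _)).
    by rewrite ge0_ler_powR ?nnegrE ?(ltW r0)// (ger0_norm (g0 x)).
have c : \int[mu]_x (`|f_ n x - f x| `^ r) @[n --> \oo] --> (0 : R).
  rewrite (_ : 0 = \int[mu]_x (cst 0 : T -> R) x); last by rewrite /Rintegral integral0.
  apply: (@dominated_Rintegral _ _ (fun x => `|g x| `^ r)) => //.
  - by move=> n; apply/measurable_normpow/measurable_funB.
  - apply: filterS cf => x cx.
    rewrite -[X in _ --> X](@powR0 R r) ?gt_eqF//.
    have h : continuous_at 0 (fun t : R => `|t| `^ r).
      apply/(@cvgrPdist_le _ R^o) => e e0.
      have := @nbhs0_le R R^o _ (powR_gt0 r^-1 e0); apply: filterS => t tle.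
      rewrite normr0 powR0 ?gt_eqF// sub0r normrN ger0_norm ?powR_ge0//.
      have -> : e = (e `^ r^-1) `^ r by rewrite -powRrM mulVf ?gt_eqF// powRr1 ?ltW.
      by apply: ge0_ler_powR; rewrite ?nnegrE ?powR_ge0 ?(ltW r0).
    have := @cvg_comp _ _ _ (fun n => f_ n x - f x) (fun t : R => `|t| `^ r) \oo (nbhs 0) _.
    rewrite /continuous_at normr0 in h; apply; last exact: h.
    by apply/subr_cvg0.
  - exact: (Lfun_integrable r1 gL).
  - move=> n x; rewrite (ger0_norm (powR_ge0 _ _)).
    by rewrite ge0_ler_powR ?nnegrE ?(ltW r0)// (ger0_norm (g0 x)).
apply/(@cvgrPdist_le _ R^o) => e e0.
have er0 : 0 < e `^ r by exact: powR_gt0.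
move/(@cvgrPdist_le _ R^o) : c => /(_ _ er0); apply: filterS => n.
rewrite !sub0r !normrN -nm_pow// !ger0_norm ?powR_ge0 ?nm_ge0// => h.
rewrite leNgt; apply/negP => en; move: h; apply/negP; rewrite -ltNge.
by apply: gt0_ltr_powR => //; rewrite nnegrE ?nm_ge0 ?(ltW e0).
Qed.

End hoelder_real.

(** * Riesz representation *)

(** Rational scalars keep such a set countable. Density is required for all exponents because one
    set serves both to approximate vectors of [L^p] and to test functionals on [L^q]; boundedness
    puts its members in every [L^r]. *)
Record test_space d (T : measurableType d) (R : realType)
    (mu : {finite_measure set T -> \bar R}) (D : set (T -> R)) : Prop := {
  ts_countable : countable D ;
  ts_bddm : forall f, D f -> bddm f ;
  ts_add : forall f g, D f -> D g -> D (fun x => f x + g x) ;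
  ts_scale : forall (c : rat) f, D f -> D (fun x => ratr c * f x) ;
  ts_dense : forall r f, 1 <= r -> bddm f -> forall e : R, 0 < e ->
    exists2 g, D g & nm mu r (fun x => f x - g x) < e }.

Section riesz.
Context d (T : measurableType d) (R : realType).
Variables (mu : {finite_measure set T -> \bar R}) (p q : R) (D : set (T -> R)).
Variables (U : (T -> R) -> R) (C : R).
Hypotheses (p1 : 1 < p) (q1 : 1 < q) (pq : p^-1 + q^-1 = 1).
Hypothesis DT : test_space mu D.
Hypothesis UD : forall f g, D f -> D g -> U (fun x => f x + g x) = U f + U g.
Hypothesis UZ : forall (c : rat) f, D f -> U (fun x => ratr c * f x) = ratr c * U f.
Hypothesis C0 : 0 <= C.
Hypothesis UC : forall f, D f -> `|U f| <= C * nm mu q f.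

Local Notation N := (nm mu q).
Let q1w : 1 <= q := ltW q1.
Let q0 : 0 < q := lt_trans ltr01 q1.
Let DL f : D f -> f \in Lfun mu q%:E.
Proof. by move=> Df; apply: bddm_Lfun => //; exact: (ts_bddm DT). Qed.
Let bL f : bddm f -> f \in Lfun mu q%:E.
Proof. exact: bddm_Lfun. Qed.

(* McShane's extension, to all bounded measurable functions, of the
   C-Lipschitz map U. *)
Let ext (f : T -> R) : R := sup [set U g - C * N (fun x => f x - g x) | g in D].

Let USub f g : D f -> D g -> `|U f - U g| <= C * N (fun x => f x - g x).
Proof.
move=> Df Dg.
have Dg' := ts_scale DT (-1) Dg.
have E : (fun x => f x - g x) = (fun x => f x + ratr (-1) * g x).
  by apply/funext => x; rewrite rmorphN1 mulN1r.
have -> : U f - U g = U (fun x => f x - g x).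
  by rewrite E UD// UZ// rmorphN1 mulN1r.
by apply: UC; rewrite E; exact: (ts_add DT).
Qed.

(** The Lipschitz bound on [U] makes [U g] plus [C] times the distance an upper bound of the set
    whose supremum is [ext f]; the contribution of [g] itself gives the lower bound. *)
Let ext_bound f g : bddm f -> D g ->
  `|ext f - U g| <= C * N (fun x => f x - g x).
Proof.
move=> bf Dg.
have ub : ubound [set U h - C * N (fun x => f x - h x) | h in D]
    (U g + C * N (fun x => f x - g x)).
  move=> _ [h Dh <-]; rewrite lerBlDr -addrA addrC -lerBlDr.
  apply: le_trans (ler_norm _) _; apply: le_trans (USub Dh Dg) _.
  rewrite -mulrDr ler_wpM2l// addrC (nmBC q1w (bL bf) (DL Dh)).
  exact: (nm_triangle q1w (DL Dh) (bL bf) (DL Dg)).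
have g_in : [set U h - C * N (fun x => f x - h x) | h in D]
    (U g - C * N (fun x => f x - g x)) by exists g.
rewrite ler_norml; apply/andP; split.
  rewrite lerBrDl; apply: ub_le_sup => //.
  by exists (U g + C * N (fun x => f x - g x)).
by rewrite lerBlDl; apply: ge_sup => //; exists (U g - C * N (fun x => f x - g x)).
Qed.

(** Density leaves a single candidate for the value at [f], whatever the constant [K]. [ext_U] and
    the rational homogeneity of [ext] follow by checking such an estimate. *)
Let ext_uniq f c K : bddm f -> 0 <= K ->
  (forall g, D g -> `|c - U g| <= K * N (fun x => f x - g x)) -> c = ext f.
Proof.
move=> bf K0 cU; apply/eqP; rewrite -subr_eq0 -normr_eq0 eq_le normr_ge0 andbT.
apply/ler_addgt0Pr => e e0; rewrite add0r.
have KC : 0 < K + C + 1 by rewrite ltr_pwDr// addr_ge0.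
have [g Dg ge] := ts_dense DT q1w bf (divr_gt0 e0 KC).
have -> : c - ext f = (c - U g) - (ext f - U g) by rewrite opprB addrA subrK.
apply: le_trans (ler_normB _ _) _.
apply: le_trans (lerD (cU g Dg) (ext_bound bf Dg)) _.
rewrite -mulrDl; apply: le_trans (_ : (K + C + 1) * N (fun x => f x - g x) <= _).
  by rewrite ler_wpM2r ?nm_ge0// lerDl.
by rewrite mulrC -ler_pdivlMr// ltW.
Qed.

Let ext_U f : D f -> ext f = U f.
Proof.
move=> Df; apply/esym/(@ext_uniq _ _ C) => //; first exact: (ts_bddm DT).
by move=> g Dg; exact: USub.
Qed.

Let ext_le f : bddm f -> `|ext f| <= C * N f.
Proof.
move=> bf; apply/ler_addgt0Pr => e e0.
have C1 : 0 < 2 * C + 1 by rewrite ltr_wpDl// mulr_ge0.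
have [g Dg ge] := ts_dense DT q1w bf (divr_gt0 e0 C1).
rewrite -[ext f](subrK (U g)); apply: le_trans (ler_normD _ _) _.
apply: le_trans (lerD (ext_bound bf Dg) (UC Dg)) _.
have gN : N g <= N (fun x => f x - g x) + N f.
  rewrite (nmBC q1w (bL bf) (DL Dg)) -[X in N X <= _](_ : (fun x => (g x - f x) + f x) = _).
    by apply: nmD => //; [apply: LfunB => //; [exact: DL|exact: bL]|exact: bL].
  by apply/funext => x; rewrite subrK.
apply: le_trans (lerD (lexx _) (ler_wpM2l C0 gN)) _.
rewrite mulrDr addrA -mulrDl addrC lerD2l.
apply: le_trans (_ : (2 * C + 1) * N (fun x => f x - g x) <= _).
  by rewrite ler_wpM2r ?nm_ge0//; lra.
by rewrite mulrC -ler_pdivlMr// ltW.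
Qed.

Let ext_add f g : bddm f -> bddm g -> ext (fun x => f x + g x) = ext f + ext g.
Proof.
move=> bf bg; have bfg := bddmD bf bg.
apply/eqP; rewrite -subr_eq0 -normr_eq0 eq_le normr_ge0 andbT.
apply/ler_addgt0Pr => e e0; rewrite add0r.
(* The defect of additivity is at most [2 * C] times the sum of the two approximation errors, each
   smaller than [e / (4 * C + 1)]; the [1] covers [C = 0]. *)
have C1 : 0 < 4 * C + 1 by rewrite ltr_wpDl// mulr_ge0.
have [u Du ue] := ts_dense DT q1w bf (divr_gt0 e0 C1).
have [v Dv ve] := ts_dense DT q1w bg (divr_gt0 e0 C1).
have Duv := ts_add DT Du Dv.
have H1 := ext_bound bf Du; have H2 := ext_bound bg Dv; have H3 := ext_bound bfg Duv.
have N1 := nm_ge0 mu q (fun x => f x - u x).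
have N2 := nm_ge0 mu q (fun x => g x - v x).
have H4 : N (fun x => f x + g x - (u x + v x)) <=
    N (fun x => f x - u x) + N (fun x => g x - v x).
  rewrite (_ : (fun x => f x + g x - _) = fun x => (f x - u x) + (g x - v x)).
    by apply: nmD => //; apply: LfunB => //; do ?[exact: bL|exact: DL].
  by apply/funext => x; ring.
rewrite UD// in H3.
have H5 := le_trans H3 (ler_wpM2l C0 H4).
have -> : ext (fun x => f x + g x) - (ext f + ext g) =
  (ext (fun x => f x + g x) - (U u + U v)) - (ext f - U u) - (ext g - U v) by ring.
apply: le_trans (ler_normB _ _) _; apply: le_trans (lerD (ler_normB _ _) (lexx _)) _.
rewrite ltr_pdivlMr// in ue; rewrite ltr_pdivlMr// in ve.
nra.
Qed.

Let ext_scale a f : bddm f -> ext (fun x => a * f x) = a * ext f.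
Proof.
move=> bf.
(* [D] is stable under rational scalars only, so these come first. A real [a] is then approximated
   from below by a rational, the error being at most [2 * (C * N f)] times the difference of the
   scalars. *)
have rat_scale (c : rat) : ext (fun x => ratr c * f x) = ratr c * ext f.
  apply/esym; have [->|c0] := eqVneq c 0.
    rewrite rmorph0 mul0r; apply/esym/eqP; rewrite -normr_eq0 eq_le normr_ge0 andbT.
    apply: le_trans (ext_le (bddmZ 0 bf)) _.
    by rewrite nmZ ?normr0 ?mul0r ?mulr0//; exact: bL.
  have rc0 : ratr c != 0 :> R by rewrite fmorph_eq0.
  apply: (@ext_uniq _ _ (C)); [exact: bddmZ|exact: C0|].
  move=> g Dg; have Dg' := ts_scale DT c^-1 Dg.
  have := ext_bound bf Dg'; rewrite UZ// => H.
  rewrite (_ : (fun x => _ - g x) =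
    fun x => ratr c * (f x - ratr c^-1 * g x)); last first.
    by apply/funext => x; rewrite mulrBr mulrA -rmorphM mulfV// rmorph1 mul1r.
  rewrite nmZ//; last by apply: LfunB => //; [exact: bL|exact: DL].
  rewrite (_ : ratr c * ext f - U g = ratr c * (ext f - ratr c^-1 * U g)); last first.
    by rewrite mulrBr mulrA -rmorphM mulfV// rmorph1 mul1r.
  by rewrite normrM mulrCA ler_wpM2l.
apply/eqP; rewrite -subr_eq0 -normr_eq0 eq_le normr_ge0 andbT.
apply/ler_addgt0Pr => e e0; rewrite add0r.
have K1 : 0 < 2 * (C * N f) + 1 by rewrite ltr_wpDl// mulr_ge0// mulr_ge0 ?nm_ge0.
have e1 : 0 < e / (2 * (C * N f) + 1) by rewrite divr_gt0.
have [c] := @rat_in_itvoo R (a - e / (2 * (C * N f) + 1)) a ltac:(by rewrite ltrBlDr ltrDl).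
rewrite in_itv /= => /andP[c1 c2].
have -> : ext (fun x => a * f x) = ext (fun x => (a - ratr c) * f x) + ratr c * ext f.
  rewrite -rat_scale -ext_add; [|exact: bddmZ|exact: bddmZ].
  by congr ext; apply/funext => x; rewrite mulrBl subrK.
have -> : ext (fun x => (a - ratr c) * f x) + ratr c * ext f - a * ext f =
  ext (fun x => (a - ratr c) * f x) - (a - ratr c) * ext f by ring.
apply: le_trans (ler_normB _ _) _; rewrite normrM.
apply: le_trans (lerD (ext_le (bddmZ _ bf)) (ler_wpM2l (normr_ge0 _) (ext_le bf))) _.
rewrite nmZ//; last exact: bL.
rewrite ger0_norm ?subr_ge0 ?(ltW c2)//.
rewrite mulrCA -mulrDr.
have : a - ratr c <= e / (2 * (C * N f) + 1) by rewrite lerBlDr -lerBlDl ltW.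
have NN : 0 <= C * N f by rewrite mulr_ge0 ?nm_ge0.
rewrite ler_pdivlMr// => H; have a0 : 0 <= a - ratr c by rewrite subr_ge0 ltW.
by apply: le_trans H; rewrite ler_wpM2l//; lra.
Qed.

Let ext0 : ext (cst 0) = 0.
Proof.
rewrite -[RHS](mul0r (ext (cst 0))) -ext_scale; last exact: bddm_cst.
by congr ext; apply/funext => x; rewrite mul0r.
Qed.

Let extB f g : bddm f -> bddm g -> ext (fun x => f x - g x) = ext f - ext g.
Proof.
move=> bf bg; rewrite -mulN1r -ext_scale// -ext_add//; last exact: bddmZ.
by congr ext; apply/funext => x; rewrite mulN1r.
Qed.

(** Dominated convergence in [L^q] and the bound on [ext]. This continuity is behind the countable
    additivity of [riesz_charge] and behind the passage from simple to bounded functions. *)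
Let ext_cvg (f_ : nat -> T -> R) f (M : R) : (forall n, bddm (f_ n)) -> bddm f ->
  (forall n x, `|f_ n x| <= M) -> (forall x, f_ n x @[n --> \oo] --> f x) ->
  ext (f_ n) @[n --> \oo] --> ext f.
Proof.
move=> bf_ bf fM cf; have [mf [K fK]] := bf.
have c0 : N (fun x => f_ n x - f x) @[n --> \oo] --> 0.
  apply: (@dominated_nm _ _ _ mu q f_ f (cst (M + K))) => //.
  - by move=> n; have [] := bf_ n.
  - exact: nearW.
  - by apply: bL; exact: bddm_cst.
  - by move=> n x; rewrite (le_trans (ler_normB _ _))// lerD.
apply/(@cvgrPdist_le _ R^o) => e e0.
have C1 : 0 < C + 1 by rewrite ltr_wpDl.
move/(@cvgrPdist_le _ R^o) : c0 => /(_ _ (divr_gt0 e0 C1)); apply: filterS => n.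
rewrite sub0r normrN ger0_norm ?nm_ge0// ler_pdivlMr// => h.
rewrite distrC -extB//; apply: le_trans (ext_le (bddmB (bf_ n) bf)) _.
apply: le_trans h; rewrite mulrC ler_wpM2l ?nm_ge0//; lra.
Qed.

Definition riesz_charge (A : set T) : \bar R := (ext \1_A)%:E.

Let riesz_charge0 : riesz_charge set0 = 0%E.
Proof. by rewrite /riesz_charge indic0 ext0. Qed.

Let riesz_charge_fin (A : set T) : measurable A -> riesz_charge A \is a fin_num.
Proof. by []. Qed.

Let riesz_charge_sigma : semi_sigma_additive riesz_charge.
Proof.
move=> F mF tF mUF.
have sumE n : (\sum_(0 <= i < n) riesz_charge (F i) =
    (ext (\1_(\big[setU/set0]_(i < n) F i)))%:E)%E.
  elim: n => [|n IHn]; first by rewrite big_nil big_ord0 indic0 ext0.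
  rewrite big_nat_recr//= IHn big_ord_recr/= /riesz_charge -EFinD; congr EFin.
  have mU : measurable (\big[setU/set0]_(i < n) F i) by exact: bigsetU_measurable.
  rewrite -ext_add; [|exact: bddm_indic|exact: bddm_indic].
  congr ext; apply/funext => x; rewrite !indicE in_setU.
  have [xU|xU] := boolP (x \in \big[setU/set0]_(i < n) F i).
    rewrite /=; case: (boolP (x \in F n)) => [xn|]; last by rewrite addr0.
    move: xU xn; rewrite !inE -bigcup_mkord => -[k /= kn Fk] Fn.
    by have := tF k n Logic.I Logic.I (ex_intro _ x (conj Fk Fn)) => kE; rewrite kE ltnn in kn.
  by rewrite add0r.
apply/fine_cvgP; split; first by apply: nearW => n; rewrite sumE.
rewrite /riesz_charge /=.
rewrite (_ : _ \o _ = fun n => ext (\1_(\big[setU/set0]_(i < n) F i))); last first.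
  by apply/funext => n /=; rewrite sumE.
apply: (@ext_cvg _ _ 1).
- by move=> n; apply: bddm_indic; exact: bigsetU_measurable.
- exact: bddm_indic.
- by move=> n x; rewrite indicE; case: (_ \in _); rewrite ?normr1 ?normr0.
- move=> x; have [[k _ Fk]|xF] := pselect ((\bigcup_n F n) x).
    apply: cvg_near_cst; near=> n; rewrite !indicE !mem_set//; first by exists k.
    by rewrite -bigcup_mkord; exists k => //=; near: n; exists k.+1.
  apply: cvg_near_cst; apply: nearW => n; rewrite !indicE !memNset//.
  by rewrite -bigcup_mkord => -[k _ Fk]; apply: xF; exists k.
Unshelve. all: by end_near. Qed.

HB.instance Definition _ := isCharge.Build _ _ _ riesz_charge
  riesz_charge0 riesz_charge_fin riesz_charge_sigma.

Let riesz_dom : riesz_charge `<< mu.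
Proof.
apply/null_content_dominatesP => A mA A0; rewrite /riesz_charge; congr EFin.
apply/eqP; rewrite -normr_eq0 eq_le normr_ge0 andbT.
apply: le_trans (ext_le (bddm_indic R mA)) _.
rewrite (@nm_ae _ _ _ mu q _ (cst 0))//.
- rewrite -[X in N X](_ : (fun=> 0 * 0) = _); last by apply/funext => x; rewrite mul0r.
  by rewrite nmZ ?normr0 ?mul0r ?mulr0//; exact/bL/bddm_cst.
- exists A; split => // x /= /not_implyP[_]; rewrite indicE.
  by have [/set_mem//|_ []] := boolP (x \in A).
Qed.

Let g (x : T) : R := fine (Radon_Nikodym riesz_charge mu x).

Let gE x : (g x)%:E = Radon_Nikodym riesz_charge mu x.
Proof. by rewrite fineK//; exact: Radon_Nikodym_fin_num. Qed.

Let ig : mu.-integrable setT (EFin \o g).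
Proof.
rewrite (_ : _ \o _ = Radon_Nikodym riesz_charge mu); last by apply/funext => x; exact: gE.
exact: Radon_Nikodym_integrable.
Qed.

Let mg : measurable_fun setT g.
Proof. exact/measurable_EFinP/(measurable_int mu ig). Qed.

Let ext_indic A : measurable A -> ext \1_A = \int[mu]_x (\1_A x * g x).
Proof.
move=> mA; apply: EFin_inj.
rewrite -[LHS]/(riesz_charge A) (Radon_Nikodym_integral riesz_dom mA).
rewrite integral_mkcond /Rintegral fineK; last first.
  apply: integrable_fin_num => //; apply: integrable_bddmM => //; exact: bddm_indic.
apply: eq_integral => x _; rewrite /patch -gE indicE.
by case: (x \in A); rewrite ?mul1r ?mul0r.
Qed.

Let ext_sfun (f : {nnsfun T >-> R}) : ext f = \int[mu]_x (f x * g x).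
Proof.
have -> : (f : T -> R) = fun x => \sum_(y <- fset_set (range f)) y * \1_(f @^-1` [set y]) x.
  by apply/funext => x; rewrite [LHS]fimfunE fsbig_finite.
have mA y : measurable (f @^-1` [set y]) by exact: measurable_sfunP.
elim: (finmap.enum_fset _) => [|y s IHs].
  under [in LHS]eq_fun do rewrite big_nil.
  by under eq_Rintegral do rewrite big_nil mul0r; rewrite /Rintegral integral0 ext0.
have bs : bddm (fun x => \sum_(y <- s) y * \1_(f @^-1` [set y]) x).
  elim: s {IHs} => [|z s IHs].
    by under eq_fun do rewrite big_nil; exact: bddm_cst.
  under eq_fun do rewrite big_cons.
  by apply: bddmD => //; apply: bddmZ; exact: bddm_indic.
under [in LHS]eq_fun do rewrite big_cons.
rewrite ext_add//; last by apply: bddmZ; exact: bddm_indic.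
rewrite IHs ext_scale; last exact: bddm_indic.
rewrite ext_indic// -RintegralDZ; [|exact: integrable_bddmM (bddm_indic _ _) _|exact: integrable_bddmM].
by apply: eq_Rintegral => x _; rewrite big_cons mulrDl mulrA.
Qed.

Let ext_ge0 f : bddm f -> (forall x, 0 <= f x) -> ext f = \int[mu]_x (f x * g x).
Proof.
move=> bf f0; have [mf [M fM]] := bf.
have mf' : measurable_fun setT (EFin \o f) by exact/measurable_EFinP.
pose f_ := nnsfun_approx measurableT mf'.
have f_c x : f_ n x @[n --> \oo] --> f x.
  have := @cvg_nnsfun_approx _ _ _ _ measurableT _ mf' (fun y _ => f0 y) x Logic.I.
  by move=> /fine_cvgP[_].
have f_le n x : f_ n x <= f x.
  rewrite -(cvg_lim (@Rhausdorff R) (f_c x)); apply: nondecreasing_cvgn_le.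
    by move=> i j ij; have /lefP := nd_nnsfun_approx measurableT mf' ij; exact.
  by apply/cvg_ex; exists (f x).
have bf_ n : bddm (f_ n).
  split => //; exists M => x; rewrite ger0_norm//; apply: le_trans (f_le n x) _.
  exact: le_trans (ler_norm _) (fM x).
have f_M n x : `|f_ n x| <= M.
  by rewrite ger0_norm// (le_trans (f_le n x))// (le_trans (ler_norm _) (fM x)).
have h1 := ext_cvg bf_ bf f_M f_c.
have h2 : \int[mu]_x (f_ n x * g x) @[n --> \oo] --> \int[mu]_x (f x * g x).
  apply: (@dominated_Rintegral _ _ _ _ _ _ (fun x => M * `|g x|)).
  - by move=> n; exact: measurable_funM.
  - exact: measurable_funM.
  - by apply: nearW => x; apply: cvgM; [exact: f_c|exact: cvg_cst].
  - by exact: (integrableZl measurableT M (integrable_norm ig)).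
  - by move=> n x; rewrite normrM ler_wpM2r.
have h3 : \int[mu]_x (f_ n x * g x) @[n --> \oo] --> ext f.
  by under eq_fun do rewrite -ext_sfun.
exact: (cvg_unique _ h3 h2).
Qed.

Let ext_bdd f : bddm f -> ext f = \int[mu]_x (f x * g x).
Proof.
move=> bf; have [mf [M fM]] := bf.
have b1 : bddm (fun x => f x + M) by apply: bddmD => //; exact: bddm_cst.
have h : ext (fun x => f x + M) = \int[mu]_x ((f x + M) * g x).
  apply: ext_ge0 => // x; rewrite -lerBlDr sub0r.
  by have := fM x; rewrite ler_norml => /andP[].
have M0 : 0 <= M by rewrite (le_trans _ (fM point)).
have hM : ext (fun=> M) = \int[mu]_x (M * g x) by apply: ext_ge0 => //; exact: bddm_cst.
have e : ext f + ext (fun=> M) = \int[mu]_x (f x * g x) + \int[mu]_x (M * g x).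
  rewrite -ext_add//; last exact: bddm_cst.
  rewrite h -RintegralD//; [|exact: integrable_bddmM|exact: (integrableZl measurableT M ig)].
  by apply: eq_Rintegral => x _; rewrite mulrDl.
by move: e; rewrite hM => /addIr.
Qed.

(** The candidate is the Radon-Nikodym density [g] of the charge. So far it is known to be
    integrable only, so the [L^p] bound is proved on the sets [A n] and passed to the limit by
    monotone convergence. *)
Lemma riesz : exists v, [/\ v \in Lfun mu p%:E, nm mu p v <= C &
  forall f, D f -> U f = \int[mu]_x (v x * f x)].
Proof.
have p0 : 0 < p := lt_trans ltr01 p1.
pose A n := [set x | `|g x| <= n%:R].
have mA n : measurable (A n).
  rewrite -[A n]setTI; apply: (measurable_fun_le measurableT _ _) => //.
  exact: measurableT_comp.
(* The duality map [g * |g|^(p-2)], truncated: [h n * g] and [|h n|^q] both equal [|g|^p] on [A n],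
   so that the bound on [ext] reads [I n <= C * I n ^ (1/q)], hence [I n ^ (1/p) <= C] unless [I n]
   is 0. *)
pose h n x := g x * (`|g x| `^ (p - 2) * \1_(A n) x).
(* For [p < 2] the factor of exponent [p - 2] blows up near the zeros of [g]; the modulus of [h n]
   has exponent [p - 1] and stays bounded on [A n]. *)
have habs n x : `|h n x| = `|g x| `^ (p - 1) * \1_(A n) x.
  rewrite /h !normrM (ger0_norm (powR_ge0 _ _)) mulrA (ger0_norm (_ : 0 <= \1_(A n) x))//; congr (_ * _).
  have [->|g0] := eqVneq (g x) 0.
    by rewrite normr0 mul0r powR0// subr_eq0 gt_eqF.
  rewrite -[X in X * _]powRr1// -powRD; first by congr (_ `^ _); ring.
  by apply/implyP => _; rewrite normr_eq0.
have bh n : bddm (h n).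
  split.
    by apply: measurable_funM => //; apply: measurable_funM => //; exact: measurable_normpow.
  exists (n%:R `^ (p - 1)) => x; rewrite habs indicE.
  have [Ax|Ax] := boolP (x \in A n); last by rewrite mulr0 powR_ge0.
  rewrite mulr1; apply: ge0_ler_powR; rewrite ?nnegrE ?subr_ge0 ?(ltW p1)//.
  by rewrite inE in Ax.
pose I n := \int[mu]_x (`|g x| `^ p * \1_(A n) x).
have hgE n x : h n x * g x = `|g x| `^ p * \1_(A n) x.
  have [g0|g0] := eqVneq (g x) 0.
    by rewrite g0 mulr0 normr0 powR0 ?mul0r// gt_eqF.
  rewrite /h mulrC !mulrA -expr2 -real_normK ?num_real// -powR_mulrn//; congr (_ * _).
  rewrite -powRD; first by congr (_ `^ _); ring.
  by apply/implyP => _; rewrite normr_eq0.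
have hI n : ext (h n) = I n.
  by rewrite ext_bdd//; apply: eq_Rintegral => x _; rewrite hgE.
have hN n : N (h n) `^ q = I n.
  rewrite nm_pow//; last exact: bL.
  apply: eq_Rintegral => x _; rewrite habs indicE.
  have [Ax|Ax] := boolP (x \in A n); last by rewrite !mulr0 powR0// gt_eqF.
  rewrite !mulr1 -powRrM; congr (_ `^ _).
  have : p^-1 * (p * q) + q^-1 * (p * q) = p * q by rewrite -mulrDl pq mul1r.
  rewrite mulKf ?gt_eqF// [q^-1 * _]mulrC mulrK ?unitfE ?gt_eqF// => e.
  lra.
have I0 n : 0 <= I n by rewrite -hN powR_ge0.
have IC n : I n <= C `^ p.
  have H : I n <= C * N (h n) by rewrite -hI; apply: le_trans (ler_norm _) (ext_le (bh n)).
  have [In0|In0] := eqVneq (I n) 0; first by rewrite In0 powR_ge0.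
  have In_gt0 : 0 < I n by rewrite lt_neqAle eq_sym In0 I0.
  have NE : N (h n) = I n `^ q^-1.
    by rewrite -hN -powRrM mulfV ?gt_eqF// powRr1// nm_ge0.
  have : I n `^ p^-1 <= C.
    have IE : I n = I n `^ p^-1 * I n `^ q^-1.
      rewrite -powRD ?pq ?powRr1//; by apply/implyP => _.
    move: H; rewrite NE [leLHS]IE ler_pM2r//; exact: powR_gt0.
  move=> H2; have -> : I n = (I n `^ p^-1) `^ p by rewrite -powRrM mulVf ?gt_eqF// powRr1.
  by apply: ge0_ler_powR; rewrite ?nnegrE ?powR_ge0 ?(ltW p0).
have foo : (\int[mu]_x (`|g x| `^ p)%:E <= (C `^ p)%:E)%E.
  pose k n x := (`|g x| `^ p * \1_(A n) x)%:E.
  have mk n : measurable_fun setT (k n).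
    by apply/measurable_EFinP/measurable_funM => //; exact: measurable_normpow.
  have k0 n x : setT x -> (0 <= k n x)%E.
    by move=> _; rewrite lee_fin mulr_ge0 ?powR_ge0.
  have knd x : setT x -> {homo k^~ x : n m / (n <= m)%N >-> (n <= m)%E}.
    move=> _ n m nm; rewrite lee_fin ler_wpM2l ?powR_ge0// !indicE ler_nat.
    have [Ax|//] := boolP (x \in A n); rewrite mem_set//=.
    by move: Ax; rewrite inE /= => /le_trans; apply; rewrite ler_nat.
  have := @cvg_monotone_convergence _ _ _ mu _ measurableT k mk k0 knd.
  rewrite (@eq_integral _ _ _ mu setT (fun x => (`|g x| `^ p)%:E) (fun x => limn (k^~ x))); last first.
    move=> x _; apply/cvg_lim => //; apply: cvg_near_cst; near=> n.
    rewrite /k indicE mem_set ?mulr1//=.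
    by near: n; exact: nbhs_infty_ger.
  move=> /cvg_lim <- //; apply: lime_le.
    apply: ereal_nondecreasing_is_cvgn => n m nm; apply: ge0_le_integral => //.
    - by move=> x _; exact: k0.
    - by move=> x _; apply: knd.
  apply: nearW => n.
  have : mu.-integrable setT (k n).
    rewrite (_ : k n = fun x => (h n x * g x)%:E); first exact: integrable_bddmM.
    by apply/funext => x; rewrite hgE.
  move=> /integrable_fin_num => /(_ measurableT) /fineK <-.
  by rewrite lee_fin; exact: IC.
have gL : g \in Lfun mu p%:E.
  by apply: Lfun_pow => //; [exact: ltW|rewrite (le_lt_trans foo) ?ltry].
exists g; split => //.
  rewrite leNgt; apply/negP => Cg; move: foo; rewrite (LnormE gL (ltW p1)) lee_fin leNgt => /negP; apply.
  by apply: gt0_ltr_powR; rewrite ?nnegrE ?nm_ge0.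
move=> f Df; rewrite -ext_U// ext_bdd; last exact: (ts_bddm DT).
by apply: eq_Rintegral => x _; rewrite mulrC.
Unshelve. all: by end_near. Qed.

End riesz.

(** * Duality and weak Borel sets of [L^p] *)

Section weak_topology.
Context (R : realType) (V : normedModType R).

Lemma cvg_weak (F : set_system V) (v : V) : Filter F ->
  (forall f : dual V, sval f w @[w --> F] --> (sval f v : R^o)) ->
  F --> (v : weak_space V).
Proof.
move=> FF Fv; pose phi (v : V) : prod_topology (fun _ : dual V => R^o) := fun f => sval f v.
have : phi w @[w --> F] --> phi v.
  apply/cvg_sup => f; apply/cvg_image.
    by apply/seteqP; split=> // r _; exists (fun=> r).
  move=> A /Fv FA; exists (fun g : prod_topology (fun _ : dual V => R^o) => A (g f)).
    exact: FA.
  apply/seteqP; split=> [_ [g Ag <-]//|r Ar].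
  by exists (fun=> r).
move=> Fphi A; rewrite nbhsE => -[B [[W oW <-] Wv]] BA.
by apply: filterS BA _; apply: Fphi; exact: open_nbhs_nbhs.
Qed.

Lemma open_weak (U : set V) : open (U : set (weak_space V)) -> open U.
Proof.
move=> oU; rewrite openE => v Uv.
have FF : Filter (nbhs v) by exact: nbhs_filter.
apply: (@cvg_weak (nbhs v) v FF); last exact: (open_nbhs_nbhs (conj oU Uv)).
by move=> f; have := svalP f; exact.
Qed.

Lemma weak_continuous (f : dual V) : continuous (sval f : weak_space V -> R^o).
Proof.
pose Pi := prod_topology (fun _ : dual V => R^o).
have h : continuous ((fun g => g f) : Pi -> R^o).
  move=> g; have /cvg_sup/(_ f)/cvg_image : g --> g by exact: cvg_id.
  move=> h; apply: cvg_trans (h _) => {h}.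
    by move=> A /= [W nbdW <-]; apply: filterS nbdW; exact: preimage_image.
  by rewrite eqEsubset; split => y //; exists (fun=> y).
move=> v.
have i := @initial_continuous _ Pi (fun (v : V) (f : dual V) => sval f v) v.
exact: (cvg_comp _ _ i (h _)).
Qed.

Lemma measurable_dual (f : dual V) : measurable_fun setT (sval f : weak_borel V -> R).
Proof.
apply: (measurability _ (RGenOInfty.measurableE R)) => // _ [_ [a ->] <-].
rewrite setTI; apply: sub_sigma_algebra.
apply: open_comp; [by move=> v _; exact: weak_continuous|exact: interval_open].
Qed.

End weak_topology.

Lemma countable_enum (X : Type) (D : set X) (x0 : X) : countable D -> D x0 ->
  exists f : nat -> X, (forall n, D (f n)) /\ forall x, D x -> exists n, f n = x.
Proof.
move=> /countable_injP[i iinj] Dx0.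
have H n : exists y, D y /\ forall x, D x -> i x = n -> y = x.
  have [[y Dy yn]|nE] := pselect (exists2 y, D y & i y = n).
    by exists y; split=> // x Dx xn; apply: iinj; rewrite ?inE// yn.
  by exists x0; split=> // x Dx xn; exfalso; apply: nE; exists x.
have [f fP] := choice H; exists f; split=> [n|x Dx]; first by case: (fP n).
by exists (i x); case: (fP (i x)) => _; apply.
Qed.

Section Lspace_duality.
Context d (T : measurableType d) (R : realType).
Variables (mu : {finite_measure set T -> \bar R}) (p q : R) (p1 : 1 < p).
Hypotheses (q1 : 1 < q) (pq : p^-1 + q^-1 = 1).
Local Notation E := (LspaceType mu (EFin_ge1 p1)).
Implicit Types (u v : E) (f g : T -> R).

Let p1w : 1 <= p := ltW p1.
Let q1w : 1 <= q := ltW q1.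

Definition pair v f : R := \int[mu]_x (v x * f x).

Lemma LspaceL v : (v : T -> R) \in Lfun mu p%:E.
Proof. exact: (LfunP (Lfun_of v)). Qed.

Lemma Lspace_normE v : `|v| = nm mu p v.
Proof. by []. Qed.

Lemma Lspace_mk f : f \in Lfun mu p%:E -> exists v, (v : T -> R) = f %[ae mu].
Proof. by move=> fL; exists (Lspace_of (Lfun_Sub (EFin_ge1 p1) fL)); exact: Lspace_ofE. Qed.

Lemma Lspace_norm_ae v f : measurable_fun setT f -> (v : T -> R) = f %[ae mu] -> `|v| = nm mu p f.
Proof. by move=> mf vf; rewrite Lspace_normE; apply: nm_ae => //; exact: measurable_Lspace. Qed.

Lemma pair_ae v f g : measurable_fun setT f -> measurable_fun setT g ->
  (v : T -> R) = f %[ae mu] -> pair v g = \int[mu]_x (f x * g x).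
Proof.
move=> mf mg vf; apply: ae_eq_Rintegral.
- by apply: measurable_funM => //; exact: measurable_Lspace.
- exact: measurable_funM.
- by apply: filterS vf => x /= ->.
Qed.

Lemma Lspace_plusE u v : ((u + v : E) : T -> R) = (fun x => u x + v x) %[ae mu].
Proof. exact: Lspace_addE. Qed.

Lemma Lspace_starE (a : R) u : ((a *: u : E) : T -> R) = (fun x => a * u x) %[ae mu].
Proof. exact: Lspace_scaleE. Qed.

Lemma Lspace_minusE u : ((- u : E) : T -> R) = (fun x => - u x) %[ae mu].
Proof. exact: Lspace_oppE. Qed.

Lemma Lspace_nullE : ((0 : E) : T -> R) = (fun=> 0) %[ae mu].
Proof. exact: Lspace_zeroE. Qed.

Lemma Lspace_subE u v : ((u - v : E) : T -> R) = (fun x => u x - v x) %[ae mu].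
Proof.
by apply: filterS2 (Lspace_plusE u (- v)) (Lspace_minusE v) => x /(_ Logic.I) -> /(_ Logic.I) ->.
Qed.

Lemma Lspace_lincE (a : R) u v : ((a *: u + v : E) : T -> R) = (fun x => a * u x + v x) %[ae mu].
Proof.
by apply: filterS2 (Lspace_plusE (a *: u) v) (Lspace_starE a u) => x /(_ Logic.I) -> /(_ Logic.I) ->.
Qed.

Lemma pair_integrable v g : g \in Lfun mu q%:E -> mu.-integrable setT (fun x => (v x * g x)%:E).
Proof. by move=> gL; apply: (@hoelder_integrable _ _ _ _ p q) => //; exact: LspaceL. Qed.

Lemma pair_le v g : g \in Lfun mu q%:E -> `|pair v g| <= `|v| * nm mu q g.
Proof. by move=> gL; apply: hoelder_le => //; exact: LspaceL. Qed.

Lemma pairB u v g : g \in Lfun mu q%:E -> pair (u - v) g = pair u g - pair v g.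
Proof.
move=> gL; have mg := Lfun_measurable gL.
rewrite (pair_ae _ mg (Lspace_subE u v)); last first.
  by apply: measurable_funB; exact: measurable_Lspace.
rewrite -RintegralB//; [|exact: pair_integrable|exact: pair_integrable].
by apply: eq_Rintegral => x _; rewrite mulrBl.
Qed.

Lemma pairDZ (a : R) u v g : g \in Lfun mu q%:E ->
  pair (a *: u + v) g = a * pair u g + pair v g.
Proof.
move=> gL; have mg := Lfun_measurable gL.
rewrite (pair_ae _ mg (Lspace_lincE a u v)); last first.
  by apply: measurable_funD; [apply: measurable_funM => //|]; exact: measurable_Lspace.
rewrite -RintegralDZ//; [|exact: pair_integrable|exact: pair_integrable].
by apply: eq_Rintegral => x _; rewrite mulrDl mulrA.
Qed.

Lemma pair0 g : g \in Lfun mu q%:E -> pair 0 g = 0.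
Proof. by move=> gL; rewrite -(subrr (0 : E)) pairB// subrr. Qed.

Lemma pair_addr v f g : f \in Lfun mu q%:E -> g \in Lfun mu q%:E ->
  pair v (fun x => f x + g x) = pair v f + pair v g.
Proof.
move=> fL gL; rewrite -RintegralD//; [|exact: pair_integrable|exact: pair_integrable].
by apply: eq_Rintegral => x _; rewrite mulrDr.
Qed.

Lemma pair_scaler v (a : R) f : f \in Lfun mu q%:E ->
  pair v (fun x => a * f x) = a * pair v f.
Proof.
move=> fL; rewrite -RintegralZl//; last exact: pair_integrable.
by apply: eq_Rintegral => x _; rewrite mulrCA.
Qed.

Lemma pair_subr v f g : f \in Lfun mu q%:E -> g \in Lfun mu q%:E ->
  pair v (fun x => f x - g x) = pair v f - pair v g.
Proof.
move=> fL gL; rewrite -RintegralB//; [|exact: pair_integrable|exact: pair_integrable].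
by apply: eq_Rintegral => x _; rewrite mulrBr.
Qed.

Lemma pair_continuous g : g \in Lfun mu q%:E -> continuous (fun v : E => pair v g : R^o).
Proof.
move=> gL v; have FF : Filter (nbhs v) by exact: nbhs_filter.
apply/(@cvgrPdist_le _ R^o E (nbhs v) FF) => e e0.
have N1 : 0 < nm mu q g + 1 by rewrite ltr_wpDl// nm_ge0.
apply/nbhs_ballP; exists (e / (nm mu q g + 1)); first exact: divr_gt0.
move=> u; rewrite -ball_normE /= => /ltW vu.
rewrite -pairB//; apply: le_trans (pair_le _ gL) _.
apply: le_trans (_ : `|v - u| * (nm mu q g + 1) <= _); first by rewrite ler_wpM2l// lerDl.
by rewrite -ler_pdivlMr.
Qed.

Section test.
Variable D : set (T -> R).
Hypothesis DT : test_space mu D.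

Let DLq f : D f -> f \in Lfun mu q%:E.
Proof. by move=> Df; apply: bddm_Lfun => //; exact: (ts_bddm DT). Qed.

Lemma riesz_Lspace (U : (T -> R) -> R) (C : R) : 0 <= C ->
  (forall f g, D f -> D g -> U (fun x => f x + g x) = U f + U g) ->
  (forall (c : rat) f, D f -> U (fun x => ratr c * f x) = ratr c * U f) ->
  (forall f, D f -> `|U f| <= C * nm mu q f) ->
  exists v : E, `|v| <= C /\ forall f, D f -> pair v f = U f.
Proof.
move=> C0 UD UZ UC; have [v0 [vL vC vU]] := riesz p1 q1 pq DT UD UZ C0 UC.
have [v vv0] := Lspace_mk vL; exists v; split.
  by rewrite (Lspace_norm_ae (Lfun_measurable vL) vv0).
move=> f Df; rewrite vU//; apply: pair_ae => //; first exact: (Lfun_measurable vL).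
exact: (ts_bddm DT Df).1.
Qed.

Lemma pair_inj u v : (forall f, D f -> pair u f = pair v f) -> u = v.
Proof.
move=> uv; apply/eqP; rewrite -subr_eq0; apply/eqP; set w := u - v.
have w0 f : D f -> pair w f = 0 by move=> Df; rewrite pairB ?uv ?subrr// DLq.
have mw : measurable_fun setT (w : T -> R) := measurable_Lspace w.
(* The sign of [w], with value 0 where [w] vanishes. It pairs with [w] to the integral of [|w|];
   approximating it by elements of [D], which pair to 0 with [w], shows that this integral is 0. *)
pose s x : R := \1_[set x | 0 <= w x] x - \1_[set x | w x <= 0] x.
have bs : bddm s.
  apply: bddmB; apply: bddm_indic; rewrite -[X in measurable X]setTI.
    exact: (measurable_fun_le measurableT).
  exact: (measurable_fun_le measurableT).
have sL : s \in Lfun mu q%:E := bddm_Lfun mu q1w bs.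
have ws x : w x * s x = `|w x|.
  have i1 : (x \in [set x | 0 <= w x]) = (0 <= w x) by apply/idP/idP; rewrite inE.
  have i2 : (x \in [set x | w x <= 0]) = (w x <= 0) by apply/idP/idP; rewrite inE.
  rewrite /s !indicE i1 i2.
  case: (ltgtP (w x) 0) => [h|h|->] /=; last by rewrite mul0r normr0.
    by rewrite sub0r mulrN1 ltr0_norm.
  by rewrite subr0 mulr1 gtr0_norm.
have i0 : \int[mu]_x `|w x| = 0.
  under eq_Rintegral do rewrite -ws.
  rewrite -[LHS]/(pair w s).
  apply/eqP; rewrite -normr_eq0 eq_le normr_ge0 andbT.
  apply/ler_addgt0Pr => e e0; rewrite add0r.
  have N1 : 0 < `|w| + 1 by rewrite ltr_wpDl.
  have [f Df sf] := ts_dense DT q1w bs (divr_gt0 e0 N1).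
  rewrite -[pair w s]subr0 -(w0 _ Df) -(pair_subr _ sL (DLq Df)).
  apply: le_trans (pair_le _ (LfunB q1w sL (DLq Df))) _.
  move: sf; rewrite ltr_pdivlMr// => /ltW; apply: le_trans.
  by rewrite mulrC ler_wpM2l ?nm_ge0// lerDl.
apply: LspaceP; have : ae_eq mu setT (EFin \o w) (cst 0%E).
  apply/(ae_eq_integral_abs mu measurableT); first exact/measurable_EFinP.
  have : mu.-integrable setT (fun x => `|w x|%:E).
    have := pair_integrable w sL.
    by apply: eq_integrable => // x _; rewrite ws.
  by move=> /integrable_fin_num => /(_ measurableT) /fineK <-; rewrite -/(Rintegral _ _ _) i0.
by move=> h; apply: filterS2 h Lspace_nullE => x /= /(_ Logic.I) [->] /(_ Logic.I) ->.
Qed.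

(** Riesz gives a representative of norm at most [C], which [pair_inj] identifies with [v]. Thus the
    norm is determined by countably many pairings, which makes it measurable below. *)
Lemma Lspace_norm_le (C : R) v : 0 <= C ->
  (forall f, D f -> `|pair v f| <= C * nm mu q f) -> `|v| <= C.
Proof.
move=> C0 vC; have [u [uC uv]] : exists u : E, `|u| <= C /\ forall f, D f -> pair u f = pair v f.
  apply: riesz_Lspace => //.
  - by move=> f g Df Dg; apply: pair_addr; exact: DLq.
  - by move=> c f Df; apply: pair_scaler; exact: DLq.
by rewrite -(pair_inj uv).
Qed.

Lemma Lspace_dense v (e : R) : 0 < e ->
  exists c : E, (exists2 f, D f & (c : T -> R) = f %[ae mu]) /\ `|v - c| < e.
Proof.
move=> e0; have e20 : 0 < e / 2 by rewrite divr_gt0.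
have mv := measurable_Lspace v.
pose A n := [set x | `|v x| <= n%:R].
have mA n : measurable (A n).
  rewrite -[A n]setTI; apply: (measurable_fun_le measurableT _ _) => //.
  exact: measurableT_comp.
pose h n x := v x * \1_(A n) x.
have bh n : bddm (h n).
  split; first exact: measurable_funM.
  exists n%:R => x; rewrite /h indicE; have [|_] := boolP (x \in A n).
    by rewrite inE mulr1.
  by rewrite mulr0 normr0.
have : nm mu p (fun x => h n x - v x) @[n --> \oo] --> 0.
  apply: (@dominated_nm _ _ _ _ _ _ _ (fun x => `|v x|)) => //.
  - by move=> n; have [] := bh n.
  - apply: nearW => x; apply: cvg_near_cst; near=> n.
    rewrite /h indicE mem_set ?mulr1//=; near: n; exact: nbhs_infty_ger.
  - apply: Lfun_pow => //; first exact: measurableT_comp.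
    under eq_integral do rewrite normr_id.
    by rewrite (LnormE (LspaceL v))// ltry.
  - move=> n x; rewrite /h indicE; case: (_ \in _); first by rewrite mulr1 subrr normr0.
    by rewrite mulr0 sub0r normrN.
move=> /(@cvgrPdist_lt _ R^o) => /(_ _ e20)[n _ /(_ n (leqnn n))] /=.
rewrite sub0r normrN ger0_norm ?nm_ge0// => hv.
have [f Df fh] := ts_dense DT p1w (bh n) e20.
have fL : f \in Lfun mu p%:E by apply: bddm_Lfun => //; exact: (ts_bddm DT).
have hL : h n \in Lfun mu p%:E by apply: bddm_Lfun.
have [c cf] := Lspace_mk fL; exists c; split; first by exists f.
rewrite (@Lspace_norm_ae _ (fun x => v x - f x)).
- apply: le_lt_trans (nm_triangle p1w (LspaceL v) hL fL) _.
  by rewrite [e]splitr ltrD// nmBC// LspaceL.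
- by apply: measurable_funB => //; exact: (Lfun_measurable fL).
- by apply: filterS2 (Lspace_subE v c) cf => x /(_ Logic.I) -> /(_ Logic.I) ->.
Unshelve. all: by end_near. Qed.

(** With 0 put first, the nearest of [c 0, ..., c k] to a vector is never farther from it than its
    norm; this provides the domination in [pettis_bochner]. *)
Lemma Lspace_separable : exists c : nat -> E, c 0%N = 0 /\
  forall v (e : R), 0 < e -> exists k, `|v - c k| < e.
Proof.
have [_ [[f0 Df0 _] _]] := Lspace_dense 0 ltr01.
have [f [fD Df]] := countable_enum (ts_countable DT) Df0.
have fL n : f n \in Lfun mu p%:E by apply: bddm_Lfun => //; exact: (ts_bddm DT).
have [c cf] := choice (fun n => Lspace_mk (fL n)).
exists (fun n => if n is n'.+1 then c n' else 0); split=> // v e e0.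
have [w [[g Dg wg] vw]] := Lspace_dense v e0.
have [n fn] := Df g Dg; exists n.+1.
suff -> : c n = w by [].
by apply: LspaceP; apply: filterS2 (cf n) wg => x /(_ Logic.I) -> /(_ Logic.I) ->; rewrite fn.
Qed.

Section measurable.
Context dS (S : measurableType dS).
Variable h : S -> E.
Hypothesis mh : forall f, D f -> measurable_fun setT (fun s => pair (h s) f).

Lemma measurable_norm_sub (c : E) : measurable_fun setT (fun s => `|h s - c|).
Proof.
have [_ [[f0 Df0 _] _]] := Lspace_dense 0 ltr01.
have [f [fD Df]] := countable_enum (ts_countable DT) Df0.
apply: (measurability _ (RGenOInfty.measurableE R)) => //.
move=> _ [_ [a ->] <-]; rewrite setTI.
rewrite -[X in measurable X]setCK; apply: measurableC.
(* [Lspace_norm_le] requires a nonnegative bound; for [a < 0] the sublevel set is empty. *)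
have [a0|a0] := ltP a 0.
  rewrite (_ : ~` _ = set0); first exact: measurable0.
  apply/seteqP; split=> // s /=; rewrite in_itv/= andbT => /negP; rewrite -leNgt => ha.
  by have := le_lt_trans ha a0; rewrite ltNge normr_ge0.
rewrite (_ : ~` _ =
  \bigcap_n [set s | `|pair (h s) (f n) - pair c (f n)| <= a * nm mu q (f n)]).
  apply: bigcapT_measurable => n; rewrite -[X in measurable X]setTI.
  apply: (measurable_fun_le measurableT _ _) => //.
  by apply: measurableT_comp => //; apply: measurable_funB => //; exact: mh.
apply/seteqP; split=> s /=; rewrite in_itv/= andbT.
  move=> /negP; rewrite -leNgt => ha n _ /=.
  rewrite -pairB ?DLq//; apply: le_trans (pair_le _ (DLq (fD n))) _.
  by rewrite ler_wpM2r// nm_ge0.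
move=> ha; apply/negP; rewrite -leNgt; apply: Lspace_norm_le => // g Dg.
by have [n <-] := Df g Dg; rewrite pairB ?DLq//; exact: ha.
Qed.

(* A weakly open set is norm open, hence a countable union of closed balls, and
   the norm is a countable supremum of pairings. *)
Lemma measurable_weak_borel : measurable_fun setT (h : S -> weak_borel E).
Proof.
apply: (@measurability _ _ _ (weak_borel E) _ _ (@open (weak_space E))) => //.
move=> _ [U oU <-]; rewrite setTI.
have oU' : open (U : set E) by exact: open_weak.
have [c [c0 cd]] := Lspace_separable.
pose B (kn : nat * nat) : set E := [set v | `|v - c kn.1| <= kn.2.+1%:R^-1].
rewrite (_ : h @^-1` U = \bigcup_kn (if `[< B kn `<=` U >] then h @^-1` B kn else set0)).
  apply: countable_bigcupT_measurable; first exact: countableP.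
  move=> kn; case: ifP => // _.
  rewrite -[X in measurable X]setTI; apply: (measurable_fun_le measurableT _ _) => //.
  exact: measurable_norm_sub.
apply/seteqP; split=> s; last by move=> [kn _]; case: asboolP => // BU /BU.
move=> Us; have := open_nbhs_nbhs (conj oU' Us).
move=> /nbhs_ballP[e /= e0 eU].
have e20 : 0 < e / 2 by rewrite divr_gt0.
have [n _ /(_ n (leqnn n)) /= ne] := near_infty_natSinv_lt (PosNum e20).
have [k hk] := cd (h s) n.+1%:R^-1 ltac:(by rewrite invr_gt0).
exists (k, n) => //; case: asboolP => [_|]; first by rewrite /B /= ltW.
case=> v /= Bv; apply: eU; rewrite -ball_normE /=.
rewrite -[h s](subrK (c k)) -addrA; apply: le_lt_trans (ler_normD _ _) _.
rewrite [e]splitr; apply: ltrD; first exact: lt_trans ne.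
by rewrite distrC; apply: le_lt_trans ne.
Qed.

End measurable.

Lemma pair_dual g : g \in Lfun mu q%:E -> exists F : dual E, forall v, sval F v = pair v g.
Proof.
move=> gL.
have lin : linear_for *%R (fun v : E => pair v g) by move=> a u v; exact: pairDZ.
pose F : {scalar E} := HB.pack (fun v : E => pair v g)
  (GRing.isLinear.Build R E R *%R (fun v : E => pair v g) lin).
have cF : continuous (F : E -> R^o) by exact: pair_continuous.
by exists (exist _ F cF).
Qed.

Lemma weak_borel_pair g : g \in Lfun mu q%:E ->
  measurable_fun setT (fun v : weak_borel E => pair v g).
Proof.
move=> /pair_dual[F FE]; have := measurable_dual F.
by rewrite (_ : (sval F : E -> R) = fun v => pair v g)//; apply/funext.
Qed.

Lemma dual_bounded (F : dual E) : exists2 C : R, 0 < C & forall v, `|sval F v| <= C * `|v|.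
Proof.
have cF : continuous (sval F : E -> R^o) by have := svalP F; exact.
have /linear_boundedP : bounded_near (sval F : E -> R^o) (nbhs (0 : E)).
  exact: (linear_bounded_continuous _).2.
by move=> [M [_ /(_ (`|M| + 1))]]; rewrite (le_lt_trans (ler_norm M)) ?ltrDl// => /(_ isT) H; exists (`|M| + 1) => //; rewrite ltr_wpDl.
Qed.

(** The Riesz theorem with [p] and [q] exchanged, applied to [F] on the classes of elements of [D].
    Density of these classes and continuity of both sides extend the identity to all [v]. *)
Lemma dual_pair (F : dual E) : exists2 g, g \in Lfun mu q%:E & forall v, sval F v = pair v g.
Proof.
have [C C0 FC] := dual_bounded F.
have [mk mkP] : exists mk : (T -> R) -> E, forall f, f \in Lfun mu p%:E ->
    (mk f : T -> R) = f %[ae mu].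
  have H f : exists v : E, f \in Lfun mu p%:E -> (v : T -> R) = f %[ae mu].
    have [fL|fL] := boolP (f \in Lfun mu p%:E); last by exists 0.
    by have [v vf] := Lspace_mk fL; exists v.
  by have [mk mkP] := choice H; exists mk.
have DLp f : D f -> f \in Lfun mu p%:E.
  by move=> Df; apply: bddm_Lfun => //; exact: (ts_bddm DT).
have qp : q^-1 + p^-1 = 1 by rewrite addrC.
have [g [gL _ gU]] : exists g, [/\ g \in Lfun mu q%:E, nm mu q g <= C &
    forall f, D f -> sval F (mk f) = \int[mu]_x (g x * f x)].
  apply: (riesz q1 p1 qp DT _ _ (ltW C0)).
  - move=> f1 f2 D1 D2; rewrite -linearD; congr (sval F _); apply: LspaceP.
    have h1 := mkP _ (DLp _ D1); have h2 := mkP _ (DLp _ D2).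
    apply: filterS3 (mkP _ (LfunD p1w (DLp _ D1) (DLp _ D2))) (Lspace_plusE (mk f1) (mk f2))
      (filterI h1 h2) => x /(_ Logic.I) -> /(_ Logic.I) ->.
    by case=> /(_ Logic.I) -> /(_ Logic.I) ->.
  - move=> c f1 D1; rewrite -[RHS]linearZ; congr (sval F _); apply: LspaceP.
    apply: filterS3 (mkP _ (LfunZ (ratr c) p1w (DLp _ D1))) (Lspace_starE (ratr c) (mk f1))
      (mkP _ (DLp _ D1)) => x /(_ Logic.I) -> /(_ Logic.I) ->.
    by move=> /(_ Logic.I) ->.
  - move=> f Df; apply: le_trans (FC _) _.
    by rewrite (Lspace_norm_ae (Lfun_measurable (DLp _ Df)) (mkP _ (DLp _ Df))).
exists g => // v; apply/eqP; rewrite -subr_eq0 -normr_eq0 eq_le normr_ge0 andbT.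
apply/ler_addgt0Pr => e e0; rewrite add0r.
have K0 : 0 < C + nm mu q g by rewrite ltr_wpDr// nm_ge0.
have [c [[f Df cf] vc]] := Lspace_dense v (divr_gt0 e0 K0).
have cE : c = mk f.
  by apply: LspaceP; apply: filterS2 cf (mkP _ (DLp _ Df)) => x /(_ Logic.I) -> /(_ Logic.I) ->.
have Fc : sval F c = pair c g.
  rewrite cE gU// (pair_ae (Lfun_measurable (DLp _ Df)) (Lfun_measurable gL) (mkP _ (DLp _ Df))).
  by apply: eq_Rintegral => x _; rewrite mulrC.
have -> : sval F v - pair v g = sval F (v - c) - pair (v - c) g.
  by rewrite pairB// linearB Fc opprB addrA subrK.
apply: le_trans (ler_normB _ _) _.
apply: le_trans (lerD (FC _) (pair_le _ gL)) _.
by rewrite [X in _ + X]mulrC -mulrDl mulrC -ler_pdivlMr// ltW.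
Qed.

Lemma pair_cvg_dense (v_ : nat -> E) (v : E) g (C : R) : (forall k, `|v_ k| <= C) ->
  (forall f, D f -> pair (v_ k) f @[k --> \oo] --> pair v f) ->
  g \in Lfun mu q%:E ->
  (forall e : R, 0 < e -> exists2 f, D f & nm mu q (fun x => g x - f x) < e) ->
  pair (v_ k) g @[k --> \oo] --> pair v g.
Proof.
move=> vC vf gL gD; apply/(@cvgrPdist_le _ R^o) => e e0.
have C0 : 0 <= C by rewrite (le_trans _ (vC 0%N)).
have K0 : 0 < C + `|v| + 1 by rewrite ltr_wpDl// addr_ge0.
have e20 : 0 < e / 2 by rewrite divr_gt0.
have [f Df gf] := gD _ (divr_gt0 e20 K0).
have /(@cvgrPdist_le _ R^o) /(_ _ e20) := vf f Df; apply: filterS => k h.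
have -> : pair v g - pair (v_ k) g = pair v (fun x => g x - f x) -
    pair (v_ k) (fun x => g x - f x) + (pair v f - pair (v_ k) f).
  by rewrite !(pair_subr _ gL (DLq Df)); ring.
apply: le_trans (ler_normD _ _) _; rewrite [e]splitr; apply: lerD => //.
apply: le_trans (ler_normB _ _) _.
have gfL := LfunB q1w gL (DLq Df).
apply: le_trans (lerD (pair_le _ gfL) (pair_le _ gfL)) _.
rewrite -mulrDl.
apply: le_trans (_ : (C + `|v| + 1) * nm mu q (fun x => g x - f x) <= _).
  by rewrite ler_wpM2r ?nm_ge0//; have := vC k; lra.
by rewrite mulrC -ler_pdivlMr// ltW.
Qed.

Lemma Lfun_dense r g : 1 <= r -> g \in Lfun mu r%:E -> forall e : R, 0 < e ->
  exists2 f, D f & nm mu r (fun x => g x - f x) < e.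
Proof.
move=> r1 gL e e0; have e20 : 0 < e / 2 by rewrite divr_gt0.
have mg := Lfun_measurable gL.
pose A n := [set x | `|g x| <= n%:R].
have mA n : measurable (A n).
  rewrite -[A n]setTI; apply: (measurable_fun_le measurableT _ _) => //.
  exact: measurableT_comp.
pose h n x := g x * \1_(A n) x.
have bh n : bddm (h n).
  split; first exact: measurable_funM.
  exists n%:R => x; rewrite /h indicE; have [|_] := boolP (x \in A n).
    by rewrite inE mulr1.
  by rewrite mulr0 normr0.
have : nm mu r (fun x => h n x - g x) @[n --> \oo] --> 0.
  apply: (@dominated_nm _ _ _ _ _ _ _ (fun x => `|g x|)) => //.
  - by move=> n; have [] := bh n.
  - apply: nearW => x; apply: cvg_near_cst; near=> n.
    rewrite /h indicE mem_set ?mulr1//=; near: n; exact: nbhs_infty_ger.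
  - apply: Lfun_pow => //; first exact: measurableT_comp.
    under eq_integral do rewrite normr_id.
    by rewrite (LnormE gL)// ltry.
  - move=> n x; rewrite /h indicE; case: (_ \in _); first by rewrite mulr1 subrr normr0.
    by rewrite mulr0 sub0r normrN.
move=> /(@cvgrPdist_lt _ R^o) => /(_ _ e20)[n _ /(_ n (leqnn n))] /=.
rewrite sub0r normrN ger0_norm ?nm_ge0// => hv.
have hL : h n \in Lfun mu r%:E by apply: bddm_Lfun.
have [f Df fh] := ts_dense DT r1 (bh n) e20.
have fL : f \in Lfun mu r%:E by apply: bddm_Lfun => //; exact: (ts_bddm DT).
exists f => //; apply: le_lt_trans (nm_triangle r1 gL hL fL) _.
by rewrite [e]splitr ltrD// nmBC.
Unshelve. all: by end_near. Qed.

(** By [dual_pair] weak convergence is convergence of the pairings with [L^q], and the norm bound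
    reduces these to a dense set. *)
Lemma weak_cvg (v_ : nat -> E) (v : E) (C : R) : (forall k, `|v_ k| <= C) ->
  (forall f, D f -> pair (v_ k) f @[k --> \oo] --> pair v f) ->
  (v_ k : weak_space E) @[k --> \oo] --> (v : weak_space E).
Proof.
move=> vC vf; apply: cvg_weak => F; have [g gL FE] := dual_pair F.
rewrite FE (_ : (fun w => sval F w) = fun w => pair w g); last by apply/funext.
apply: (pair_cvg_dense vC vf gL); exact: Lfun_dense.
Qed.

(** * Bochner integrals of weakly measurable maps *)

Section bochner.
Context dS (S : measurableType dS) (m : {finite_measure set S -> \bar R}).

Lemma simple_pair (s : seq (set S * E)) f : D f ->
  {in s, forall a, measurable a.1} ->
  mu.-integrable setT (EFin \o f) ->
  m.-integrable setT (fun t => (pair (simple_eval s t) f)%:E) /\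
  \int[m]_t pair (simple_eval s t) f = pair (simple_integral m s) f.
Proof.
move=> Df; elim: s => [|[A c] s IHs] ms fi.
  rewrite /simple_integral big_nil pair0 ?DLq//.
  rewrite (_ : (fun t => (pair (simple_eval [::] t) f)%:E) = cst 0%E); last first.
    by apply/funext => t; rewrite /simple_eval big_nil pair0 ?DLq.
  split; first exact: integrable0.
  by under eq_Rintegral do rewrite /simple_eval big_nil pair0 ?DLq//; rewrite /Rintegral integral0.
have ms' : {in s, forall a, measurable a.1} by move=> a sa; apply: ms; rewrite inE sa orbT.
have [i1 i2] := IHs ms' fi.
have mA : measurable A by have := ms (A, c) (mem_head _ _).
have iA : m.-integrable setT (fun t => (pair c f * \1_A t)%:E).
  by apply: bddm_integrable; apply: bddmZ; exact: bddm_indic.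
have E1 t : pair (simple_eval ((A, c) :: s) t) f = pair c f * \1_A t + pair (simple_eval s t) f.
  by rewrite /simple_eval big_cons /= pairDZ ?DLq// mulrC.
split.
  rewrite (_ : (fun t => _) = fun t => (pair c f * \1_A t)%:E + (pair (simple_eval s t) f)%:E)%E.
    exact: integrableD.
  by apply/funext => t; rewrite E1 EFinD.
under eq_Rintegral do rewrite E1.
rewrite RintegralD// i2 /simple_integral big_cons /= pairDZ ?DLq//; congr (_ + _).
rewrite RintegralZl//; last exact/bddm_integrable/bddm_indic.
by rewrite mulrC; congr (_ * _); rewrite /Rintegral integral_indic// setIT.
Qed.

Variable h : S -> E.
Hypothesis mh : forall f, D f -> measurable_fun setT (fun s => pair (h s) f).
Hypothesis ih : (\int[m]_s `|h s|%:E < +oo)%E.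

(** The integral is first obtained in the weak sense from Riesz. Separability supplies the simple
    functions, which send [s] to the nearest of [c 0, ..., c k]; they converge pointwise and are
    dominated. *)
Lemma pettis_bochner : exists I : E, is_bochner_integral m h I /\
  forall f, D f -> pair I f = \int[m]_s pair (h s) f.
Proof.
have mn c : measurable_fun setT (fun s => `|h s - c|) := measurable_norm_sub mh c.
have mn0 : measurable_fun setT (fun s => `|h s|) by have := mn 0; under eq_fun do rewrite subr0.
have iN : m.-integrable setT (fun s => `|h s|%:E).
  apply/integrableP; split; first exact/measurable_EFinP.
  by under eq_integral do rewrite gee0_abs ?lee_fin//.
have ip f : D f -> m.-integrable setT (fun s => (pair (h s) f)%:E).
  move=> Df; apply: (le_integrable measurableT _ _ (integrableZl measurableT (nm mu q f) iN)).
    exact/measurable_EFinP/mh.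
  move=> s _ /=; rewrite lee_fin normrM normr_id (ger0_norm (nm_ge0 _ _ _)) mulrC.
  by apply: pair_le; exact: DLq.
have [I [_ IE]] : exists I : E, `|I| <= \int[m]_s `|h s| /\
    forall f, D f -> pair I f = \int[m]_s pair (h s) f.
  apply: riesz_Lspace.
  - by apply: Rintegral_ge0.
  - move=> f g Df Dg; rewrite -RintegralD//; [|exact: ip|exact: ip].
    by apply: eq_Rintegral => s _; rewrite pair_addr ?DLq.
  - move=> c f Df; rewrite -RintegralZl//; last exact: ip.
    by apply: eq_Rintegral => s _; rewrite pair_scaler ?DLq.
  - move=> f Df; apply: le_trans (le_normr_Rintegral measurableT (ip f Df)) _.
    rewrite -RintegralZr//; apply: le_Rintegral => //.
    + exact: (integrable_norm (ip f Df)).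
    + by have := integrableZr measurableT (nm mu q f) iN.
    + by move=> s _; apply: pair_le; exact: DLq.
exists I; split=> //.
have [c [c0 cd]] := Lspace_separable.
(* [P k i s] says that [c i] is nearest to [h s] among [c 0, ..., c k]. Taking the least such index
   makes the sets [A k i] with [i <= k] a partition. *)
pose P k i s := all (fun j => `|h s - c i| <= `|h s - c j|) (iota 0 k.+1).
pose A k i := [set s | P k i s && all (fun j => ~~ P k j s) (iota 0 i)].
have mP k i : measurable [set s | P k i s].
  rewrite /P; elim: (iota 0 k.+1) => [|j l IHl]; first by rewrite [X in measurable X](_ : _ = setT)//; apply/seteqP.
  rewrite (_ : [set s | _] = [set s | `|h s - c i| <= `|h s - c j|] `&`
     [set s | all (fun j => `|h s - c i| <= `|h s - c j|) l]); last first.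
    by apply/seteqP; split=> s /= => [/andP[]|[-> ->]].
  apply: measurableI => //; rewrite -[X in measurable X]setTI.
  exact: (measurable_fun_le measurableT).
have mA k i : measurable (A k i).
  rewrite (_ : A k i = [set s | P k i s] `&` [set s | all (fun j => ~~ P k j s) (iota 0 i)]); last first.
    by apply/seteqP; split=> s /= => [/andP[]|[? ?]]; last exact/andP.
  apply: measurableI => //.
  elim: (iota 0 i) => [|j l IHl]; first by rewrite [X in measurable X](_ : _ = setT)//; apply/seteqP.
  rewrite (_ : [set s | _] = ~` [set s | P k j s] `&` [set s | all (fun j => ~~ P k j s) l]); last first.
    by apply/seteqP; split=> s /= => [/andP[/negP]|[/negP -> ->]].
  by apply: measurableI => //; exact: measurableC.
pose sk k : seq (set S * E) := [seq (A k i, c i) | i <- iota 0 k.+1].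
have mS k : {in sk k, forall a, measurable a.1} by move=> a /mapP[i _ ->]; exact: mA.
have evP k s : exists i, [/\ (i <= k)%N, simple_eval (sk k) s = c i,
    P k i s & forall j, j \in iota 0 k.+1 -> \1_(A k j) s = (j == i)%:R :> R].
  have exP : exists i, (i <= k)%N && P k i s.
    have [i _ iP] := @arg_minP _ _ _ (ord0 : 'I_k.+1) xpredT (fun i => `|h s - c i|) isT.
    exists i; rewrite -ltnS ltn_ord /=; apply/allP => j; rewrite mem_iota add0n => /andP[_ jk].
    exact: (iP (Ordinal jk)).
  have [i /andP[ik Pi] imin] := ex_minnP exP.
  have ind j : j \in iota 0 k.+1 -> \1_(A k j) s = (j == i)%:R :> R.
    rewrite mem_iota add0n ltnS => /andP[_ jk]; rewrite indicE; congr (_%:R).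
    have -> : (s \in A k j) = P k j s && all (fun j => ~~ P k j s) (iota 0 j).
      by apply/idP/idP; rewrite inE.
    congr nat_of_bool; apply/andP/eqP => [[Pj /allP al]|->].
      apply/eqP; rewrite eqn_leq imin ?jk ?Pj// andbT leqNgt; apply/negP => ij.
      by have := al i; rewrite mem_iota add0n ij Pi => /(_ isT).
    split=> //; apply/allP => j'; rewrite mem_iota add0n => /andP[_ ji].
    by apply/negP => Pj'; have := imin j'; rewrite Pj' (ltnW (leq_trans ji ik)) leqNgt ji => /(_ isT).
  exists i; split=> //.
  rewrite /simple_eval big_map (bigD1_seq i) ?iota_uniq ?mem_iota ?add0n ?ltnS//=.
  rewrite ind ?mem_iota ?add0n ?ltnS// eqxx scale1r big_seq_cond big1 ?addr0// => j /andP[jk ji].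
  by rewrite ind// (negbTE ji) scale0r.
have evle k s : `|h s - simple_eval (sk k) s| <= `|h s|.
  have [i [_ -> /allP Pi _]] := evP k s.
  by have := Pi 0%N; rewrite mem_iota /= c0 subr0; apply.
have evc s : `|h s - simple_eval (sk k) s| @[k --> \oo] --> 0.
  apply/(@cvgrPdist_lt _ R^o) => e e0; have [j hj] := cd (h s) e e0.
  near=> k; rewrite sub0r normrN normr_id.
  have [i [_ -> /allP Pi _]] := evP k s.
  apply: le_lt_trans hj; apply: Pi; rewrite mem_iota add0n ltnS /=.
  by near: k; exists j.
have mev k : measurable_fun setT (fun s => `|h s - simple_eval (sk k) s|).
  rewrite (_ : (fun s => _) = fun s => \sum_(i <- iota 0 k.+1) \1_(A k i) s * `|h s - c i|).
    by apply: measurable_sum => i; apply: measurable_funM.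
  apply/funext => s; have [i [ik -> _ ind]] := evP k s.
  rewrite (bigD1_seq i) ?iota_uniq ?mem_iota ?add0n ?ltnS//=.
  rewrite ind ?mem_iota ?add0n ?ltnS// eqxx mul1r big_seq_cond big1 ?addr0// => j /andP[jk ji].
  by rewrite ind// (negbTE ji) mul0r.
have ev0 : \int[m]_s `|h s - simple_eval (sk k) s| @[k --> \oo] --> (0 : R).
  rewrite (_ : 0 = \int[m]_s (cst 0 : S -> R) s); last by rewrite /Rintegral integral0.
  apply: (@dominated_Rintegral _ _ _ _ _ _ (fun s => `|h s|)) => //.
  - exact: nearW.
  - by move=> k s; rewrite normr_id.
have iev k : m.-integrable setT (fun s => `|h s - simple_eval (sk k) s|%:E).
  apply: (le_integrable measurableT _ _ iN); first exact/measurable_EFinP.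
  by move=> s _ /=; rewrite lee_fin !normr_id.
exists sk; split.
- by move=> k a ak; split; [exact: mS ak|rewrite ltey_eq fin_num_measure//; exact: mS ak].
- apply: nearW => s; apply/cvgrPdist_lt => e e0.
  have /(@cvgrPdist_lt _ R^o) /(_ _ e0) := evc s.
  by apply: filterS => k; rewrite sub0r normrN normr_id.
- rewrite (_ : (fun k => _) = fun k => (\int[m]_s `|h s - simple_eval (sk k) s|)%:E); last first.
    by apply/funext => k; rewrite fineK//; exact: (integrable_fin_num measurableT (iev k)).
  by apply/fine_cvgP; split; [exact: nearW|exact: ev0].
- apply/cvgrPdist_le => e e0.
  have /(@cvgrPdist_le _ R^o) /(_ _ e0) := ev0; apply: filterS => k.
  rewrite sub0r normrN ger0_norm; last exact: Rintegral_ge0.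
  apply: le_trans; rewrite -normrN opprB.
  (* The norm of the difference is estimated through pairings, for which both integrals become
     scalar ones. *)
  apply: Lspace_norm_le; first exact: Rintegral_ge0.
  move=> f Df; rewrite pairB ?DLq//.
  have [i1 <-] := simple_pair Df (mS k) (bddm_integrable mu (ts_bddm DT Df)).
  rewrite IE// -RintegralB//; last exact: ip.
  have i2 := integrableB measurableT i1 (ip f Df).
  apply: le_trans (le_normr_Rintegral measurableT i2) _.
  rewrite -RintegralZr//; last exact: iev.
  apply: le_Rintegral => //.
  + exact: (integrable_norm i2).
  + by have := integrableZr measurableT (nm mu q f) (iev k).
  + move=> s _ /=; rewrite -pairB ?DLq// -[X in X * _]normrN opprB.
    by apply: pair_le; exact: DLq.
Unshelve. all: by end_near. Qed.

End bochner.
End test.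
End Lspace_duality.

(** * Convex combinations of tails *)

Section ae_summable.
Context d (T : measurableType d) (R : realType).
Variable mu : {measure set T -> \bar R}.

(** By monotone convergence the sum of the series has a finite integral, hence is finite almost
    everywhere. *)
Lemma ae_summable (f : nat -> T -> R) (b : nat -> R) :
  (forall i, measurable_fun setT (f i)) -> (forall i x, 0 <= f i x) ->
  (forall i, (\int[mu]_x (f i x)%:E <= (b i)%:E)%E) -> cvgn (series b) ->
  {ae mu, forall x, cvgn (series (f^~ x))}.
Proof.
move=> mf f0 fb cb.
have mf' i : measurable_fun setT (fun x => (f i x)%:E) by exact/measurable_EFinP.
have f0' i x : setT x -> (0 <= (f i x)%:E)%E by move=> _; rewrite lee_fin.
have b0 i : 0 <= b i by rewrite -lee_fin; apply: le_trans (fb i); apply: integral_ge0 => x _; rewrite lee_fin.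
have sumlty : (\int[mu]_x (\sum_(i <oo) (f i x)%:E) < +oo)%E.
  rewrite integral_nneseries//.
  apply: (@le_lt_trans _ _ (\sum_(i <oo) (b i)%:E)%E).
    by apply: lee_nneseries => // i *; first [exact: fb|apply: integral_ge0 => x _; rewrite lee_fin].
  have -> : (\sum_(i <oo) (b i)%:E = (limn (series b))%:E)%E.
    rewrite -EFin_lim//; congr (limn _); apply/funext => n.
    by rewrite /= /series /= sumEFin.
  exact: ltry.
have ms : measurable_fun setT (fun x => \sum_(i <oo) (f i x)%:E)%E.
  by apply: ge0_emeasurable_sum => // *; rewrite lee_fin.
have : mu.-integrable setT (fun x => \sum_(i <oo) (f i x)%:E)%E.
  apply/integrableP; split=> //; apply: le_lt_trans sumlty.
  apply: ge0_le_integral => //=; first exact: measurableT_comp.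
  by move=> x _; rewrite gee0_abs//; apply: nneseries_ge0 => *; rewrite lee_fin.
move=> /(integrable_ae measurableT); apply: filterS => x /(_ Logic.I) fx.
apply: nondecreasing_is_cvgn.
  by apply: nondecreasing_series => i _; rewrite f0.
exists (fine (\sum_(i <oo) (f i x)%:E)) => _ [n _ <-].
rewrite -lee_fin fineK// /series /= -sumEFin.
by apply: nneseries_lim_ge => i _; rewrite lee_fin.
Qed.

Lemma ae_cvg0_summable (f : nat -> T -> R) (b : nat -> R) :
  (forall i, measurable_fun setT (f i)) -> (forall i x, 0 <= f i x) ->
  (forall i, (\int[mu]_x (f i x)%:E <= (b i)%:E)%E) -> cvgn (series b) ->
  {ae mu, forall x, f i x @[i --> \oo] --> 0}.
Proof.
move=> mf f0 fb cb; apply: filterS (ae_summable mf f0 fb cb) => x.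
exact: cvg_series_cvg_0.
Qed.

Lemma ae_cvg_summable (f : nat -> T -> R) (b : nat -> R) :
  (forall i, measurable_fun setT (f i)) ->
  (forall i, (\int[mu]_x `|f i.+1 x - f i x|%:E <= (b i)%:E)%E) -> cvgn (series b) ->
  {ae mu, forall x, cvgn (f^~ x)}.
Proof.
move=> mf fb cb.
have mD i : measurable_fun setT (fun x => `|f i.+1 x - f i x|).
  by apply: measurableT_comp => //; exact: measurable_funB.
apply: filterS (ae_summable mD (fun i x => normr_ge0 _) fb cb) => x cx.
have : cvgn (series (fun i => f i.+1 x - f i x)) by exact: normed_cvg.
move=> h; rewrite (_ : (f^~ x) = fun n => f 0%N x + series (fun i => f i.+1 x - f i x) n).
  by apply: is_cvgD => //; exact: is_cvg_cst.
by apply/funext => n; rewrite /series /= telescope_sumr// addrC subrK.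
Qed.

End ae_summable.

Section convex_tail.
Context d (T : measurableType d) (R : realType).
Variables (mu : {finite_measure set T -> \bar R}) (f : nat -> T -> R).
Hypothesis mf : forall k, measurable_fun setT (f k).
Hypothesis f1 : forall k x, `|f k x| <= 1.

Definition convex_weights (n N : nat) (a : nat -> R) :=
  [/\ forall k, 0 <= a k, forall k, (k < n)%N -> a k = 0,
      forall k, (N <= k)%N -> a k = 0 & \sum_(k < N) a k = 1].

Let comb (Na : nat * (nat -> R)) (x : T) := \sum_(k < Na.1) Na.2 k * f k x.

Let comb_wide N N' a x : (N <= N')%N -> (forall k, (N <= k)%N -> a k = 0) ->
  comb (N, a) x = comb (N', a) x.
Proof.
move=> NN' aN; rewrite /comb /= (big_ord_widen _ (fun k => a k * f k x) NN').
rewrite big_mkcond /=; apply: eq_bigr => k _; case: ltnP => // Nk.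
by rewrite aN// mul0r.
Qed.

Let bcomb Na : bddm (comb Na).
Proof.
rewrite /comb; case: Na => N a /=.
split; first by apply: measurable_sum => k; apply: measurable_funM.
exists (\sum_(k < N) `|a k|) => x.
apply: le_trans (ler_norm_sum _ _ _) _; apply: ler_sum => k _.
by rewrite normrM ler_piMr.
Qed.

Let sq (g : T -> R) := \int[mu]_x (g x * g x).

Let weights n := [set Na : nat * (nat -> R) | convex_weights n Na.1 Na.2].

Let rho n := inf [set sq (comb Na) | Na in weights n].

Let weights_n n : weights n (n.+1, fun k => (k == n)%:R).
Proof.
split=> //=.
- by move=> k kn; rewrite ltn_eqF.
- by move=> k nk; rewrite gtn_eqF.
- rewrite big_ord_recr /= eqxx big1 ?add0r// => k _.
  by rewrite ltn_eqF//.
Qed.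

Let sq_ge0 g : 0 <= sq g.
Proof. by apply: Rintegral_ge0 => x _; rewrite -expr2 sqr_ge0. Qed.

Let lb n : lbound [set sq (comb Na) | Na in weights n] 0.
Proof. by move=> _ [Na _ <-]. Qed.

Let rho_le n Na : weights n Na -> rho n <= sq (comb Na).
Proof. by move=> wNa; apply: ge_inf; [exists 0; exact: lb|exists Na]. Qed.

Let weightsS n m : (n <= m)%N -> weights m `<=` weights n.
Proof.
by move=> nm [N a] [/= a0 an aN a1]; split => // k kn; apply: an; exact: leq_trans nm.
Qed.

Let rho_homo n m : (n <= m)%N -> rho n <= rho m.
Proof.
move=> nm; apply: lb_le_inf; first by exists (sq (comb (m.+1, fun k => (k == m)%:R))); eexists => //; exact: weights_n.
by move=> _ [Na wNa <-]; apply: rho_le; exact: weightsS wNa.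
Qed.

Let rho_bd n : rho n <= fine (mu setT).
Proof.
apply: le_trans (rho_le (weights_n n)) _.
rewrite -[leRHS]mul1r -Rintegral_cst//.
have i1 : mu.-integrable setT (EFin \o (fun x => comb (n.+1, fun k => (k == n)%:R) x * comb (n.+1, fun k => (k == n)%:R) x)).
  by apply: bddm_integrable; apply: bddmM; exact: bcomb.
apply: le_Rintegral => //; first exact: (bddm_integrable mu (@bddm_cst _ T R 1)).
move=> x _; rewrite /comb /= big_ord_recr /= eqxx mul1r big1 ?add0r; last first.
  by move=> k _; rewrite ltn_eqF ?mul0r.
by apply: le_trans (ler_norm _) _; rewrite normrM mulr_ile1.
Qed.

Let parallelogram g h : bddm g -> bddm h ->
  sq (fun x => g x - h x) = 2 * sq g + 2 * sq h - 4 * sq (fun x => 2^-1 * (g x + h x)).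
Proof.
move=> bg bh.
have bgg := bddm_integrable mu (bddmM bg bg).
have bhh := bddm_integrable mu (bddmM bh bh).
have bgh := bddm_integrable mu (bddmM bg bh).
have sqE (a b : R) : \int[mu]_x ((a * g x + b * h x) * (a * g x + b * h x)) =
    a ^+ 2 * sq g + (b ^+ 2 * sq h + 2 * a * b * \int[mu]_x (g x * h x)).
  rewrite /sq -RintegralZl// -RintegralZl// -RintegralZl//.
  rewrite -RintegralD//; [|exact: (integrableZl measurableT _ bhh)|exact: (integrableZl measurableT _ bgh)].
  rewrite -RintegralD//; [|exact: (integrableZl measurableT _ bgg)|].
    by apply: eq_Rintegral => x _; ring.
  apply: (integrableD measurableT (integrableZl measurableT (b^+2) bhh) (integrableZl measurableT (2 * a * b) bgh)).
have -> : sq (fun x => g x - h x) = sq g + (sq h - 2 * \int[mu]_x (g x * h x)).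
  rewrite (_ : sq _ = \int[mu]_x ((1 * g x + -1 * h x) * (1 * g x + -1 * h x))).
    by rewrite sqE; ring.
  by apply: eq_Rintegral => x _; ring.
have -> : sq (fun x => 2^-1 * (g x + h x)) = 4^-1 * sq g + (4^-1 * sq h + 2^-1 * \int[mu]_x (g x * h x)).
  have := sqE 2^-1 2^-1 => H.
  rewrite (_ : sq _ = \int[mu]_x ((2^-1 * g x + 2^-1 * h x) * (2^-1 * g x + 2^-1 * h x))).
    by rewrite H; congr (_ + (_ + _)); [congr (_ * _)|congr (_ * _)|congr (_ * _)]; field.
  by apply: eq_Rintegral => x _; ring.
by field.
Qed.

(* The near-minimizers of the [L^2] norm over the convex hulls of the tails form
   a Cauchy sequence, by the parallelogram identity. *)
Lemma convex_tail : exists (N : nat -> nat) (a : nat -> nat -> R),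
  (forall n, convex_weights n (N n) (a n)) /\
  {ae mu, forall x, cvgn (fun n => \sum_(k < N n) a n k * f k x)}.
Proof.
pose rr := sup (range rho).
have hs : has_sup (range rho).
  split; first by exists (rho 0%N), 0%N.
  by exists (fine (mu setT)) => _ [n _ <-]; exact: rho_bd.
have rle n : rho n <= rr by apply: ub_le_sup; [exact: hs.2|exists n].
(* The passage from [L^2] to [L^1] below uses [|D| <= 2^-i + 2^i * D^2]. The rate [8^-i] absorbs the
   factor [2^i] and leaves a summable bound. *)
pose dl i : R := 8^-1 ^+ i.
have dl0 i : 0 < dl i by rewrite exprn_gt0.
have Hn i : exists n, rr - dl i < rho n.
  by have [_ [n _ <-] h] := sup_adherent (dl0 i) hs; exists n.
have [n0 n0P] := choice Hn.
(* At least [i], because the weights of index [i] must start there, and nondecreasing, so that the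
   midpoint of two consecutive combinations is admissible for the earlier tail. *)
pose nn i := (i + \max_(j < i.+1) n0 j)%N.
have nn_ge i : rr - dl i < rho (nn i).
  apply: lt_le_trans (n0P i) _; apply: rho_homo; apply: leq_trans (leq_addl _ _).
  exact: (leq_bigmax (ord_max : 'I_i.+1)).
have nn_homo i : (nn i <= nn i.+1)%N.
  rewrite /nn leq_add// [leqRHS]big_ord_recr /=; exact: leq_maxl.
have Hg i : exists Na, weights (nn i) Na /\ sq (comb Na) < rho (nn i) + dl i.
  have [] := @inf_adherent _ [set sq (comb Na) | Na in weights (nn i)] _ (dl0 i).
    by split; [exists (sq (comb ((nn i).+1, fun k => (k == nn i)%:R))); eexists => //; exact: weights_n|exists 0; exact: lb].
  by move=> _ [Na wNa <-] h; exists Na.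
have [g gP] := choice Hg.
exists (fun i => (g i).1), (fun i => (g i).2); split.
  by move=> i; have [w _] := gP i; have := weightsS (leq_addr _ _ : (i <= nn i)%N) w.
(* Both squared norms are at most [rr + dl i] and that of the midpoint is at least [rr - dl i]; the
   parallelogram identity turns this into [8 * dl i]. *)
have sqd i : sq (fun x => comb (g i.+1) x - comb (g i) x) <= 8 * dl i.
  rewrite parallelogram//.
  have [w1 h1] := gP i.+1; have [w0 h0] := gP i.
  have w0' := weightsS (nn_homo i) w1.
  pose NN := maxn (g i.+1).1 (g i).1.
  pose aa k := 2^-1 * ((g i.+1).2 k + (g i).2 k).
  have [a0 an aN a1] := w0; have [b0 bn bN b1] := w0'.
  have ext (b : nat -> R) M : (M <= NN)%N -> (forall k, (M <= k)%N -> b k = 0) ->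
      \sum_(k < NN) b k = \sum_(k < M) b k.
    move=> MN bM; rewrite (big_ord_widen _ b MN) big_mkcond /=.
    by rewrite [RHS]big_mkcond/=; apply: eq_bigr => k _; case: ltnP => // /bM.
  have wa : weights (nn i) (NN, aa).
    split => /=.
    - by move=> k; rewrite mulr_ge0// addr_ge0.
    - by move=> k ki; rewrite /aa an// bn// addr0 mulr0.
    - by move=> k; rewrite geq_max => /andP[k1 k2]; rewrite /aa aN// bN// addr0 mulr0.
    - rewrite -mulr_sumr big_split /= (ext _ _ (leq_maxl _ _) bN) (ext _ _ (leq_maxr _ _) aN) a1 b1.
      lra.
  have -> : (fun x => 2^-1 * (comb (g i.+1) x + comb (g i) x)) = comb (NN, aa).
    apply/funext => x; rewrite [in LHS](surjective_pairing (g i.+1)) [in LHS](surjective_pairing (g i)).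
    rewrite (@comb_wide _ NN) ?leq_maxl// (@comb_wide (g i).1 NN) ?leq_maxr//.
    rewrite /comb /= -big_split /= mulr_sumr; apply: eq_bigr => k _.
    by rewrite /aa -mulrDl mulrA.
  have := rho_le wa; have := rle (nn i.+1); have := rle (nn i); have := nn_ge i.
  have : dl i.+1 <= dl i.
    by rewrite /dl exprS ler_piMl ?ltW//; lra.
  move=> *; lra.
pose b i : R := 2^-1 ^+ i * (fine (mu setT) + 8).
apply: (@ae_cvg_summable _ _ _ mu (fun i => comb (g i)) b).
- by move=> i; have [] := bcomb (g i).
- move=> i; pose D x := comb (g i.+1) x - comb (g i) x.
  have bD : bddm D by apply: bddmB; exact: bcomb.
  have iD : mu.-integrable setT (EFin \o D) by exact: bddm_integrable.
  have iD2 := bddm_integrable mu (bddmM bD bD).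
  have -> : (\int[mu]_x `|comb (g i.+1) x - comb (g i) x|%:E = (\int[mu]_x `|D x|)%:E)%E.
    by rewrite fineK//; exact: (integrable_fin_num measurableT (integrable_norm iD)).
  rewrite lee_fin.
  have i1 : mu.-integrable setT (EFin \o (fun x => 2^-1 ^+ i + 2 ^+ i * (D x * D x))).
    by apply: bddm_integrable; apply: bddmD; [exact: bddm_cst|exact/bddmZ/bddmM].
  apply: (@le_trans _ _ (\int[mu]_x (2^-1 ^+ i + 2 ^+ i * (D x * D x)))).
    apply: le_Rintegral => //; first exact: (integrable_norm iD).
    move=> x _; rewrite -[D x * D x]expr2 -real_normK ?num_real//.
    have t0 : (0 : R) < 2 ^+ i by rewrite exprn_gt0.
    have tE : (2^-1 ^+ i : R) = (2 ^+ i)^-1 by rewrite exprVn.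
    rewrite tE; move: (2 ^+ i) t0 (`|D x|) => t t0 y.
    have : 0 <= t^-1 * (t * y - 1) ^+ 2 by rewrite mulr_ge0 ?sqr_ge0// invr_ge0 ltW.
    have -> : t^-1 * (t * y - 1) ^+ 2 = t * y ^+ 2 - 2 * y + t^-1 by field; rewrite gt_eqF.
    have : 0 < t^-1 by rewrite invr_gt0.
    have : 0 <= t * y ^+ 2 by rewrite mulr_ge0 ?sqr_ge0 ?ltW.
    lra.
  rewrite RintegralD//; [|exact: (bddm_integrable mu (@bddm_cst _ T R (2^-1 ^+ i)))|exact: (integrableZl measurableT (2 ^+ i) iD2)].
  rewrite Rintegral_cst// RintegralZl// /b mulrDr lerD2l.
  apply: le_trans (ler_wpM2l _ (sqd i)) _; first by rewrite exprn_ge0.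
  rewrite mulrCA mulrC ler_wpM2r// /dl -exprMn.
  by apply: lerXn2r; rewrite ?nnegrE; lra.
- have : cvgn (series (fun i => (fine (mu setT) + 8) * 2^-1 ^+ i) : nat -> R).
    by apply: is_cvg_geometric_series; rewrite ger0_norm//; lra.
  by congr (cvgn _); congr series; apply/funext => i; rewrite /b mulrC.
Qed.

End convex_tail.

(** * Random indices *)

Section finite_product.
Context d1 d2 (T1 : measurableType d1) (T2 : measurableType d2) (R : realType).
Variables (m1 : {finite_measure set T1 -> \bar R}) (m2 : {finite_measure set T2 -> \bar R}).

Let product_measure1_fin : fin_num_fun (m1 \x m2)%E.
Proof.
move=> A mA; rewrite ge0_fin_numE//.
apply: (@le_lt_trans _ _ ((m1 \x m2)%E setT)); first by apply: le_measure; rewrite ?inE.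
by rewrite -setXTT product_measure1E// -ge0_fin_numE ?mule_ge0// fin_numM// fin_num_measure.
Qed.

(* The library makes [m1 \x m2] a finite measure only for subprobabilities. *)
Definition prodfm : {finite_measure set (T1 * T2)%type -> \bar R} :=
  HB.pack_for {finite_measure set (T1 * T2)%type -> \bar R} (m1 \x m2)%E
    (Measure_isFinite.Build _ _ _ (m1 \x m2)%E product_measure1_fin).

End finite_product.

Section unit_interval.
Context (R : realType).

Lemma lebesgue_itv01_fin : (lebesgue_measure (`[0%R, 1%R[%classic : set (measurableTypeR R)) < +oo)%E.
Proof. by rewrite lebesgue_measure_itv /= lte_fin ltr01 EFinN sube0 ltry. Qed.

(** The uniform law on [0, 1), half-open like the intervals into which the weights cut it. *)
Definition lam : set (measurableTypeR R) -> \bar R :=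
  mfrestr (f := @lebesgue_measure R) (measurable_itv `[0%R, 1%R[) lebesgue_itv01_fin.

HB.instance Definition _ := FiniteMeasure.copy lam
  (mfrestr (f := @lebesgue_measure R) (measurable_itv `[0%R, 1%R[) lebesgue_itv01_fin).

Lemma lamE (A : set R) : lam A = lebesgue_measure (A `&` `[0%R, 1%R[%classic).
Proof. by []. Qed.

Lemma lam_setT : lam setT = 1%E.
Proof. by rewrite lamE setTI lebesgue_measure_itv /= lte_fin ltr01 EFinN sube0. Qed.

HB.instance Definition _ := Measure_isProbability.Build _ _ R lam lam_setT.

Lemma lam_itv (a b : R) : 0 <= a -> a <= b -> b <= 1 ->
  lam [set t | a <= t < b] = (b - a)%:E.
Proof.
move=> a0 ab b1; rewrite lamE (_ : _ `&` _ = `[a, b[%classic); last first.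
  apply/seteqP; split=> t /=; rewrite !in_itv /=; first by case.
  by move=> /andP[h1 h2]; rewrite h1 h2 (le_trans a0 h1) (lt_le_trans h2 b1).
rewrite lebesgue_measure_itv /= lte_fin; case: ifPn => [_|]; first by rewrite -EFinB.
by rewrite -leNgt => ba; have -> : a = b; [apply/le_anti; rewrite ab ba|rewrite subrr].
Qed.

Lemma lam_ae01 (A : set R) : (forall t, 0 <= t < 1 -> A t) -> {ae lam, forall t, A t}.
Proof.
move=> H; exists (~` `[0%R, 1%R[%classic); split.
- by apply: measurableC; exact: measurable_itv.
- by rewrite lamE setICl measure0.
- by move=> t /= nA t01; apply: nA; apply: H; rewrite in_itv in t01.
Qed.

Lemma lam_countable (A : set R) : countable A -> {ae lam, forall t, ~ A t}.
Proof.
move=> cA; exists A; split => //; first exact: countable_measurable.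
- apply/eqP; rewrite eq_le measure_ge0 andbT lamE.
  have <- : lebesgue_measure A = 0%E by exact: countable_lebesgue_measure0.
  apply: le_measure; rewrite ?inE//; last exact: countable_measurable.
  by apply: measurableI; [exact: countable_measurable|exact: measurable_itv].
- by move=> t /= /contrapT.
Qed.

Lemma lam_ae_dense (A : set R) (a b : R) : 0 <= a -> a < b -> b <= 1 ->
  {ae lam, forall t, A t} -> exists2 t, a < t < b & A t.
Proof.
move=> a0 ab b1 [N [mN N0 AN]]; apply: contrapT => nE.
have mab : a < (a + b) / 2 by rewrite ltr_pdivlMr// mulrDr mulr1 ltrD2l.
have mbb : (a + b) / 2 < b by rewrite ltr_pdivrMr// mulrDr mulr1 ltrD2r.
have : ((b - (a + b) / 2)%:E <= lam N)%E.
  rewrite -(@lam_itv ((a + b) / 2) b (le_trans a0 (ltW mab)) (ltW mbb) b1).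
  apply: le_measure; rewrite ?inE//.
    rewrite (_ : [set t | _] = `[(a + b) / 2, b[%classic); first exact: measurable_itv.
    by apply/seteqP; split=> t /=; rewrite in_itv.
  move=> t /= /andP[t1 t2]; apply: AN => At; apply: nE; exists t => //.
  by rewrite t2 (lt_le_trans mab t1).
by rewrite N0 lee_fin leNgt subr_gt0 mbb.
Qed.

Lemma lam_ae_filter : Filter (almost_everywhere lam).
Proof. exact: (ae_filter_ringOfSetsType (lam : {measure set _ -> \bar R})). Qed.

End unit_interval.

Section ae_product.
Context d1 d2 (T1 : measurableType d1) (T2 : measurableType d2) (R : realType).
Variables (m1 : {sigma_finite_measure set T1 -> \bar R}) (m2 : {sigma_finite_measure set T2 -> \bar R}).

Lemma ae_prod (A : set (T1 * T2)) : {ae (m1 \x m2)%E, forall z, A z} ->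
  {ae m1, forall x, {ae m2, forall y, A (x, y)}}.
Proof.
move=> [N [mN N0 AN]].
have m0 : {ae m1, forall x, m2 (xsection N x) = 0%E}.
  have mm : measurable_fun setT (fun x => m2 (xsection N x)) by exact: measurable_fun_xsection.
  have : (\int[m1]_x `|m2 (xsection N x)| = 0)%E.
    by under eq_integral do rewrite gee0_abs//; exact: N0.
  move/(ae_eq_integral_abs m1 measurableT mm).
  by apply: filterS => x /(_ Logic.I).
apply: filterS m0 => x mx; exists (xsection N x); split=> //.
  exact: measurable_xsection.
by move=> y /= nA; rewrite /xsection /= inE; apply: AN.
Qed.

End ae_product.

(** * Quantiles of a weighted finite family *)

Section sorted_index.
Context (R : realType) (N : nat) (a z : nat -> R).
Hypotheses (a0 : forall k, 0 <= a k) (a1 : \sum_(k < N) a k = 1).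

(** Equal values are ordered by their indices. The order is thus strict and total, and the intervals
    cut out of [0, 1) are disjoint. *)
Let prec (j k : nat) := (z j < z k) || ((z j == z k) && (j < k)%N).

Let precT i j k : prec i j -> prec j k -> prec i k.
Proof.
rewrite /prec => /orP[ij|/andP[/eqP -> ij]] /orP[jk|/andP[/eqP <- jk]].
- by rewrite (lt_trans ij jk).
- by rewrite ij.
- by rewrite jk.
- by rewrite eqxx (ltn_trans ij jk) orbT.
Qed.

Let precI k : prec k k = false.
Proof. by rewrite /prec ltxx eqxx ltnn. Qed.

Let prec_total j k : j != k -> prec j k || prec k j.
Proof. by rewrite /prec neq_ltn; case: (ltgtP (z j) (z k)). Qed.

(** Left end of the interval of length [a k] that [k] receives when [0, 1) is cut in the order
    [prec]. *)
Definition rank_below (k : nat) : R := \sum_(j < N) a j * (prec j k)%:R.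

Local Notation S := rank_below.

Let S_split (k : 'I_N) : S k + a k = \sum_(j < N) a j * (prec j k || (j == k))%:R.
Proof.
rewrite /S (bigD1 k)//= precI mulr0 add0r [RHS](bigD1 k)//= precI eqxx mulr1 addrC; congr (_ + _).
by apply: eq_bigr => j jk; rewrite (negbTE jk) orbF.
Qed.

Let S_lt (j k : 'I_N) : prec j k -> S j + a j <= S k.
Proof.
move=> jk; rewrite S_split; apply: ler_sum => i _; apply: ler_wpM2l => //.
rewrite ler_nat; case: (boolP (prec i j)) => /= [ij|_]; first by rewrite (precT ij jk).
by case: eqVneq => //= ->; rewrite jk.
Qed.

Lemma rank_below_ge0 k : 0 <= S k.
Proof. by apply: sumr_ge0 => j _; rewrite mulr_ge0. Qed.

Lemma rank_below_le1 k : (k < N)%N -> S k + a k <= 1.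
Proof.
move=> kN; rewrite (S_split (Ordinal kN)) -[leRHS]a1; apply: ler_sum => j _.
by rewrite ler_piMr// lern1 leq_b1.
Qed.

Lemma sorted_index_uniq j k t : (j < N)%N -> (k < N)%N ->
  S j <= t < S j + a j -> S k <= t < S k + a k -> j = k.
Proof.
move=> jN kN /andP[j1 j2] /andP[k1 k2]; apply/eqP/negPn/negP => /prec_total/orP[jk|kj].
  have := @S_lt (Ordinal jN) (Ordinal kN) jk; move=> /=; lra.
by have := @S_lt (Ordinal kN) (Ordinal jN) kj; move=> /=; lra.
Qed.

Lemma sorted_index_ex t : 0 <= t < 1 -> exists2 k, (k < N)%N & S k <= t < S k + a k.
Proof.
move=> /andP[t0 t1].
pose rk (k : 'I_N) := #|[pred j : 'I_N | prec j k]|.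
have rk_lt (j k : 'I_N) : prec j k -> (rk j < rk k)%N.
  move=> jk; apply: proper_card; apply/properP; split.
    by apply/fintype.subsetP => i; rewrite !inE => /precT; apply.
  by exists j; rewrite !inE ?precI.
have N0 : (0 < N)%N.
  by rewrite lt0n; apply/eqP => NE; move: a1; rewrite NE big_ord0 => /eqP; rewrite eq_sym oner_eq0.
have [m _ mmin] := @arg_minnP _ (Ordinal N0) xpredT rk isT.
have Sm : S m <= t.
  rewrite /S big1// => j _; case: (boolP (prec j m)) => [jm|_]; last by rewrite mulr0.
  by have := mmin j isT; rewrite leqNgt rk_lt.
(* The last index whose interval starts at or before [t]. If it has a successor, the interval of the
   next index starts at [S k + a k], which must exceed [t]; otherwise [S k + a k] is the total mass
   1. *)
have [k kt kmax] := @arg_maxnP _ m (fun k => S k <= t) rk Sm.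
exists k => //; rewrite kt /=.
have [k' kk'|nB] := pickP (fun j : 'I_N => prec k j).
  have [l kl lmin] := @arg_minnP _ k' (fun j => prec k j) rk kk'.
  suff <- : S l = S k + a k.
    by rewrite ltNge; apply/negP => /kmax /=; rewrite /geq /= leqNgt rk_lt.
  rewrite S_split; apply: eq_bigr => j _; congr (_ * _%:R); congr nat_of_bool.
  apply/idP/orP => [jl|[jk|/eqP ->//]]; last exact: precT kl.
  have [|jk] := eqVneq j k; first by right.
  have /orP[|kj] := prec_total jk; first by left.
  by have := lmin j kj; rewrite leqNgt rk_lt.
rewrite S_split; apply: lt_le_trans t1 _; rewrite -[leLHS]a1; apply: ler_sum => j _.
rewrite ler_peMr// ler1n lt0b.
have [//|jk] := eqVneq j k; first by rewrite orbT.
by have /orP[->//|kj] := prec_total jk; have := nB j; rewrite kj.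
Qed.

(** With [sorted_index_gt] this is the defining property of a quantile: [z k <= q] exactly when [t]
    is less than the weighted distribution function at [q]. *)
Lemma sorted_index_le k t q : (k < N)%N -> S k <= t < S k + a k -> z k <= q ->
  t < \sum_(j < N) a j * (z j <= q)%R%:R.
Proof.
move=> kN /andP[_ tk] kq; apply: lt_le_trans tk _; rewrite (S_split (Ordinal kN)).
apply: ler_sum => j _; apply: ler_wpM2l => //; rewrite ler_nat.
case: (boolP (_ || _)) => // /orP[|/eqP ->]; last by rewrite kq.
by rewrite /prec => /orP[/ltW/le_trans/(_ kq) ->|/andP[/eqP -> _]] //; rewrite kq.
Qed.

Lemma sorted_index_gt k t q : (k < N)%N -> S k <= t < S k + a k -> q < z k ->
  \sum_(j < N) a j * (z j <= q)%R%:R <= t.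
Proof.
move=> kN /andP[kt _] qk; apply: le_trans kt.
apply: ler_sum => j _; apply: ler_wpM2l => //; rewrite ler_nat.
by case: (leP (z j) q) => // jq; rewrite /prec (le_lt_trans jq qk).
Qed.

End sorted_index.

(** The limit is the supremum of the eventual lower bounds. If the upper limit were larger, some
    level strictly between the two would be crossed infinitely often. *)
Lemma cvgn_osc (R : realType) (u : nat -> R) : (forall n, 0 <= u n <= 1) ->
  (forall r s, 0 <= r -> r < s -> s <= 1 -> exists2 q, r < q < s &
     (\forall n \near \oo, u n <= q) \/ (\forall n \near \oo, q < u n)) ->
  cvgn u.
Proof.
move=> u01 H; pose A := [set r : R | \forall n \near \oo, r <= u n].
have A0 : A 0 by apply: nearW => n; have /andP[] := u01 n.
have A1 : ubound A 1.
  by move=> r [n _ /(_ n (leqnn n))] /= rn; apply: le_trans rn _; have /andP[] := u01 n.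
have hs : has_sup A by split; [exists 0|exists 1].
have L0 : 0 <= sup A by apply: ub_le_sup => //; exact: hs.2.
have L1 : sup A <= 1 by apply: ge_sup => //; exists 0.
apply/cvg_ex; exists (sup A); apply/(@cvgrPdist_le _ R^o) => e e0.
have lo : \forall n \near \oo, sup A - e <= u n.
  have [r Ar rL] := sup_adherent e0 hs.
  by apply: filterS Ar => n; apply: le_trans; exact: ltW.
have hi : \forall n \near \oo, u n <= sup A + e.
  move: L1; rewrite le_eqVlt => /predU1P[->|L1].
    by apply: nearW => n; have /andP[_ un] := u01 n; apply: le_trans un _; rewrite lerDl ltW.
  have [|||q /andP[q1 q2] [hq|hq]] := H (sup A) (Num.min 1 (sup A + e)) => //.
  - by rewrite lt_min L1 ltrDl.
  - by rewrite ge_min lexx.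
  - apply: filterS hq => n /le_trans; apply; move: q2; rewrite lt_min => /andP[_ /ltW//].
  - have : A q by apply: filterS hq => n /ltW.
    by move/(ub_le_sup hs.2); rewrite leNgt q1.
by apply: filterS2 lo hi => n h1 h2; rewrite ler_distlC; apply/andP; split; lra.
Qed.

Section random_index.
Context dO (Omega : measurableType dO) (R : realType) (P : probability Omega R).
Variable z : nat -> Omega -> R.
Hypothesis mz : forall k, measurable_fun setT (z k).
Hypothesis z01 : forall k w, 0 <= z k w <= 1.

Local Notation I := (measurableTypeR R).

(* [kap n (w, t)] is the index at which the weights [a n], listed in increasing
   order of [z k w], accumulate to [t]: [z (kap n (w, t)) w] is a quantile. *)
Lemma random_index : exists (N : nat -> nat) (a : nat -> nat -> R) (kap : nat -> Omega * I -> nat),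
  [/\ forall n, convex_weights n (N n) (a n),
      forall n k, measurable [set x | kap n x = k],
      forall n x, (n <= kap n x)%N,
      forall n w (F : nat -> \bar R), (forall k, 0 <= F k)%E ->
        (\int[@lam R]_t F (kap n (w, t)) = \sum_(k < N n) (a n k)%:E * F k)%E &
      {ae P, forall w, {ae @lam R, forall t, cvgn (fun n => z (kap n (w, t)) w)}}].
Proof.
(* The second coordinate serves here as a level, not as the uniform variable: [convex_tail] on the
   product yields, for almost every [w], convergence of the weighted distribution functions at
   almost every level. *)
pose f k (x : Omega * I) : R := (z k x.1 <= x.2)%R%:R.
have mz1 j : measurable_fun setT (fun x : Omega * I => z j x.1).
  by apply: (measurableT_comp (mz j)); exact: measurable_fst.
have mle (k : nat) : measurable [set x : Omega * I | z k x.1 <= x.2].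
  rewrite -[X in measurable X]setTI; exact: (measurable_fun_le measurableT).
have mf k : measurable_fun setT (f k).
  rewrite (_ : f k = \1_[set x : Omega * I | z k x.1 <= x.2]); first exact: measurable_indic.
  by apply/funext => x; rewrite /f indicE; congr (_%:R); congr nat_of_bool; apply/idP/idP; rewrite inE.
have f1 k x : `|f k x| <= 1 by rewrite /f; case: (z k x.1 <= x.2); rewrite ?normr1 ?normr0.
have [N [a [wa /ae_prod aecv]]] := @convex_tail _ _ _ (prodfm P (@lam R)) _ mf f1.
exists N, a.
pose S n w k := rank_below (N n) (a n) (fun j => z j w) k.
have mS n k : measurable_fun setT (fun x : Omega * I => S n x.1 k).
  rewrite /S /rank_below; apply: measurable_sum => j; apply: measurable_funM => //.
  have mjk i i' : measurable [set x : Omega * I | z i x.1 <= z i' x.1].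
    by rewrite -[X in measurable X]setTI; exact: (measurable_fun_le measurableT).
  pose A := ~` [set x : Omega * I | z k x.1 <= z j x.1] `|`
    (if (j < k)%N then [set x | z j x.1 <= z k x.1] `&` [set x | z k x.1 <= z j x.1] else set0).
  have mA : measurable A.
    apply: measurableU; first exact: measurableC.
    by case: ifP => _ //; exact: measurableI.
  rewrite [X in measurable_fun _ X](_ : _ = \1_A); first exact: measurable_indic.
  apply/funext => x; rewrite indicE; congr (_%:R); congr nat_of_bool; apply/idP/idP.
    rewrite inE => /orP[zz|/andP[/eqP zz jk]].
      by left; apply/negP; rewrite -ltNge.
    by right; rewrite jk; split; rewrite /= zz.
  rewrite inE => -[/= /negP|]; first by rewrite -ltNge => ->.
  by case: ifP => // jk [/= h1 h2]; rewrite andbT (@le_anti _ _ (z j x.1) (z k x.1)) ?h1 ?h2// eqxx orbT.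
pose Q n (x : Omega * I) k := (k < N n)%N && (S n x.1 k <= x.2 < S n x.1 k + a n k).
have Q_uniq n x j k : Q n x j -> Q n x k -> j = k.
  by move=> /andP[jN Qj] /andP[kN Qk]; have [a0 _ _ _] := wa n; exact: (sorted_index_uniq a0 jN kN Qj Qk).
have Q_ex n x : 0 <= x.2 < 1 -> exists k, Q n x k.
  have [a0 _ _ a1] := wa n => x01.
  by have [k kN Qk] := sorted_index_ex (fun j => z j x.1) a0 a1 x01; exists k; rewrite /Q kN.
(* When no interval contains the point, that is, outside [0, 1), the index defaults to [n], so that
   [n <= kap n x] holds everywhere. *)
have [kap0 kap0P] : exists kap0 : nat * (Omega * I) -> nat, forall nx,
    Q nx.1 nx.2 (kap0 nx) \/ (kap0 nx = nx.1 /\ forall j, ~~ Q nx.1 nx.2 j).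
  have H (nx : nat * (Omega * I)) : exists k, Q nx.1 nx.2 k \/ (k = nx.1 /\ forall j, ~~ Q nx.1 nx.2 j).
    have [[k Qk]|nQ] := pselect (exists k, Q nx.1 nx.2 k); first by exists k; left.
    by exists nx.1; right; split=> // j; apply/negP => Qj; apply: nQ; exists j.
  by have [kap0 h] := choice H; exists kap0.
pose kap n x := kap0 (n, x).
have kapQ n x k : Q n x k -> kap n x = k.
  by move=> Qk; have [/Q_uniq|[_ /(_ k)]] := kap0P (n, x); [apply|rewrite Qk].
have kap01 n x : 0 <= x.2 < 1 -> Q n x (kap n x).
  by move=> /(Q_ex n)[k Qk]; rewrite (kapQ _ _ _ Qk).
have mQ n k : measurable [set x : Omega * I | Q n x k].
  rewrite /Q; case: (k < N n)%N; last by rewrite [X in measurable X](_ : _ = set0)//; apply/seteqP; split.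
  have m2 : measurable_fun setT (fun x : Omega * I => x.2 : R) by exact: measurable_snd.
  rewrite (_ : [set x | _] = [set x | S n x.1 k <= x.2] `&` ~` [set x | S n x.1 k + a n k <= x.2]).
    apply: measurableI; last apply: measurableC; rewrite -[X in measurable X]setTI.
      exact: (measurable_fun_le measurableT).
    by apply: (measurable_fun_le measurableT) => //; exact: measurable_funD.
  by apply/seteqP; split=> x /= => [/andP[-> h]|[-> /negP]]; [split=> //; apply/negP|]; rewrite -ltNge.
have mkap n k : measurable [set x | kap n x = k].
  rewrite (_ : [set x | _] = [set x | Q n x k] `|`
      (if k == n then \bigcap_j ~` [set x | Q n x j] else set0)).
    apply: measurableU => //; case: ifP => // _.
    by apply: bigcapT_measurable => j; exact: measurableC.
  apply/seteqP; split=> x /=.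
    move=> <-; have [Qk|[kn nQ]] := kap0P (n, x); first by left.
    by right; rewrite /kap kn eqxx => j _; exact/negP/nQ.
  move=> [/kapQ//|]; case: eqP => // -> nQ.
  have [Qk|[kn _]] := kap0P (n, x); last exact: kn.
  by have := nQ (kap n x) Logic.I.
exists kap; split => //.
(* An index below [n] has weight 0, hence an empty interval, and is never selected. *)
- move=> n x; have [/andP[kN Qk]|[kn _]] := kap0P (n, x); last by rewrite /kap kn.
  rewrite leqNgt; apply/negP => kn; have [_ an _ _] := wa n.
  by move: Qk; rewrite an//= addr0 => /andP[h1 /(le_lt_trans h1)]; rewrite ltxx.
- move=> n w F F0; have [a0 _ _ a1] := wa n.
  pose J k := [set t : I | S n w k <= t < S n w k + a n k].
  have JE k : (k < N n)%N -> J k = xsection [set x | Q n x k] w.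
    by move=> kN; apply/seteqP; split=> t; rewrite /J /xsection /= inE /= /Q kN.
  have mJ k : (k < N n)%N -> measurable (J k).
    by move=> kN; rewrite JE//; exact: measurable_xsection.
  have lJ k : (k < N n)%N -> lam (J k) = (a n k)%:E.
    move=> kN; rewrite lam_itv.
    + by rewrite addrC addKr.
    + exact: rank_below_ge0.
    + by rewrite lerDl.
    + exact: rank_below_le1.
  have mFk : measurable_fun setT (fun t : I => F (kap n (w, t))).
    move=> _ Y mY; rewrite setTI.
    rewrite (_ : _ @^-1` _ = \bigcup_k (if `[< Y (F k) >] then xsection [set x | kap n x = k] w else set0)).
      apply: bigcupT_measurable => k; case: ifP => // _; exact: measurable_xsection.
    apply/seteqP; split=> t /=.
      move=> Yt; exists (kap n (w, t)) => //; case: asboolP => // _.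
      by rewrite /xsection /= inE.
    by move=> [k _]; case: asboolP => // Yk; rewrite /xsection /= inE /= => ->.
  transitivity (\int[@lam R]_t \sum_(k < N n) (F k * (\1_(J k) t)%:E))%E.
    apply: ge0_ae_eq_integral => //.
    + apply: emeasurable_sum => k; apply: emeasurable_funM => //.
      by apply/measurable_EFinP/measurable_indic; exact: mJ.
    + move=> t _; apply: sume_ge0 => k _; apply: mule_ge0 => //.
    + apply: lam_ae01 => t t01 _.
      have /andP[kN Qk] := kap01 n (w, t) t01.
      rewrite (bigD1 (Ordinal kN))//= big1 ?adde0.
        by rewrite indicE mem_set//= mule1.
      move=> j jk; rewrite indicE memNset ?mule0//= => Qj; move/eqP : jk; apply.
      by apply/val_inj/esym/kapQ; rewrite /Q ltn_ord.
  rewrite ge0_integral_sum//; last 2 first.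
  + move=> k; apply: emeasurable_funM => //.
    by apply/measurable_EFinP/measurable_indic; exact: mJ.
  + by move=> k t _; apply: mule_ge0.
  apply: eq_bigr => k _; rewrite ge0_integralZl//; last 1 first.
  + by apply/measurable_EFinP/measurable_indic; exact: mJ.
  transitivity (F k * lam (J k))%E; last by rewrite lJ// muleC.
  by congr (_ * _)%E; rewrite (integral_indic _ measurableT (mJ k (ltn_ord k))) setIT.
- apply: filterS aecv => w aecw.
  have Hq (rs : rat * rat) : exists q : R, (0 <= ratr rs.1 :> R) -> (ratr rs.1 < ratr rs.2 :> R) ->
      ratr rs.2 <= 1 :> R -> ratr rs.1 < q < ratr rs.2 /\
      cvgn (fun n => \sum_(k < N n) a n k * f k (w, q)).
    have [[r0 [rs1 s1]]|h] := pselect (0 <= ratr rs.1 :> R /\ (ratr rs.1 < ratr rs.2 :> R) /\ ratr rs.2 <= 1 :> R).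
      by have [q q1 q2] := lam_ae_dense r0 rs1 s1 aecw; exists q.
    by exists 0 => r0 rs1 s1; exfalso; apply: h.
  have [qq qqP] := choice Hq.
  (* Almost every [t] avoids these countably many limits. The distribution function at a chosen
     level then ends strictly on one side of [t], and so the quantile ends on one side of that
     level, as [cvgn_osc] requires. *)
  pose G rs := limn (fun n => \sum_(k < N n) a n k * f k (w, qq rs)).
  have cG : countable (range G) by apply: card_le_trans (card_image_le _ _) _; exact: countableP.
  have ae1 : {ae @lam R, forall t, 0 <= t < 1} by exact: lam_ae01.
  apply: (@filterS2 _ _ (lam_ae_filter R) _ _ _ _ ae1 (lam_countable cG)) => t t01 nG.
  apply: cvgn_osc => // r s r0 rs s1.
  have [s' /= ] := rat_in_itvoo rs; rewrite in_itv /= => /andP[rs' s's].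
  have [r' /= ] := rat_in_itvoo rs'; rewrite in_itv /= => /andP[rr' r's'].
  have [||/andP[q1 q2] cq] := qqP (r', s') _ r's'.
  + by rewrite (le_trans r0)// ltW.
  + by rewrite (le_trans (ltW s's)).
  exists (qq (r', s')); first by rewrite (lt_trans rr' q1) (lt_trans q2 s's).
  have [Gt|tG|tG] := ltgtP (G (r', s')) t.
  + right; have h0 : \forall n \near \oo, \sum_(k < N n) a n k * f k (w, qq (r', s')) < t.
      by apply: (cvgr_lt _ cq).
    apply: filterS h0 => n h.
    rewrite ltNge; apply/negP => zq; have /andP[kN Qk] := kap01 n (w, t) t01.
    have [a0 _ _ _] := wa n.
    by have := sorted_index_le a0 kN Qk zq; rewrite ltNge (ltW h).
  + left; have h0 : \forall n \near \oo, t < \sum_(k < N n) a n k * f k (w, qq (r', s')).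
      by apply: (cvgr_gt _ cq).
    apply: filterS h0 => n h.
    rewrite leNgt; apply/negP => zq; have /andP[kN Qk] := kap01 n (w, t) t01.
    have [a0 _ _ _] := wa n.
    by have := sorted_index_gt a0 kN Qk zq; rewrite leNgt h.
  + by exfalso; apply: nG; exists (r', s').
Qed.

End random_index.

(** * Coding sequences of bits by points of the Cantor set *)

Section ternary_code.
Context (R : realType).
Implicit Types b : nat -> bool.

Let term b m : R := 2 * 3^-1 ^+ m.+1 * (b m)%:R.

(** Only the ternary digits 0 and 2 occur, so that sequences differing at a given index have codes
    at a definite distance; binary expansions would not ensure this. *)
Definition code b : R := limn (series (term b)).

Let term_ge0 b m : 0 <= term b m.
Proof. by rewrite !mulr_ge0// exprn_ge0. Qed.

Let series_le b n : series (term b) n <= 1 - 3^-1 ^+ n.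
Proof.
elim: n => [|n IHn]; first by rewrite /series /= big_geq// expr0 subrr.
rewrite /series /= big_nat_recr//= -[X in X + _]/(series (term b) n).
have : term b n <= 2 * 3^-1 ^+ n.+1 by rewrite /term ler_piMr ?mulr_ge0 ?exprn_ge0// lern1 leq_b1.
move: IHn; rewrite exprS; move: (series _ n) (term b n) (3^-1 ^+ n) => *; lra.
Qed.

Lemma cvg_code b : series (term b) n @[n --> \oo] --> code b.
Proof.
have : cvgn (series (term b)).
  apply: nondecreasing_is_cvgn; first by apply: nondecreasing_series => i _.
  by exists 1 => _ [n _ <-]; rewrite (le_trans (series_le b n))// gerBl exprn_ge0.
by [].
Qed.

Lemma code_ge0 b : 0 <= code b.
Proof.
apply: limr_ge; first by apply/cvg_ex; exists (code b); exact: cvg_code.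
by apply: nearW => n; apply: sumr_ge0 => i _.
Qed.

Lemma code_le1 b : code b <= 1.
Proof.
apply: limr_le; first by apply/cvg_ex; exists (code b); exact: cvg_code.
by apply: nearW => n; rewrite (le_trans (series_le b n))// gerBl exprn_ge0.
Qed.

Lemma code_rec b : code b = 3^-1 * (2 * (b 0%N)%:R + code (b \o S)).
Proof.
have h1 : series (term b) n.+1 @[n --> \oo] --> code b by rewrite cvg_shiftS; exact: cvg_code.
suff h2 : series (term b) n.+1 @[n --> \oo] --> 3^-1 * (2 * (b 0%N)%:R + code (b \o S)).
  exact: (cvg_unique _ h1 h2).
rewrite (_ : (fun n => _) = fun n => 3^-1 * (2 * (b 0%N)%:R + series (term (b \o S)) n)).
  by apply: cvgMr; apply: cvgD; [exact: cvg_cst|exact: cvg_code].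
apply/funext => n; rewrite /series /= big_nat_recl//= mulrDr mulr_sumr; congr (_ + _).
  by rewrite /term expr1; ring.
by apply: eq_bigr => i _; rewrite /term /= !exprS; ring.
Qed.

(** Different first digits separate the codes by at least 1/3, because the tails lie in [0, 1] and
    are scaled by 1/3; [code_rec] shifts the sequences for the induction. *)
Lemma code_digit b b' m : `|code b - code b'| < 3^-1 ^+ m.+1 -> b m = b' m.
Proof.
elim: m b b' => [|m IHm] b b'.
  rewrite expr1 (code_rec b) (code_rec b').
  have := code_ge0 (b \o S); have := code_ge0 (b' \o S).
  have := code_le1 (b \o S); have := code_le1 (b' \o S).
  move: (code (b \o S)) (code (b' \o S)) => x y y1 x1 y0 x0.
  by case: (b 0%N) (b' 0%N) => -[] //; rewrite ltr_norml => /andP[h1 h2]; exfalso; move: h1 h2 => /=; lra.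
move=> h; apply: (IHm (b \o S) (b' \o S)).
have b0 : b 0%N = b' 0%N.
  move: h; rewrite (code_rec b) (code_rec b').
  have := code_ge0 (b \o S); have := code_ge0 (b' \o S).
  have := code_le1 (b \o S); have := code_le1 (b' \o S).
  have : (3^-1 : R) ^+ m.+2 <= 3^-1.
    by rewrite exprS ler_piMr// exprn_ile1// ?invr_ge0// invf_le1// ler1n.
  move: (3^-1 ^+ m.+2) (code (b \o S)) (code (b' \o S)) => z x y z3 y1 x1 y0 x0.
  by case: (b 0%N) (b' 0%N) => -[] //; rewrite ltr_norml => /andP[h1 h2]; exfalso; move: h1 h2 => /=; lra.
move: h; rewrite (code_rec b) (code_rec b') b0 -mulrBr opprD addrACA subrr add0r.
by rewrite normrM ger0_norm ?invr_ge0// [ltRHS]exprS ltr_pM2l// invr_gt0.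
Qed.

End ternary_code.

(** The dichotomy gives a limit in the extended reals; returning infinitely often to a bounded
    interval makes it finite. *)
Lemma cvgn_rat_dichotomy (R : realType) (u : nat -> R) (B : R) :
  (forall q : rat, (\forall n \near \oo, ratr q < u n) \/ (\forall n \near \oo, u n <= ratr q)) ->
  (forall m, exists2 n, (m <= n)%N & `|u n| <= B) -> cvgn u.
Proof.
move=> H uB; pose A := [set r : R | \forall n \near \oo, r <= u n].
have Alt (r : R) : A r -> r <= B.
  move=> [m _ mP]; have [n mn un] := uB m.
  by apply: le_trans (mP n mn) _; exact: le_trans (ler_norm _) un.
have hs : has_sup A.
  split; last by exists B.
  have [q /=] := @rat_in_itvoo R (- B - 1) (- B) ltac:(by rewrite ltrBlDr ltrDl).
  rewrite in_itv /= => /andP[_ qB]; exists (ratr q).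
  have [h|[m _ mP]] := H q; first by apply: filterS h => n /ltW.
  have [n mn un] := uB m; exfalso.
  have := mP n mn => /= uq; move: un; rewrite ler_norml => /andP[Bu _].
  by have := le_lt_trans (le_trans Bu uq) qB; rewrite ltxx.
apply/cvg_ex; exists (sup A); apply/(@cvgrPdist_le _ R^o) => e e0.
have lo : \forall n \near \oo, sup A - e <= u n.
  have [r Ar rL] := sup_adherent e0 hs.
  by apply: filterS Ar => n; apply: le_trans; exact: ltW.
have hi : \forall n \near \oo, u n <= sup A + e.
  have [q /=] := @rat_in_itvoo R (sup A) (sup A + e) ltac:(by rewrite ltrDl).
  rewrite in_itv /= => /andP[q1 q2].
  have [h|h] := H q; last by apply: filterS h => n /le_trans; apply; exact: ltW.
  have : A (ratr q) by apply: filterS h => n /ltW.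
  by move/(ub_le_sup hs.2); rewrite leNgt q1.
by apply: filterS2 lo hi => n h1 h2; rewrite ler_distlC; apply/andP; split; lra.
Qed.

Section random_index_multi.
Context dO (Omega : measurableType dO) (R : realType) (P : probability Omega R).
Variable y : nat -> nat -> Omega -> R.
Hypothesis my : forall k j, measurable_fun setT (y k j).

Local Notation I := (measurableTypeR R).

(* The real number [code] of the truth values of [q < y k j w], for [j] natural
   and [q] rational, reduces the statement to one real sequence. *)
Lemma random_index_multi : exists (N : nat -> nat) (a : nat -> nat -> R) (kap : nat -> Omega * I -> nat),
  [/\ forall n, convex_weights n (N n) (a n),
      forall n k, measurable [set x | kap n x = k],
      forall n x, (n <= kap n x)%N,
      forall n w (F : nat -> \bar R), (forall k, 0 <= F k)%E ->
        (\int[@lam R]_t F (kap n (w, t)) = \sum_(k < N n) (a n k)%:E * F k)%E &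
      {ae P, forall w, {ae @lam R, forall t, forall j (B : R),
        (forall m, exists2 n, (m <= n)%N & `|y (kap n (w, t)) j w| <= B) ->
        cvgn (fun n => y (kap n (w, t)) j w)}}].
Proof.
(* The index [m] encodes a pair of a natural and a rational number; an index that encodes none
   receives the digit [false]. *)
pose bit (v : nat -> R) (m : nat) : bool :=
  if (choice.unpickle m : option (nat * rat)%type) is Some jq then (ratr jq.2 < v jq.1)%R else false.
pose z k w := code R (bit (fun j => y k j w)).
have mz k : measurable_fun setT (z k).
  apply: (@measurable_fun_cvg _ _ _ setT (fun n w => series (fun m => 2 * 3^-1 ^+ m.+1 * (bit (fun j => y k j w) m)%:R : R) n)).
    move=> n; apply: measurable_sum => m; apply: measurable_funM => //.
    rewrite /bit; case: (choice.unpickle m) => [[j q] /=|]; last exact: measurable_cst.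
    rewrite (_ : (fun w => _) = \1_(~` [set w | y k j w <= ratr q])).
      apply: measurable_indic; apply: measurableC; rewrite -[X in measurable X]setTI.
      exact: (measurable_fun_le measurableT).
    apply/funext => w; rewrite indicE; congr (_%:R); congr nat_of_bool.
    apply/idP/idP; rewrite inE /=; first by move=> h; apply/negP; rewrite -ltNge.
    by move/negP; rewrite -ltNge.
  by move=> w _; exact: cvg_code.
have z01 k w : 0 <= z k w <= 1 by rewrite code_ge0 code_le1.
have [N [a [kap [h1 h2 h3 h4 h5]]]] := random_index P mz z01.
exists N, a, kap; split => //; apply: filterS h5 => w.
apply: (@filterS _ _ (lam_ae_filter R)) => t cz j B; apply: cvgn_rat_dichotomy => q.
pose m := choice.pickle (j, q).
(* The codes converge, so that from some index on they stay close enough to share digit [m]: each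
   rational ends up on one side of the sequence. *)
have [n0 n0P] : exists n0, forall n, (n0 <= n)%N -> bit (fun j => y (kap n (w, t)) j w) m = bit (fun j => y (kap n0 (w, t)) j w) m.
  have e0 : 0 < (3^-1 : R) ^+ m.+1 / 2 by rewrite divr_gt0// exprn_gt0.
  have /(@cvgrPdist_lt _ R^o) /(_ _ e0)[n0 _ n0P] := cz.
  exists n0 => n nn0; apply: (@code_digit R).
  have := n0P n nn0; have := n0P n0 (leqnn n0) => /=; rewrite /z.
  rewrite !ltr_distlC; move: (code _ _) (code _ _) (limn _) ((3^-1 : R) ^+ m.+1) => x1 x2 l e.
  by move=> /andP[? ?] /andP[? ?]; apply/andP; split; lra.
have bE n : bit (fun j => y (kap n (w, t)) j w) m = (ratr q < y (kap n (w, t)) j w).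
  by rewrite /bit /m choice.pickleK.
have [qn|nq] := ltP (ratr q) (y (kap n0 (w, t)) j w).
  by left; exists n0 => // n nn0; rewrite /= -bE n0P// bE.
by right; exists n0 => // n nn0; rewrite /= leNgt -bE n0P// bE -leNgt.
Qed.

End random_index_multi.

(** * The shear *)

Section lebesgue_scaling.
Context (R : realType) (d : nat).
Local Notation Rd := 'rV[R]_d.
Local Notation allsets := (g_sigma_algebraType [set: set Rd]).
Variable c : R.
Hypothesis c0 : c != 0.

Lemma lebesgue_outer_le_cost (A : set Rd) : (lebesgue_outer A <= box_cost A)%E.
Proof.
apply: ereal_inf_lbound; exists (fun k : nat => if k == 0%N then A else set0).
  split=> [k|x Ax]; first exact: sub_sigma_algebra.
  by exists 0%N.
apply: lim_near_cst => //; near=> n.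
rewrite big_ltn; last by near: n; exists 1%N.
rewrite big_nat_cond big1 ?adde0// => -[|k]//.
by rewrite box_cost0.
Unshelve. all: by end_near. Qed.

(* For [c < 0] the preimage of a half-open box is half-open on the wrong side,
   whence the strict enlargement [t]. *)
Let scale_box (t : R) (A : set Rd) : `|c|^-1 < t ->
  (lebesgue_outer ((fun x => c *: x) @^-1` A) <= (t ^+ d)%:E * box_cost A)%E.
Proof.
move=> ct; have s0 : 0 < `|c|^-1 by rewrite invr_gt0 normr_gt0.
have t0 : 0 < t := lt_trans s0 ct.
rewrite -lee_pdivrMl ?exprn_gt0//.
apply: le_ereal_inf_tmp => _ [[-> ->]|[a [b [-> ->]]]].
  by rewrite preimage_set0 outer_measure0 mule0.
rewrite lee_pdivrMl ?exprn_gt0//.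
pose l : Rd := \row_i Num.min (a ord0 i / c) (b ord0 i / c).
apply: (@le_trans _ _ (lebesgue_outer (box l (l + t *: (b - a))))).
  apply: le_outer_measure => x /= xab i; have := xab i; rewrite !mxE => /andP[ax xb].
  have ba : 0 < b ord0 i - a ord0 i by rewrite subr_gt0; apply: le_lt_trans xb.
  have st : `|c|^-1 * (b ord0 i - a ord0 i) < t * (b ord0 i - a ord0 i).
    by rewrite ltr_pM2r.
  have xE : x ord0 i = c * x ord0 i / c by rewrite mulrC mulKf.
  rewrite xE; move: ax xb; set y := c * _ => ax xb.
  move: st; case: (ltgtP c 0) c0 => // cc _.
    rewrite ltr0_norm//; move=> st.
    have c10 : c^-1 < 0 by rewrite invr_lt0.
    rewrite min_r; last by rewrite ler_nM2r// ltW// -subr_gt0.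
    rewrite ler_nM2r// (ltW xb)/=.
    apply: (@le_lt_trans _ _ (a ord0 i / c)); first by rewrite ler_nM2r.
    by move: st; rewrite invrN; lra.
  rewrite gtr0_norm//; move=> st.
  have c10 : 0 < c^-1 by rewrite invr_gt0.
  rewrite min_l; last by rewrite ler_pM2r// ltW// -subr_gt0.
  rewrite ler_pM2r// ax/=.
  apply: (@lt_trans _ _ (b ord0 i / c)); first by rewrite ltr_pM2r.
  by move: st; lra.
apply: le_trans (lebesgue_outer_le_cost _) _.
apply: le_trans (box_cost_box _ _) _.
rewrite -EFinM lee_fin /vol.
rewrite -[d in t ^+ d]card_ord -prodr_const -big_split/=.
by apply: ler_prod => i _; rewrite le_max lexx/= !mxE (addrC (Num.min _ _)) addrK maxr_pMr ?mulr0// ltW.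
Qed.

(** Every factor [t > |c|^-1] is allowed, by summing [scale_box] over a cover, and [t] then
    decreases to [|c|^-1]. Infinite outer measure is treated apart. *)
Lemma lebesgue_outer_scale (A : set Rd) :
  (lebesgue_outer ((fun x => c *: x) @^-1` A) <= (`|c|^-1 ^+ d)%:E * lebesgue_outer A)%E.
Proof.
have s0 : 0 < `|c|^-1 by rewrite invr_gt0 normr_gt0.
have key t : `|c|^-1 < t ->
    (lebesgue_outer ((fun x => c *: x) @^-1` A) <= (t ^+ d)%:E * lebesgue_outer A)%E.
  move=> ct; have t0 : 0 < t := lt_trans s0 ct.
  rewrite -lee_pdivrMl ?exprn_gt0//.
  apply: le_ereal_inf_tmp => _ [F [_ AF] <-].
  rewrite lee_pdivrMl ?exprn_gt0//.
  rewrite -nneseriesZl; last by move=> k _; exact: box_cost_ge0.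
  apply: (@le_trans _ _ (\sum_(k <oo) lebesgue_outer ((fun x => c *: x) @^-1` F k))%E).
    apply: le_trans (outer_measure_sigma_subadditive _ _).
    by apply: le_outer_measure => x /= /AF[k _ Fk]; exists k.
  apply: lee_nneseries => k _; last exact: scale_box.
  by move=> _; exact: (outer_measure_ge0 (@lebesgue_outer R d)).
case: (boolP (lebesgue_outer A \is a fin_num)) => [Afin|]; last first.
  rewrite ge0_fin_numE ?outer_measure_ge0// -leNgt leye_eq => /eqP ->.
  by rewrite gt0_muley ?leey// lte_fin exprn_gt0.
have [r rE] : exists r, lebesgue_outer A = r%:E by exists (fine (lebesgue_outer A)); rewrite fineK.
have cv : ((`|c|^-1 + n.+1%:R^-1) ^+ d * r)%:E @[n --> \oo] --> (`|c|^-1 ^+ d * r)%:E.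
  apply: cvg_EFin; first by near=> n.
  apply: cvgMl.
  rewrite -[X in X ^+ d]addr0.
  apply: (@cvg_comp _ _ _ (fun n : nat => `|c|^-1 + n.+1%:R^-1) (fun t : R => t ^+ d) _ (nbhs (`|c|^-1 + 0))); last exact: exprn_continuous.
  by apply: cvgD; [exact: cvg_cst|exact: cvg_harmonic].
rewrite rE -EFinM; apply: (cvge_to_ge cv).
by near=> n; rewrite EFinM -rE; apply: key; rewrite ltrDl invr_gt0.
Unshelve. all: by end_near. Qed.

End lebesgue_scaling.

(** Preimages by [c] and by [c^-1] change outer measure by factors at most [|c|^-d] and [|c|^d],
    which cancel when Caratheodory's condition for [A] is transported from [Y] to [X]. Continuity
    would not be enough, since all Lebesgue sets are measurable here. *)
Lemma measurable_scale (R : realType) (d : nat) (c : R) : c != 0 ->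
  measurable_fun [set: RdL R d] (fun x => (c *: (x : 'rV[R]_d) : RdL R d)).
Proof.
move=> c0 _ A mA; rewrite setTI.
have s0 : 0 < `|c| by rewrite normr_gt0.
apply: le_caratheodory_measurable => X.
pose Y := (fun x : 'rV[R]_d => c^-1 *: x) @^-1` X.
have XY : X = (fun x : 'rV[R]_d => c *: x) @^-1` Y.
  by apply/seteqP; split=> x; rewrite /Y/= scalerA mulVf// scale1r.
have YX B : (fun x : 'rV[R]_d => c^-1 *: x) @^-1` (X `&` ((fun x : 'rV[R]_d => c *: x) @^-1` B)) = Y `&` B.
  by apply/seteqP; split=> x/=; rewrite scalerA mulfV// scale1r.
have le1 B : (lebesgue_outer (X `&` ((fun x : 'rV[R]_d => c *: x) @^-1` B)) <=
    (`|c|^-1 ^+ d)%:E * lebesgue_outer (Y `&` B))%E.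
  by rewrite {1}XY -preimage_setI; exact: lebesgue_outer_scale.
apply: le_trans (leeD (le1 A) (le1 (~` A))) _.
rewrite -muleDr//; last by apply: ge0_adde_def; rewrite inE outer_measure_ge0.
rewrite -mA exprVn lee_pdivrMl ?exprn_gt0//.
have := @lebesgue_outer_scale R d c^-1 _ X.
by rewrite invr_eq0 => /(_ c0); rewrite normfV invrK.
Qed.

Section shear.
Context dO (Omega : measurableType dO) (R : realType) (d : nat).
Variables (P : probability Omega R) (tau : 'rV[R]_d -> Omega -> Omega).
Hypothesis sys : ergodic_system P tau.
Variable m : {finite_measure set (RdL R d) -> \bar R}.
Local Notation X := (Omega * RdL R d)%type.

(** [Tstar tau eps f] is [f] composed with [shear eps^-1]; unfolding is composition with the inverse
    shear. *)
Definition shear (c : R) (z : X) : X := (tau (c *: (z.2 : 'rV[R]_d)) z.1, z.2).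

(** Preservation of [P] is assumed for images under [tau x]; the group law turns preimages into
    images. *)
Lemma tau_preimage x (A : set Omega) : tau x @^-1` A = tau (- x) @` A.
Proof.
have tauK y : cancel (tau y) (tau (- y)).
  by move=> w; have /(congr1 (@^~ w)) := sys_add sys (- y) y; rewrite /= addNr (sys_id sys).
apply/seteqP; split=> w /=; first by move=> Aw; exists (tau x w) => //; exact: tauK.
by move=> [v Av <-]; have := tauK (- x) v; rewrite opprK => ->.
Qed.

Lemma tau_pushforward x (F : Omega -> \bar R) : measurable_fun setT F ->
  (forall w, 0 <= F w)%E -> (\int[P]_w F (tau x w) = \int[P]_w F w)%E.
Proof.
move=> mF F0; have mt := sys_measurable sys x.
rewrite -(@ge0_integral_pushforward _ _ _ _ _ (tau x) mt P setT F)//.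
apply: eq_measure_integral => A mA _.
by rewrite /= /pushforward tau_preimage; exact: (sys_preserving sys).
Qed.

Lemma measurable_shear c : c != 0 -> measurable_fun setT (shear c).
Proof.
move=> c0; apply/measurable_fun_pairP; split; last exact: measurable_snd.
have -> : (fst \o shear c) = (fun z : X => tau z.2 z.1) \o (fun z : X => (z.1, c *: (z.2 : 'rV[R]_d) : RdL R d)).
  by apply/funext.
apply: measurableT_comp; first exact: (sys_joint sys).
apply/measurable_fun_pairP; split; first exact: measurable_fst.
by apply: (@measurableT_comp _ _ _ _ _ _ (fun x : RdL R d => (c *: (x : 'rV[R]_d) : RdL R d))); [exact: measurable_scale|exact: measurable_snd].
Qed.

(** Integrate in [w] first: at fixed [x] the shear acts on [w] by a single measure-preserving
    map. *)
Lemma ge0_integral_shear c (F : X -> \bar R) : c != 0 -> measurable_fun setT F ->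
  (forall z, 0 <= F z)%E ->
  (\int[(P \x m)%E]_z F (shear c z) = \int[(P \x m)%E]_z F z)%E.
Proof.
move=> c0 mF F0.
have mFs : measurable_fun setT (F \o shear c).
  by apply: measurableT_comp => //; exact: measurable_shear.
rewrite (@fubini_tonelli2 _ _ _ _ _ P m (F \o shear c))//; last by move=> z; exact: F0.
rewrite (@fubini_tonelli2 _ _ _ _ _ P m F)//.
apply: eq_integral => x _; rewrite /fubini_G/=.
apply: (@tau_pushforward (c *: (x : 'rV[R]_d)) (fun w => F (w, x))) => //.
exact: measurableT_comp.
Qed.

Lemma integral_shear c (F : X -> \bar R) : c != 0 -> measurable_fun setT F ->
  (\int[(P \x m)%E]_z F (shear c z) = \int[(P \x m)%E]_z F z)%E.
Proof.
move=> c0 mF; rewrite [RHS]integralE.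
rewrite -(ge0_integral_shear c0 (measurable_funepos mF) (funepos_ge0 F)).
rewrite -(ge0_integral_shear c0 (measurable_funeneg mF) (funeneg_ge0 F)).
rewrite [LHS]integralE.
by congr (_ - _)%E; apply: eq_integral => z _; rewrite ?funeposE ?funenegE.
Qed.

Lemma shearK c : cancel (shear c) (shear (- c)).
Proof.
move=> [w x]; rewrite /shear/=; congr (_, _).
by have /(congr1 (@^~ w)) := sys_add sys (- (c *: (x : 'rV[R]_d))) (c *: (x : 'rV[R]_d)); rewrite /= addNr (sys_id sys) scaleNr.
Qed.

Lemma ae_shear c (A : set X) : c != 0 -> {ae (P \x m)%E, forall z, A z} ->
  {ae (P \x m)%E, forall z, A (shear c z)}.
Proof.
move=> c0 [N [mN N0 AN]]; exists (shear c @^-1` N); split.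
- by rewrite -[X in measurable X]setTI; exact: measurable_shear.
- have mS : measurable (shear c @^-1` N) by rewrite -[X in measurable X]setTI; exact: measurable_shear.
  have E B : measurable B -> ((P \x m) B = \int[P \x m]_z (\1_B z)%:E)%E.
    by move=> mB; rewrite integral_indic// setIT.
  rewrite E// -N0 E// -[in RHS](@ge0_integral_shear c (fun z => (\1_N z)%:E))//.
  exact/measurable_EFinP/measurable_indic.
- by move=> z /= nA; apply: AN.
Qed.

End shear.

(** * Countable dense spaces of bounded functions *)

Section dense_bounded.
Context d (T : measurableType d) (R : realType).
Variables (mu : {finite_measure set T -> \bar R}) (D : set (T -> R)).
Hypothesis Db : forall f, D f -> bddm f.
Hypothesis DD : forall f g, D f -> D g -> D (fun x => f x + g x).
Hypothesis DZ : forall (c : rat) f, D f -> D (fun x => ratr c * f x).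

Let ap (f : T -> R) := forall e : R, 0 < e -> exists2 g, D g & nm mu 1 (fun x => f x - g x) < e.
Let bL (f : T -> R) : bddm f -> f \in Lfun mu 1%:E.
Proof. by apply: bddm_Lfun. Qed.

Let ap_add f g : bddm f -> bddm g -> ap f -> ap g -> ap (fun x => f x + g x).
Proof.
move=> bf bg af ag e e0; have e20 : 0 < e / 2 by rewrite divr_gt0.
have [f' Df' ff'] := af _ e20; have [g' Dg' gg'] := ag _ e20.
exists (fun x => f' x + g' x); first exact: DD.
have bf' := Db Df'; have bg' := Db Dg'.
rewrite [e]splitr.
apply: le_lt_trans (ltrD ff' gg').
rewrite (_ : (fun x => _) = (fun x => (f x - f' x) + (g x - g' x))); last first.
  by apply/funext => x; rewrite opprD addrACA.
by apply: nmD => //; apply: bL; exact: bddmB.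
Qed.

Let ap_scale a f : bddm f -> ap f -> ap (fun x => a * f x).
Proof.
move=> bf af e e0; have e20 : 0 < e / 2 by rewrite divr_gt0.
have [f' Df' ff'] := af (e / 2 / (`|a| + 1)) ltac:(by rewrite divr_gt0// ltr_wpDl).
have bf' := Db Df'.
have [r] := @rat_in_itvoo R a (a + e / 2 / (nm mu 1 f' + 1)) ltac:(by rewrite ltrDl divr_gt0// ltr_wpDl// nm_ge0).
rewrite in_itv/= => /andP[ar ra].
exists (fun x => ratr r * f' x); first exact: DZ.
rewrite (_ : (fun x => _) = (fun x => a * (f x - f' x) + (a - ratr r) * f' x)); last first.
  by apply/funext => x; ring.
have bB := bddmB bf bf'.
apply: le_lt_trans (nmD (lexx 1) (bL (bddmZ a bB)) (bL (bddmZ (a - ratr r) bf'))) _.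
rewrite !nmZ//; try exact: bL.
rewrite [e]splitr; apply: ltr_leD.
  apply: (@le_lt_trans _ _ ((`|a| + 1) * nm mu 1 (fun x => f x - f' x))).
    by rewrite ler_wpM2r ?nm_ge0// lerDl.
  by rewrite mulrC -ltr_pdivlMr// ltr_wpDl.
apply: (@le_trans _ _ (`|a - ratr r| * (nm mu 1 f' + 1))).
  by rewrite ler_wpM2l// lerDl.
rewrite -ler_pdivlMr ?ltr_wpDl ?nm_ge0//.
by rewrite distrC ger0_norm ?subr_ge0 ?(ltW ar)// lerBlDl ltW.
Qed.

Let ap_lim (f_ : nat -> T -> R) (f : T -> R) (M : R) : (forall n, bddm (f_ n)) -> measurable_fun setT f ->
  (forall n x, `|f_ n x| <= M) -> (forall x, f_ n x @[n --> \oo] --> f x) ->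
  (forall n, ap (f_ n)) -> ap f.
Proof.
move=> bf_ mf fM f_c af_ e e0; have e20 : 0 < e / 2 by rewrite divr_gt0.
have fM' x : `|f x| <= M.
  apply: (cvgr_to_le (cvg_norm (f_c x))); exact: nearW.
have bf : bddm f by split => //; exists M.
have H : nm mu 1 (fun x => f_ n x - f x) @[n --> \oo] --> 0.
  apply: (@dominated_nm _ _ _ mu 1 f_ f (cst (M + M))) => //.
  - by move=> n; have [] := bf_ n.
  - exact: nearW.
  - by apply: bL; exact: (@bddm_cst _ T R (M + M)).
  - by move=> n x; apply: le_trans (ler_normB _ _) (lerD _ _).
have /cvgrPdist_lt /(_ _ e20) [n _ /(_ n (leqnn n))] := H.
rewrite sub0r normrN ger0_norm ?nm_ge0// => fn.
have [g Dg fg] := af_ n _ e20.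
exists g => //; rewrite [e]splitr.
apply: le_lt_trans (ltrD fn fg).
have bg := Db Dg.
rewrite (nmBC (lexx 1) (bL (bf_ n)) (bL bf)).
by apply: nm_triangle => //; exact: bL.
Qed.

(** Dynkin's argument: the sets with approximable indicators form a lambda-system containing [G],
    hence all measurable sets. Linear combinations and bounded limits reach simple and nonnegative
    functions, and adding a constant reaches all bounded ones. *)
Lemma dense_bounded (G : set (set T)) : setI_closed G -> G setT ->
  (@measurable _ T) = <<s G >> -> (forall A, G A -> ap \1_A) ->
  forall f, bddm f -> ap f.
Proof.
move=> GI GT mG aG.
pose H := [set A : set T | measurable A /\ ap \1_A].
have GH : G `<=` H.
  by move=> A GA; split; [rewrite mG; exact: sub_sigma_algebra|exact: aG].
have aI A : measurable A -> ap \1_A.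
  rewrite mG => mA; suff : H A by case.
  move: A mA; apply: (lambda_system_subset GI) => //.
  split=> //.
  - exact: GH.
  - move=> A B BA [mA aA] [mB aB]; split; first exact: measurableD.
    rewrite (_ : \1_(A `\` B) = (fun x => \1_A x + (-1) * \1_B x)); last first.
      apply/funext => x; rewrite mulN1r !indicE in_setD.
      have [xB|xB] := boolP (x \in B); last by rewrite subr0 andbT.
      have -> : x \in A by move: xB; rewrite !inE; exact: BA.
      by rewrite subrr.
    apply: ap_add => //; [exact: bddm_indic|apply: bddmZ; exact: bddm_indic|].
    by apply: ap_scale => //; exact: bddm_indic.
  - move=> F ndF HF; have mU : measurable (\bigcup_n F n).
      by apply: bigcup_measurable => n _; exact: (HF n).1.
    split => //.
    apply: (@ap_lim (fun n => \1_(F n)) _ 1).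
    + by move=> n; apply: bddm_indic; exact: (HF n).1.
    + exact: measurable_indic.
    + by move=> n x; rewrite indicE normr_nat lern1 leq_b1.
    + move=> x; rewrite indicE.
      have [xU|xU] := boolP (x \in _).
        move: xU; rewrite inE => -[n _ Fn].
        apply: cvg_near_cst; exists n => //= m /= nm; rewrite indicE mem_set//.
        by have /subsetPset := ndF _ _ nm; exact.
      apply: cvg_near_cst; apply: nearW => n; rewrite indicE memNset// => Fn.
      by move/negP: xU; apply; rewrite inE; exists n.
    + by move=> n; exact: (HF n).2.
have aS (f : {nnsfun T >-> R}) : ap f.
  have bS (s : seq R) : bddm (fun x : T => \sum_(y <- s) y * \1_(f @^-1` [set y]) x) /\
      ap (fun x : T => \sum_(y <- s) y * \1_(f @^-1` [set y]) x).
    elim: s => [|y s [IHb IHa]].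
      have E0 : (fun x : T => \sum_(y <- [::]) y * \1_(f @^-1` [set y]) x) = (fun x => 0 * \1_setT x).
        by apply/funext => x; rewrite big_nil mul0r.
      rewrite E0; split; first by apply: bddmZ; exact: bddm_indic.
      by apply: ap_scale; [exact: bddm_indic|exact: aI].
    have -> : (fun x : T => \sum_(y <- y :: s) y * \1_(f @^-1` [set y]) x) =
        (fun x => y * \1_(f @^-1` [set y]) x + \sum_(y <- s) y * \1_(f @^-1` [set y]) x).
      by apply/funext => x; rewrite big_cons.
    have b1 : bddm (fun x : T => y * \1_(f @^-1` [set y]) x).
      by apply: bddmZ; apply: bddm_indic.
    split; first exact: bddmD.
    by apply: ap_add => //; apply: ap_scale; [exact: bddm_indic|exact: aI].
  have [_] := bS (fset_set (range f)).
  congr ap; apply/funext => x; rewrite [in RHS](fimfunE f x) fsbig_finite//=.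
have a0 f : bddm f -> (forall x, 0 <= f x) -> ap f.
  move=> bf f0; have [mf [M fM]] := bf.
  have mf' : measurable_fun setT (EFin \o f) by exact/measurable_EFinP.
  pose f_ := nnsfun_approx measurableT mf'.
  have f_c x : f_ n x @[n --> \oo] --> f x.
    have := @cvg_nnsfun_approx _ _ _ _ measurableT _ mf' (fun y _ => f0 y) x Logic.I.
    by move=> /fine_cvgP[_].
  have f_le n x : f_ n x <= f x.
    rewrite -(cvg_lim (@Rhausdorff R) (f_c x)); apply: nondecreasing_cvgn_le.
      by move=> i j ij; have /lefP := nd_nnsfun_approx measurableT mf' ij; exact.
    by apply/cvg_ex; exists (f x).
  have f_M n x : `|f_ n x| <= M.
    by rewrite ger0_norm// (le_trans (f_le n x))// (le_trans (ler_norm _) (fM x)).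
  apply: (@ap_lim f_ f M) => //.
  by move=> n; split => //; exists M.
move=> f bf; have [mf [M fM]] := bf.
have b1 : bddm (fun x => f x + M) by apply: bddmD => //; exact: (@bddm_cst _ T R M).
have := @ap_add (fun x => f x + M) (fun x => (- M) * \1_setT x) b1.
rewrite (_ : (fun x => _ + - M * _) = f); last first.
  by apply/funext => x; rewrite indicT mulr1 addrK.
apply.
- by apply: bddmZ; exact: bddm_indic.
- apply: a0 => // x; rewrite -lerBlDr sub0r.
  by have := fM x; rewrite ler_norml => /andP[].
- by apply: ap_scale; [exact: bddm_indic|exact: aI].
Qed.

End dense_bounded.

Section spans.
Context dO (Omega : measurableType dO) (R : realType) (d : nat).
Local Notation X := (Omega * RdL R d)%type.
Implicit Types A : set (X -> R).

Lemma Qspan_gen A a : A a -> Qspan A a.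
Proof.
move=> Aa; exists 1%N, (fun=> 1), (fun=> a); split=> //.
by apply/funext => z; rewrite big_ord1 rmorph1 mul1r.
Qed.

Lemma Qspan_add A f g : Qspan A f -> Qspan A g -> Qspan A (fun z => f z + g z).
Proof.
move=> [n [c [a [Aa ->]]]] [m [c' [a' [Aa' ->]]]].
exists (n + m)%N, (fun i : 'I_(n + m) => match fintype.split i with inl j => c j | inr j => c' j end),
  (fun i : 'I_(n + m) => match fintype.split i with inl j => a j | inr j => a' j end); split.
  by move=> i; case: (fintype.split i).
apply/funext => z; rewrite big_split_ord/=; congr (_ + _); apply: eq_bigr => i _.
  by have -> : fintype.split (lshift m i) = inl i by exact: (unsplitK (inl i)).
by have -> : fintype.split (rshift n i) = inr i by exact: (unsplitK (inr i)).
Qed.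

Lemma Qspan_scale A (b : rat) f : Qspan A f -> Qspan A (fun z => ratr b * f z).
Proof.
move=> [n [c [a [Aa ->]]]]; exists n, (fun i => b * c i), a; split=> //.
by apply/funext => z; rewrite mulr_sumr; apply: eq_bigr => i _; rewrite rmorphM mulrA.
Qed.

Lemma Qspan_ind A (H : set (X -> R)) : H (fun=> 0) -> 
  (forall f g, H f -> H g -> H (fun z => f z + g z)) ->
  (forall (c : rat) f, A f -> H (fun z => ratr c * f z)) -> Qspan A `<=` H.
Proof.
move=> H0 HD HZ f [n [c [a [Aa ->]]]].
elim: n c a Aa => [|n IH] c a Aa.
  by rewrite (_ : (fun z => _) = fun=> 0)//; apply/funext => z; rewrite big_ord0.
rewrite (_ : (fun z => _) = (fun z => ratr (c ord0) * a ord0 z +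
    \sum_(i < n) ratr (c (lift ord0 i)) * a (lift ord0 i) z)); last first.
  by apply/funext => z; rewrite big_ord_recl.
apply: HD; first exact: HZ.
by apply: (IH (fun i => c (lift ord0 i)) (fun i => a (lift ord0 i))).
Qed.

Lemma Rspan_ind A (H : set (X -> R)) : H (fun=> 0) -> 
  (forall f g, H f -> H g -> H (fun z => f z + g z)) ->
  (forall c f, A f -> H (fun z => c * f z)) -> Rspan A `<=` H.
Proof.
move=> H0 HD HZ f [n [c [a [Aa ->]]]].
elim: n c a Aa => [|n IH] c a Aa.
  by rewrite (_ : (fun z => _) = fun=> 0)//; apply/funext => z; rewrite big_ord0.
rewrite (_ : (fun z => _) = (fun z => c ord0 * a ord0 z +
    \sum_(i < n) c (lift ord0 i) * a (lift ord0 i) z)); last first.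
  by apply/funext => z; rewrite big_ord_recl.
apply: HD; first exact: HZ.
by apply: (IH (fun i => c (lift ord0 i)) (fun i => a (lift ord0 i))).
Qed.

Lemma Qspan_Rspan A : Qspan A `<=` Rspan A.
Proof. by move=> f [n [c [a [Aa ->]]]]; exists n, (fun i => ratr (c i)), a. Qed.

Lemma Rspan_bddm A : (forall a, A a -> bddm a) -> forall f, Rspan A f -> bddm f.
Proof.
move=> bA; apply: Rspan_ind.
- exact: (@bddm_cst _ X R 0).
- by move=> f g; exact: bddmD.
- by move=> c f /bA; exact: bddmZ.
Qed.

Lemma Qspan_countable A : countable A -> countable (Qspan A).
Proof.
move=> cA; have [[x0 Ax0]|A0] := pselect (exists x0, A x0); last first.
  apply: (@sub_countable _ _ _ [set (fun=> 0)]); last exact: countable1.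
  apply: subset_card_le => f [[|n] [c [a [Aa ->]]]]; last first.
    by exfalso; apply: A0; exists (a ord0).
  by apply/funext => z; rewrite big_ord0.
have [e [eA Ae]] := countable_enum cA Ax0.
pose ev (s : seq (rat * nat)) : X -> R := fun z => \sum_(x <- s) ratr x.1 * e x.2 z.
apply: (@sub_countable _ _ _ (range ev)); last first.
  by apply: (card_le_trans (card_image_le _ _)); exact: countableP.
apply: subset_card_le; apply: Qspan_ind.
- by exists [::] => //; apply/funext => z; rewrite /ev big_nil.
- move=> _ _ [s _ <-] [t _ <-]; exists (s ++ t) => //.
  by apply/funext => z; rewrite /ev big_cat.
- move=> c f /Ae[n <-]; exists [:: (c, n)] => //.
  by apply/funext => z; rewrite /ev big_seq1.
Qed.

End spans.

(** * Truncation, and density in every L^r *)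

Section truncation.
Context dO (Omega : measurableType dO) (R : realType) (d : nat).
Local Notation X := (Omega * RdL R d)%type.

Definition trunc (c x : R) : R := Num.max (- c) (Num.min c x).

Lemma trunc_bound c x : 0 <= c -> `|trunc c x| <= c.
Proof. by move=> c0; rewrite ler_norml /trunc le_max lexx/= ge_max ge_min lexx/=; lra. Qed.

Lemma trunc_lip c x y : 0 <= c -> `|trunc c x - trunc c y| <= `|x - y|.
Proof.
move=> _; have maxl (a s t : R) : `|Num.max a s - Num.max a t| <= `|s - t|.
  have := ler_norm (s - t); have := ler_norm (t - s); rewrite distrC ler_norml /Num.max.
  by case: (ltP a s) => *; case: (ltP a t) => *; apply/andP; split; lra.
have minl (a s t : R) : `|Num.min a s - Num.min a t| <= `|s - t|.
  have := ler_norm (s - t); have := ler_norm (t - s); rewrite distrC ler_norml /Num.min.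
  by case: (ltP a s) => *; case: (ltP a t) => *; apply/andP; split; lra.
exact: le_trans (maxl _ _ _) (minl _ _ _).
Qed.

Lemma trunc_id c x : `|x| <= c -> trunc c x = x.
Proof.
rewrite ler_norml => /andP[h1 h2]; rewrite /trunc min_r// max_r//.
Qed.

Lemma measurable_trunc c : measurable_fun setT (trunc c).
Proof.
by apply: measurable_maxr => //; apply: measurable_minr.
Qed.

Variable mu : {finite_measure set X -> \bar R}.
Variable A : set (X -> R).
Hypothesis cA : countable A.
Hypothesis bA : forall a, A a -> bddm a.
Hypothesis dA : forall f, bddm f -> forall e : R, 0 < e ->
  exists2 g, Qspan A g & nm mu 1 (fun x => f x - g x) < e.

(** Truncation upgrades density in [L^1]: if [|f| <= n], the error made by the truncation of [g] is
    bounded both by [2n] and by [|f - g|]. The span is taken again because truncations of a span do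
    not form one. *)
Definition truncated : set (X -> R) :=
  Qspan (A `|` [set (fun z => trunc n%:R (f z)) | n in [set: nat] & f in Qspan A]).

Lemma sub_truncated : A `<=` truncated.
Proof. by move=> a Aa; apply: Qspan_gen; left. Qed.

Lemma truncated_bddm f : truncated f -> bddm f.
Proof.
move=> /Qspan_Rspan; apply: Rspan_bddm => a [/bA//|[n _ [g /Qspan_Rspan/(Rspan_bddm bA)[mg _] <-]]].
split; first exact: (measurableT_comp (measurable_trunc _)).
by exists n%:R => z; exact: trunc_bound.
Qed.

Lemma test_space_truncated : test_space mu truncated.
Proof.
split.
- apply: Qspan_countable; rewrite -bigcup2E; apply: bigcup_countable; first exact: countableP.
  move=> [_ //|[_|n _]]; last exact: countable0.
  rewrite /bigcup2/=.
  rewrite (_ : [set _ | _ in _ & _ in _] = \bigcup_n ((fun f z => trunc n%:R (f z)) @` Qspan A)); last first.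
    by apply/seteqP; split=> [_ [n _ [f Af <-]]|_ [n _ [f /= Af <-]]]; exists n => //; exists f.
  apply: bigcup_countable => [|n _]; first exact: countableP.
  by apply: (card_le_trans (card_image_le _ _)); exact: Qspan_countable.
- exact: truncated_bddm.
- by move=> f g; exact: Qspan_add.
- by move=> c f; exact: Qspan_scale.
- move=> r f r1 bf e e0; have [mf [M fM]] := bf.
  have [n Mn] : exists n : nat, M <= n%:R.
    by exists (Num.truncn `|M|).+1; apply: le_trans (ler_norm _) _; exact/ltW/truncnS_gt.
  have fn x : trunc n%:R (f x) = f x by apply: trunc_id; exact: le_trans (fM x) Mn.
  (* The truncated error [h] satisfies [|h|^r <= (2n)^(r-1) * |f - g|]; adding 1 keeps [K] positive
     when the power vanishes. *)
  pose K : R := (n%:R + n%:R) `^ (r - 1) + 1.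
  have K0 : 0 < K by rewrite ltr_wpDl// powR_ge0.
  have e'0 : 0 < e `^ r / K by rewrite divr_gt0// powR_gt0.
  have [g Ag fg] := dA bf e'0.
  have bg : bddm g := Rspan_bddm bA (Qspan_Rspan Ag).
  exists (fun z => trunc n%:R (g z)).
    by apply: Qspan_gen; right; exists n => //; exists g.
  have mt : measurable_fun setT (fun z => trunc n%:R (g z)) by exact: (measurableT_comp (measurable_trunc _) bg.1).
  have bh : bddm (fun x => f x - trunc n%:R (g x)).
    apply: bddmB => //; split=> //; exists n%:R => z; exact: trunc_bound.
  have bfg := bddmB bf bg.
  have r0 : 0 < r := lt_le_trans ltr01 r1.
  rewrite ltNge; apply/negP => le; suff : e `^ r < e `^ r by rewrite ltxx.
  apply: (@le_lt_trans _ _ (nm mu r (fun x => f x - trunc n%:R (g x)) `^ r)).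
    by apply: ge0_ler_powR => //; rewrite ?nnegrE ?nm_ge0// ltW.
  rewrite nm_pow//; last exact: bddm_Lfun.
  apply: (@le_lt_trans _ _ (\int[mu]_x (K * `|f x - g x|))).
    apply: le_Rintegral => //.
    - have /Lfun_integrable := bddm_Lfun mu r1 bh; exact.
    - by have := integrableZl measurableT K (integrable_norm (bddm_integrable mu bfg)).
    - move=> x _; set h := f x - _.
      have hK : `|h| <= n%:R + n%:R.
        by apply: le_trans (ler_normB _ _) (lerD (le_trans (fM x) Mn) (trunc_bound _ _)).
      have hg : `|h| <= `|f x - g x| by rewrite /h -{1}fn; apply: trunc_lip.
      have [->|h0] := eqVneq `|h| 0.
        by rewrite powR0 ?gt_eqF// mulr_ge0// ltW.
      have hp : 0 < `|h| by rewrite lt0r h0/=.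
      rewrite -{1}(subrK 1 r) powRD; last by rewrite h0 implybT.
      rewrite powRr1//; apply: ler_pM => //.
      rewrite /K; apply: ler_wpDr => //.
      by apply: ge0_ler_powR => //; rewrite ?nnegrE ?subr_ge0// addr_ge0.
  rewrite RintegralZl//; last exact: (integrable_norm (bddm_integrable mu bfg)).
  rewrite -ltr_pdivlMl// mulrC.
  move: fg; rewrite -[in X in X < _ -> _](@powRr1 _ (nm _ _ _)) ?nm_ge0// nm_pow//; last exact: bddm_Lfun.
  by under eq_Rintegral do rewrite powRr1//.
Qed.

End truncation.

Section test_functions.
Context dO (Omega : measurableType dO) (R : realType) (d : nat).
Variables (P : probability Omega R) (Q : bounded_open R d).
Variables (DO : set (Omega -> R)) (DQ : set (RdL R d -> R)).
Hypothesis TF : test_families P Q DO DQ.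
Local Notation X := (Omega * RdL R d)%type.
Local Notation mQ := (lebesgue_on Q).
Local Notation mu := (prodfm P mQ).

Lemma bounded_closureQ : bounded_set (closure (Q : set 'rV[R]_d)).
Proof.
have [M [Mr QM]] := bopen_bounded Q.
exists M; split=> //.
move=> N MN x Qx.
have cl : closed [set x : 'rV[R]_d | `|x| <= N].
  by apply: (@closed_comp _ _ (fun x : 'rV[R]_d => `|x|) [set y | y <= N]) => [z _|]; [exact: norm_continuous|exact: closed_le].
have : closure [set x : 'rV[R]_d | `|x| <= N] x.
  by apply: closure_subset Qx => y Qy; exact: QM.
by move/closure_id : cl => <-.
Qed.

Lemma testO_bddm f : DO f -> bddm f.
Proof. exact: (testO_bounded TF). Qed.

Lemma testQ_bddm g : DQ g -> bddm g.
Proof.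
move=> Dg; have [cg g0] := testQ_continuous TF Dg.
have mC : measurable (closure (Q : set 'rV[R]_d) : set (RdL R d)).
  rewrite -[X in measurable X]setCK; apply: measurableC; apply: open_measurable_RdL.
  by rewrite openC; exact: closed_closure.
split.
  apply: (measurability _ (RGenOInfty.measurableE R)) => //.
  move=> _ [_ [a ->] <-]; rewrite setTI.
  have /continuousP /(_ [set y : R | a < y] (@open_gt R a)) := cg.
  move=> /open_subspaceP[V oV VE].
  rewrite set_itvoy.
  (* Elements of [DQ] vanish off the closure of [Q], so its complement lies in the superlevel set
     exactly when [a < 0]. *)
  rewrite (_ : _ @^-1` _ = (V `&` closure Q) `|` (if a < 0 then ~` closure Q else set0)); last first.
    rewrite VE; apply/seteqP; split=> x /=.
      move=> gx; have [Qx|Qx] := pselect (closure Q x); first by left.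
      by move: gx; rewrite g0// => ->; right.
    by case=> [[]//|]; case: ifP => // a0 Qx; rewrite g0.
  apply: measurableU; first by apply: measurableI => //; exact: open_measurable_RdL.
  by case: ifP => // _; exact: measurableC.
have cpt : compact (closure (Q : set 'rV[R]_d)).
  by apply: bounded_closed_compact; [exact: bounded_closureQ|exact: closed_closure].
have /compact_bounded[M [Mr gM]] := continuous_compact cg cpt.
exists (Num.max (M + 1) 0) => x; have [Qx|Qx] := pselect (closure Q x).
  by rewrite le_max (gM (M + 1))// ?ltrDl//; exists x.
by rewrite g0// normr0 le_max lexx orbT.
Qed.

Lemma tensors_bddm f : tensors DO DQ f -> bddm f.
Proof.
move=> [g [h [/testO_bddm[mg [M gM]] /testQ_bddm[mh [N hN]] ->]]]; split.
  by apply: measurable_funM; apply: measurableT_comp.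
by exists (M * N) => z; rewrite normrM ler_pM.
Qed.

Lemma tensors_countable : countable (tensors DO DQ).
Proof.
rewrite (_ : tensors DO DQ = \bigcup_(g in DO) ((fun h z => g z.1 * h z.2) @` DQ)); last first.
  apply/seteqP; split=> [_ [f [g [Df Dg ->]]]|_ [f Df [g Dg <-]]]; first by exists f => //; exists g.
  by exists f, g.
apply: bigcup_countable => [|g _]; first exact: (testO_countable TF).
by apply: (card_le_trans (card_image_le _ _)); exact: (testQ_countable TF).
Qed.

Lemma nm_tensor (f : Omega -> R) (g : RdL R d -> R) : bddm f -> bddm g ->
  nm mu 1 (fun z => f z.1 * g z.2) = nm P 1 f * nm mQ 1 g.
Proof.
move=> bf bg; have mf := bf.1; have mg := bg.1.
have mfg : measurable_fun setT (fun z : X => f z.1 * g z.2).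
  by apply: measurable_funM; apply: measurableT_comp.
rewrite /nm -fineM; try by rewrite -nmE; [|exact: bddm_Lfun].
congr fine; rewrite !Lnorm1.
rewrite (_ : (\int[prodfm P mQ]_x _)%E = (\int[(P \x mQ)%E]_z (`|f z.1| * `|g z.2|)%:E)%E); last first.
  by apply: eq_integral => z _ /=; rewrite normrM.
have mfg' : measurable_fun setT (fun z : X => (`|f z.1| * `|g z.2|)%:E).
  by apply/measurable_EFinP/measurable_funM; apply: measurableT_comp => //; apply: measurableT_comp.
rewrite fubini_tonelli1//.
rewrite /fubini_F/=.
have mg' : measurable_fun setT (fun y => (`|g y|)%:E) by exact/measurable_EFinP/measurableT_comp.
have g0 y : setT y -> (0 <= (`|g y|)%:E)%E by [].
under eq_integral => w _.
  under eq_integral do rewrite EFinM.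
  rewrite (ge0_integralZl_EFin mQ measurableT g0 mg' (normr_ge0 (f w))).
  over.
rewrite ge0_integralZr//.
- by apply/measurable_EFinP/measurableT_comp.
- by apply: integral_ge0.
Qed.

(** Measurable rectangles form a generating pi-system, and the indicator of a rectangle is
    approximated factor by factor. The tolerance for the second factor depends on the approximation
    [f0] already chosen for the first. *)
Lemma tensors_dense f : bddm f -> forall e : R, 0 < e ->
  exists2 g, Qspan (tensors DO DQ) g & nm mu 1 (fun x => f x - g x) < e.
Proof.
pose G : set (set X) := [set A `*` B | A in measurable & B in measurable].
apply: (@dense_bounded _ _ _ mu _ _ _ _ G).
- by move=> g /Qspan_Rspan; apply: Rspan_bddm; exact: tensors_bddm.
- by move=> g h; exact: Qspan_add.
- by move=> c g; exact: Qspan_scale.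
- move=> _ _ [A mA [B mB <-]] [A' mA' [B' mB' <-]].
  by rewrite -setXI; exists (A `&` A'); [exact: measurableI|exists (B `&` B') => //; exact: measurableI].
- by exists setT => //; exists setT => //; rewrite setXTT.
- exact: measurable_prod_measurableType.
move=> _ [A mA [B mB <-]] e e0; have e20 : 0 < e / 2 by rewrite divr_gt0.
have bA := @bddm_indic _ _ R _ mA; have bB := @bddm_indic _ _ R _ mB.
have N0 : 0 < nm mQ 1 \1_B + 1 by rewrite ltr_wpDl// nm_ge0.
have [f0 Df f0A] := testO_dense TF (bddm_Lfun P (lexx 1) bA) (divr_gt0 e20 N0).
have bf0 := testO_bddm Df.
have N1 : 0 < nm P 1 f0 + 1 by rewrite ltr_wpDl// nm_ge0.
have [g0 Dg g0B] := testQ_dense TF (bddm_Lfun mQ (lexx 1) bB) (divr_gt0 e20 N1).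
have bg0 := testQ_bddm Dg.
exists (fun z => f0 z.1 * g0 z.2).
  by apply: Qspan_gen; exists f0, g0.
have bAf := bddmB bA bf0; have bBg := bddmB bB bg0.
have ten (h : Omega -> R) (k : RdL R d -> R) : bddm h -> bddm k -> bddm (fun z : X => h z.1 * k z.2).
  move=> [mh [M hM]] [mk [N kN]]; split.
    by apply: measurable_funM; apply: measurableT_comp.
  by exists (M * N) => z; rewrite normrM ler_pM.
rewrite (_ : (fun z => _ ) = (fun z : X => (\1_A z.1 - f0 z.1) * \1_B z.2 + f0 z.1 * (\1_B z.2 - g0 z.2))); last first.
  apply/funext => z; rewrite (_ : \1_(A `*` B) z = \1_A z.1 * \1_B z.2 :> R); first by ring.
  by rewrite !indicE -natrM mulnb in_setX.
apply: le_lt_trans (nmD (lexx 1) (bddm_Lfun mu (lexx 1) (ten _ _ bAf bB)) (bddm_Lfun mu (lexx 1) (ten _ _ bf0 bBg))) _.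
rewrite (nm_tensor bAf bB) (nm_tensor bf0 bBg) [e]splitr.
have f0A' : nm P 1 (fun w => \1_A w - f0 w) < e / 2 / (nm mQ 1 \1_B + 1).
  by rewrite -lte_fin nmE//; exact: bddm_Lfun.
have g0B' : nm mQ 1 (fun w => \1_B w - g0 w) < e / 2 / (nm P 1 f0 + 1).
  by rewrite -lte_fin nmE//; exact: bddm_Lfun.
apply: ltr_leD.
  apply: (@le_lt_trans _ _ (nm P 1 (fun w => \1_A w - f0 w) * (nm mQ 1 \1_B + 1))).
    by rewrite ler_wpM2l ?nm_ge0// lerDl.
  by rewrite -ltr_pdivlMr.
apply: (@le_trans _ _ ((nm P 1 f0 + 1) * nm mQ 1 (fun w => \1_B w - g0 w))).
  by rewrite ler_wpM2r ?nm_ge0// lerDl.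
by rewrite mulrC -ler_pdivlMr// ltW.
Qed.

End test_functions.

(** * Limits along random indices *)

Lemma increasing_choice (Pr : nat -> nat -> Prop) :
  (forall n m, exists2 k, (m <= k)%N & Pr n k) ->
  exists2 s : nat -> nat, {homo s : m n / (m < n)%N} & forall n, Pr n (s n).
Proof.
move=> H.
have H' (x : nat * nat) : exists k, (x.2 <= k)%N /\ Pr x.1 k.
  by have [k h1 h2] := H x.1 x.2; exists k.
have [g gP] := choice H'.
pose s := fix s n := if n is m.+1 then g (n, (s m).+1) else g (0%N, 0%N).
exists s.
  apply: homo_ltn; first exact: ltn_trans.
  by move=> n; exact: (gP (n.+1, (s n).+1)).1.
by case=> [|n]; [exact: (gP (0%N, 0%N)).2|exact: (gP (n.+1, (s n).+1)).2].
Qed.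

Lemma homo_ge_id (s : nat -> nat) : {homo s : m n / (m < n)%N} -> forall n, (n <= s n)%N.
Proof. by move=> hs; elim=> // n IH; apply: leq_ltn_trans IH (hs _ _ _). Qed.

Lemma cvg_subseq_homo (T : topologicalType) (u : nat -> T) (l : T) (s : nat -> nat) :
  {homo s : m n / (m < n)%N} -> u n @[n --> \oo] --> l -> u (s n) @[n --> \oo] --> l.
Proof.
move=> hs cu; apply: (cvg_comp s u _ cu) => A [N _ NA].
by exists N => // n /= Nn; apply: NA; apply: leq_trans Nn (homo_ge_id hs n).
Qed.

(* An ultrafilter finer than [\oo] provides all the limits at once. *)
Lemma bounded_cluster (R : realType) (a : nat -> nat -> R) (M : nat -> R) :
  (forall k j, `|a k j| <= M j) ->
  exists x : nat -> R, forall n (E : nat -> Prop), (\forall k \near \oo, E k) -> forall e : R, 0 < e ->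
    exists2 k, E k & forall j, (j <= n)%N -> `|a k j - x j| <= e.
Proof.
move=> aM; have [U [UU oU]] := @ultraFilterLemma nat \oo _.
have Uj j : exists x : R, a k j @[k --> U] --> x.
  have := @segment_compact R (- M j) (M j); rewrite compact_ultra.
  have UF : UltraFilter (fmap (a ^~ j) U).
    split=> [|G GF UG]; first exact: fmap_proper_filter.
    apply/seteqP; split=> [A GA|]; last exact: UG.
    have [//|UC] := in_ultra_setVsetC (a ^~ j @^-1` A) UU.
    have /filter_ex[x [Ax]] : G (A `&` ~` A) by apply: filterI => //; exact: UG.
    by [].
  move=> /(_ (fmap (a ^~ j) U) UF) [].
    by apply: (@filterE _ U) => k; rewrite /= in_itv/= -ler_norml.
  by move=> x [_ xU]; exists x.
have [x xU] := choice Uj; exists x => n E oE e e0.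
have /filter_ex[k [Ek kP]] : \forall k \near U, E k /\ forall j, (j <= n)%N -> `|a k j - x j| <= e.
  apply: filterI; first exact: oU.
  have : \forall k \near U, forall j : 'I_n.+1, `|a k j - x j| <= e.
    apply: filter_forall => j; have /cvgrPdist_le /(_ _ e0) := xU j.
    by apply: filterS => k; rewrite distrC.
  by apply: filterS => k h j jn; exact: (h (Ordinal (jn : (j < n.+1)%N))).
by exists k.
Qed.

Section measurability.
Context d (T : measurableType d) (R : realType).

Lemma measurable_index d' (U : measurableType d') (kap : T -> nat) (f : nat -> T -> U) :
  (forall k, measurable [set x | kap x = k]) -> (forall k, measurable_fun setT (f k)) ->
  measurable_fun setT (fun x => f (kap x) x).
Proof.
move=> mk mf _ A mA; rewrite setTI.
rewrite (_ : _ @^-1` A = \bigcup_k ([set x | kap x = k] `&` f k @^-1` A)).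
  apply: bigcup_measurable => k _; apply: measurableI => //.
  by rewrite -[X in measurable X]setTI; exact: mf.
apply/seteqP; split=> [x fx|x [k _ [/= <-]]//]; by exists (kap x).
Qed.

Lemma measurable_cvgn (f : nat -> T -> R) : (forall n, measurable_fun setT (f n)) ->
  measurable [set x | cvgn (f^~ x)].
Proof.
move=> mf.
rewrite (_ : [set x | _] = \bigcap_m \bigcup_N \bigcap_n
   [set x | `|f (N + n)%N x - f N x| <= m.+1%:R^-1]).
  apply: bigcap_measurable => // m _; apply: bigcup_measurable => N _.
  apply: bigcap_measurable => // n _.
  rewrite -[X in measurable X]setTI.
  apply: (@measurable_fun_le _ _ _ _ (fun x => `|f (N + n)%N x - f N x|) (cst m.+1%:R^-1)) => //.
  by apply: measurableT_comp => //; exact: measurable_funB.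
apply/seteqP; split=> x.
  move=> /= cx m _.
  have m0 : 0 < m.+1%:R^-1 / 2 :> R by rewrite divr_gt0.
  have /cvgrPdist_le /(_ _ m0)[N _ NP] := cx.
  exists N => // n _ /=.
  rewrite [leRHS]splitr.
  apply: le_trans (ler_distD (lim (f^~ x @ \oo)) _ _) _; apply: lerD.
    by rewrite distrC; apply: NP => /=; exact: leq_addr.
  exact: (NP N (leqnn N)).
move=> H; apply/cauchy_cvgP; apply: cauchy_exP => e e0.
have [m _ /(_ m (leqnn m)) /= me] := near_infty_natSinv_lt (PosNum e0).
have [N _ NP] := H m Logic.I; exists (f N x); exists N => // n /= Nn.
rewrite /ball/= distrC; apply: le_lt_trans me.
by have := NP (n - N)%N Logic.I; rewrite /= subnKC.
Qed.

Lemma measurable_limn_einf (f : nat -> T -> \bar R) : (forall n, measurable_fun setT (f n)) ->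
  measurable_fun setT (fun x => limn_einf (f^~ x)).
Proof.
move=> mf; apply: (emeasurable_fun_cvg (fun n x => einfs (f^~ x) n)).
  exact: measurable_fun_einfs.
by move=> x _; rewrite limn_einf_lim; exact: is_cvg_einfs.
Qed.

End measurability.

Section convex_weights.
Context (R : realType) (N : nat -> nat) (a : nat -> nat -> R).
Hypothesis wa : forall n, convex_weights n (N n) (a n).

Lemma convex_cvg (c : nat -> R) (l : R) : c k @[k --> \oo] --> l ->
  \sum_(k < N n) a n k * c k @[n --> \oo] --> l.
Proof.
move=> cl; apply/cvgrPdist_le => e e0.
have /cvgrPdist_le /(_ _ e0)[m _ mP] := cl.
exists m => // n /= mn; have [a0 an aN a1] := wa n.
rewrite -[l]mul1r -a1 mulr_suml -sumrB.
apply: le_trans (ler_norm_sum _ _ _) _.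
rewrite -[leRHS]mul1r -a1 mulr_suml; apply: ler_sum => k _.
rewrite -mulrBr normrM ger0_norm//.
have [kn|nk] := ltnP k n; first by rewrite an// !mul0r.
by rewrite ler_wpM2l//; apply: mP => /=; exact: leq_trans nk.
Qed.

(** A weighted mean is at least the least of its terms. This recovers a genuine sequence of indices
    from convex combinations. *)
Lemma convex_exists n (c : nat -> R) (e : R) : \sum_(k < N n) a n k * c k < e ->
  exists2 k, (n <= k)%N & c k < e.
Proof.
have [a0 an aN a1] := wa n => lt; apply: contrapT => H.
have ec k : (n <= k)%N -> e <= c k.
  by move=> nk; rewrite leNgt; apply/negP => ck; apply: H; exists k.
move: lt; rewrite ltNge => /negP; apply.
rewrite -[leLHS]mul1r -a1 mulr_suml; apply: ler_sum => k _.
have [kn|nk] := ltnP k n; first by rewrite an// !mul0r.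
by rewrite ler_wpM2l// ec.
Qed.

End convex_weights.

Lemma cvg_powR (R : realType) (r l : R) (u : nat -> R) : 0 < r -> (forall n, 0 <= u n) ->
  u n @[n --> \oo] --> l -> u n `^ r @[n --> \oo] --> l `^ r.
Proof.
move=> r0 u0 ul.
have l0 : 0 <= l by apply: (cvgr_to_ge ul); exact: nearW.
have rK (x : R) : 0 <= x -> (x `^ r^-1) `^ r = x.
  by move=> x0; rewrite -powRrM mulVf ?gt_eqF// powRr1.
have Kr (x : R) : 0 <= x -> (x `^ r) `^ r^-1 = x.
  by move=> x0; rewrite -powRrM mulfV ?gt_eqF// powRr1.
have ri0 : 0 < r^-1 by rewrite invr_gt0.
apply/cvgrPdist_le => e e0.
have up : \forall n \near \oo, u n `^ r <= l `^ r + e.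
  have h : l < (l `^ r + e) `^ r^-1.
    rewrite -{1}(Kr l l0); apply: gt0_ltr_powR; rewrite ?nnegrE ?powR_ge0 ?addr_ge0 ?powR_ge0 ?(ltW e0)//.
    by rewrite ltrDl.
  apply: filterS (cvgr_lt _ ul _ h) => n un.
  rewrite -[leRHS]rK ?addr_ge0 ?powR_ge0 ?(ltW e0)//.
  by apply: ge0_ler_powR; rewrite ?nnegrE ?powR_ge0 ?(ltW r0) ?(ltW un).
have dn : \forall n \near \oo, l `^ r - e <= u n `^ r.
  have [le|le] := lerP (l `^ r) e.
    by apply: nearW => n; apply: (@le_trans _ _ 0); rewrite ?powR_ge0// subr_le0.
  have le0 : 0 <= l `^ r - e by rewrite subr_ge0 ltW.
  have h : (l `^ r - e) `^ r^-1 < l.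
    rewrite -{2}(Kr l l0); apply: gt0_ltr_powR; rewrite ?nnegrE ?powR_ge0//.
    by rewrite ltrBlDr ltrDl.
  apply: filterS (cvgr_gt _ ul _ h) => n un.
  rewrite -[leLHS]rK//.
  by apply: ge0_ler_powR; rewrite ?nnegrE ?powR_ge0 ?(ltW r0) ?(ltW un).
by apply: filterS2 up dn => n h1 h2; rewrite ler_distl; apply/andP; split; lra.
Qed.

(** * Convergence of integrals under a uniform L^p bound *)

Section uniform_integrability.
Context d (T : measurableType d) (R : realType).
Variable mu : {finite_measure set T -> \bar R}.
Variables (p C : R) (Z_ : nat -> T -> R) (Z : T -> R).
Hypotheses (p1 : 1 < p) (mZ_ : forall n, measurable_fun setT (Z_ n)) (mZ : measurable_fun setT Z).
Hypothesis cZ : {ae mu, forall x, Z_ n x @[n --> \oo] --> Z x}.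
Hypothesis ZC : forall n, (\int[mu]_x (`|Z_ n x| `^ p)%:E <= C%:E)%E.

Let p1w : 1 <= p := ltW p1.

Let ZL_ n : Z_ n \in Lfun mu p%:E.
Proof. by apply: Lfun_pow => //; apply: le_lt_trans (ZC n) _; exact: ltry. Qed.

Let C0 : 0 <= C.
Proof. by rewrite -lee_fin; apply: le_trans (ZC 0%N); apply: integral_ge0 => x _; rewrite lee_fin powR_ge0. Qed.

Let ZC' : (\int[mu]_x (`|Z x| `^ p)%:E <= C%:E)%E.
Proof.
apply: (@le_trans _ _ (\int[mu]_x limn_einf (fun n => (`|Z_ n x| `^ p)%:E))%E); last first.
  apply: le_trans (fatou mu measurableT (f := fun n x => (`|Z_ n x| `^ p)%:E) _ _) _.
  - by move=> n; apply/measurable_EFinP; exact: measurable_normpow.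
  - by move=> n x _; rewrite lee_fin powR_ge0.
  rewrite limn_einf_lim; apply: lime_le; first exact: is_cvg_einfs.
  by apply: nearW => n; apply: le_trans (ZC n); apply: ereal_inf_lbound; exists n => /=.
apply: ae_ge0_le_integral => //.
- by apply/measurable_EFinP; exact: measurable_normpow.
- move=> x _; rewrite limn_einf_lim; apply: lime_ge; first exact: is_cvg_einfs.
  by apply: nearW => n; apply: le_ereal_inf_tmp => _ [m /= _ <-]; rewrite lee_fin powR_ge0.
- apply: measurable_limn_einf => n.
  by apply/measurable_EFinP; exact: measurable_normpow.
apply: filterS cZ => x cx _.
have c : (`|Z_ n x| `^ p)%:E @[n --> \oo] --> (`|Z x| `^ p)%:E.
  apply: cvg_EFin; first exact: nearW.
  by apply: cvg_powR; [exact: lt_trans ltr01 p1|by []|exact: cvg_norm].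
by have [->] := cvg_limn_einf_sup c.
Qed.

Let ZL : Z \in Lfun mu p%:E.
Proof. by apply: Lfun_pow => //; apply: le_lt_trans ZC' _; exact: ltry. Qed.

Let int_Lp f : f \in Lfun mu p%:E -> mu.-integrable setT (EFin \o f).
Proof.
move=> fL; apply/Lfun1_integrable.
by apply: (Lfun_subset (lexx _) (EFin_ge1 p1) _ _ fL); [exact: fin_num_measure|exact: EFin_ge1].
Qed.

(** The truncation level [c] satisfies [c^(p-1) = K]. The left factor is at most [|z|] and vanishes
    unless [|z| > c], where [|z|^(p-1)] exceeds [K]. *)
Let trunc_tail (K : R) z : 0 < K -> `|z - trunc (K `^ (p - 1)^-1) z| * K <= `|z| `^ p.
Proof.
move=> K0; set c := K `^ _; have c0 : 0 < c by rewrite powR_gt0.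
have [zc|cz] := lerP `|z| c; first by rewrite trunc_id// subrr normr0 mul0r powR_ge0.
have z0 : 0 < `|z| := lt_trans c0 cz.
have KE : K = c `^ (p - 1).
  by rewrite /c -powRrM mulVf ?powRr1 ?(ltW K0)// gt_eqF// subr_gt0.
have -> : `|z| `^ p = `|z| * `|z| `^ (p - 1).
  by rewrite -{2}(powRr1 (ltW z0)) -powRD ?(gt_eqF z0) ?implybT// addrC subrK.
apply: ler_pM => //; first exact: ltW.
  have [z0'|z0'] := lerP 0 z; move: cz.
    rewrite ger0_norm// => cz; rewrite /trunc min_l ?(ltW cz)// max_r; last by lra.
    by rewrite ger0_norm; lra.
  rewrite ltr0_norm// => cz; rewrite /trunc min_r; last by lra.
  by rewrite max_l; [rewrite ler0_norm|]; lra.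
rewrite KE; apply: ge0_ler_powR; rewrite ?nnegrE ?(ltW c0)// ?(ltW cz)//.
by rewrite subr_ge0.
Qed.

Let trunc_int (K : R) f : f \in Lfun mu p%:E -> (\int[mu]_x (`|f x| `^ p)%:E <= C%:E)%E -> 0 < K ->
  `|\int[mu]_x f x - \int[mu]_x trunc (K `^ (p - 1)^-1) (f x)| <= C / K.
Proof.
move=> fL fC K0; set c := K `^ _; have c0 : 0 <= c by rewrite powR_ge0.
have mf := Lfun_measurable fL.
have bt : bddm (fun x => trunc c (f x)).
  split; first exact: (measurableT_comp (measurable_trunc _)).
  by exists c => x; exact: trunc_bound.
have It := bddm_integrable mu bt.
rewrite -RintegralB//; last exact: int_Lp.
have IB : mu.-integrable setT (EFin \o (fun x => f x - trunc c (f x))).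
  by apply: (integrableB measurableT (int_Lp fL) It).
apply: le_trans (le_normr_Rintegral measurableT IB) _.
rewrite ler_pdivlMr// mulrC -RintegralZl//; last exact: (integrable_norm IB).
have Ip := Lfun_integrable p1w fL.
apply: (@le_trans _ _ (\int[mu]_x (`|f x| `^ p))).
  apply: le_Rintegral => //.
    by have := integrableZl measurableT K (integrable_norm IB).
  by move=> x _; rewrite mulrC; exact: trunc_tail.
by rewrite -lee_fin fineK//; exact: (integrable_fin_num measurableT Ip).
Qed.

Lemma Lp_bounded_cvg : \int[mu]_x Z_ n x @[n --> \oo] --> \int[mu]_x Z x.
Proof.
apply/cvgrPdist_le => e e0.
have e30 : 0 < e / 3 by rewrite divr_gt0.
(* Chosen so that [C / K <= e / 3]; the numerator [C + 1] allows [C = 0]. *)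
pose K := (C + 1) / (e / 3).
have K0 : 0 < K by rewrite divr_gt0// ltr_wpDl.
have CK : C / K <= e / 3.
  by rewrite ler_pdivrMr// /K mulrC divfK ?gt_eqF// lerDl.
have c0 : 0 <= K `^ (p - 1)^-1 by rewrite powR_ge0.
have : \int[mu]_x trunc (K `^ (p - 1)^-1) (Z_ n x) @[n --> \oo] --> \int[mu]_x trunc (K `^ (p - 1)^-1) (Z x).
  apply: (@dominated_Rintegral _ _ _ mu _ _ (cst (K `^ (p - 1)^-1))).
  - by move=> n; exact: (measurableT_comp (measurable_trunc _)).
  - exact: (measurableT_comp (measurable_trunc _)).
  - apply: filterS cZ => x cx; apply/cvgrPdist_le => d' d0.
    have /cvgrPdist_le /(_ _ d0) := cx; apply: filterS => n; apply: le_trans.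
    exact: trunc_lip.
  - exact: (bddm_integrable mu (@bddm_cst _ T R _)).
  - by move=> n x; exact: trunc_bound.
move=> /cvgrPdist_le /(_ _ e30); apply: filterS => n h.
have h1 := trunc_int ZL ZC' K0.
have h2 := trunc_int (ZL_ n) (ZC n) K0.
rewrite (_ : e = e / 3 + e / 3 + e / 3); last by field.
move: h h1 h2; set t := \int[mu]_x trunc _ (Z x); set t' := \int[mu]_x trunc _ (Z_ n x).
move=> h h1 h2.
rewrite (_ : _ - _ = (\int[mu]_x Z x - t) + (t - t') + (t' - \int[mu]_x Z_ n x)); last by ring.
apply: le_trans (ler_normD _ _) _; apply: lerD; last by rewrite distrC (le_trans h2).
by apply: le_trans (ler_normD _ _) _; apply: lerD => //; exact: le_trans h1 CK.
Qed.

End uniform_integrability.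

(** * The mean ergodic theorem and the unfolding *)

Section product_sections.
Context d1 d2 (T1 : measurableType d1) (T2 : measurableType d2) (R : realType).
Variables (m1 : {finite_measure set T1 -> \bar R}) (m2 : {finite_measure set T2 -> \bar R}).
Local Notation mu := (prodfm m1 m2).
Implicit Types f : T1 * T2 -> R.

Lemma bddm_section f x : bddm f -> bddm (fun y => f (x, y)).
Proof. by move=> [mf [M fM]]; split; [exact: measurableT_comp|exists M]. Qed.

Lemma measurable_Rsection f : mu.-integrable setT (EFin \o f) ->
  measurable_fun setT (fun x => \int[m2]_y f (x, y)).
Proof.
move=> fi; have := measurable_fubini_F fi.
by apply: measurableT_comp; exact: fine_measurable.
Qed.

Let RsectionE f : mu.-integrable setT (EFin \o f) ->
  {ae m1, forall x, (\int[m2]_y f (x, y))%:E = fubini_F m2 (EFin \o f) x}.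
Proof.
move=> fi; apply: filterS (ae_integrable1 fi) => x /= fx.
by rewrite /Rintegral fineK//; exact: (integrable_fin_num measurableT fx).
Qed.

Lemma integrable_Rsection f : mu.-integrable setT (EFin \o f) ->
  m1.-integrable setT (fun x => (\int[m2]_y f (x, y))%:E).
Proof.
move=> fi; have If := integrable_fubini_F fi.
have mR := measurable_Rsection fi.
apply/integrableP; split; first exact/measurable_EFinP.
have /integrableP[_] := If; apply: le_lt_trans.
apply: ae_ge0_le_integral => //.
- by apply: measurableT_comp => //; exact/measurable_EFinP.
- by apply: measurableT_comp => //; exact: (measurable_fubini_F fi).
- by apply: filterS (RsectionE fi) => x <- _.
Qed.

Lemma Rintegral_prod f : mu.-integrable setT (EFin \o f) ->
  \int[m1]_x \int[m2]_y f (x, y) = \int[mu]_z f z.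
Proof.
move=> fi; rewrite /Rintegral; congr fine.
rewrite -(integral12_prod_meas1 fi); apply: ae_eq_integral => //.
- by apply/measurable_EFinP; exact: measurable_Rsection.
- exact: (measurable_fubini_F fi).
- by apply: filterS (RsectionE fi) => x /= h _.
Qed.

Variables (r : R) (r1 : 1 <= r).

Let mpow f : measurable_fun setT f -> measurable_fun setT (fun z => (`|f z| `^ r)%:E).
Proof. by move=> mf; apply/measurable_EFinP; exact: measurable_normpow. Qed.

Lemma Lfun_section f : f \in Lfun mu r%:E -> {ae m1, forall x, (fun y => f (x, y)) \in Lfun m2 r%:E}.
Proof.
move=> fL; have mf := Lfun_measurable fL.
have Ip := Lfun_integrable r1 fL.
apply: filterS (ae_integrable1 Ip) => x /= /integrableP[_ Ix].
apply: Lfun_pow => //; first exact: measurableT_comp.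
apply: le_lt_trans Ix; apply: ge0_le_integral => //.
- by apply: (measurableT_comp (mpow mf)).
- by apply: measurableT_comp => //; apply: (measurableT_comp (mpow mf)).
- by move=> y _; rewrite /= lee_fin ler_norm.
Qed.

Variable f : T1 * T2 -> R.
Hypothesis fL : forall x, (fun y => f (x, y)) \in Lfun m2 r%:E.
Hypothesis mf : measurable_fun setT f.

Lemma measurable_nm_section : measurable_fun setT (fun x => nm m2 r (fun y => f (x, y)) `^ r).
Proof.
rewrite (_ : (fun x => _) = fun x => fine (\int[m2]_y (`|f (x, y)| `^ r)%:E)).
  apply: measurableT_comp; first exact: fine_measurable.
  apply: (@measurable_fun_fubini_tonelli_F _ _ _ _ _ m2 (fun z => (`|f z| `^ r)%:E)); first exact: mpow.
  by move=> z; rewrite lee_fin powR_ge0.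
by apply/funext => x; rewrite nm_pow.
Qed.

Lemma nm_section_int :
  (\int[m1]_x (nm m2 r (fun y => f (x, y)) `^ r)%:E = \int[mu]_z (`|f z| `^ r)%:E)%E.
Proof.
rewrite [RHS](@fubini_tonelli1 _ _ _ _ _ m1 m2 (fun z => (`|f z| `^ r)%:E)); last 2 first.
- exact: mpow.
- by move=> z; rewrite lee_fin powR_ge0.
by apply: eq_integral => x _; rewrite -LnormE.
Qed.

End product_sections.

Section mean_ergodic.
Context dO (Omega : measurableType dO) (R : realType) (d : nat).
Variables (P : probability Omega R) (tau : 'rV[R]_d -> Omega -> Omega).
Variables (Q : bounded_open R d) (p : R).
Variables (DO : set (Omega -> R)) (DQ : set (RdL R d -> R)) (Omega0 : set Omega).
Hypothesis sys : ergodic_system P tau.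
Hypothesis TF : test_families P Q DO DQ.
Hypothesis adm : admissible_points P tau Q p DO DQ Omega0.
Local Notation X := (Omega * RdL R d)%type.
Local Notation mQ := (lebesgue_on Q).
Local Notation mu := (prodfm P mQ).
Local Notation S := (shear tau).
Implicit Types (f : X -> R).

Lemma bddm_shear c f : c != 0 -> bddm f -> bddm (f \o S c).
Proof.
move=> c0 [mf [M fM]]; split; last by exists M => z; exact: fM.
by apply: measurableT_comp => //; exact: (measurable_shear sys).
Qed.

Lemma Rintegral_shear c f : c != 0 -> measurable_fun setT f ->
  \int[mu]_z f (S c z) = \int[mu]_z f z.
Proof.
by move=> c0 mf; rewrite /Rintegral (integral_shear sys mQ c0 (F := EFin \o f))//; exact/measurable_EFinP.
Qed.

Variable eps : nat -> R.
Hypothesis eps0 : forall k, 0 < eps k.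
Hypothesis epsc : eps k @[k --> \oo] --> 0.

Let epsV k : (eps k)^-1 != 0.
Proof. by rewrite invr_eq0 gt_eqF. Qed.

Local Notation Z f k w := (\int[mQ]_x f (S (eps k)^-1 (w, x))).

Let bs f k w : bddm f -> bddm (fun x => f (S (eps k)^-1 (w, x))).
Proof. by move=> /(bddm_shear (epsV k)) h; exact: bddm_section h. Qed.

Lemma ergodic_points f : Qspan (tensors DO DQ) f -> forall w, Omega0 w ->
  Z f k w @[k --> \oo] --> \int[mu]_z f z.
Proof.
suff H : Qspan (tensors DO DQ) `<=` [set f | bddm f /\ forall w, Omega0 w ->
    Z f k w @[k --> \oo] --> \int[mu]_z f z] by move=> /H[].
clear f; apply: Qspan_ind.
- split=> [|w _]; first exact: (@bddm_cst _ X R 0).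
  rewrite {2}/Rintegral integral0 /=.
  by under eq_fun do rewrite /Rintegral integral0 /=; exact: cvg_cst.
- move=> f g [bf cf] [bg cg]; split=> [|w Ow]; first exact: bddmD.
  rewrite RintegralD//; [|exact: bddm_integrable|exact: bddm_integrable].
  rewrite (_ : (fun k => _) = fun k => Z f k w + Z g k w); first exact: cvgD (cf w Ow) (cg w Ow).
  by apply/funext => k; rewrite RintegralD//; apply: bddm_integrable; exact: bs.
- move=> c f tf; have bf := tensors_bddm TF tf; split=> [|w Ow]; first exact: bddmZ.
  rewrite RintegralZl//; last exact: bddm_integrable.
  rewrite (_ : (fun k => _) = fun k => ratr c * Z f k w); last first.
    by apply/funext => k; rewrite RintegralZl//; apply: bddm_integrable; exact: bs.
  apply: cvgMr; have [_ _ A] := adm.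
  (* The assumed limits concern products of two tensors. The second one is taken to be the unit: [f]
     times [psi] is [f], since elements of [DQ] vanish off the closure of [Q]. *)
  pose psi : X -> R := fun z => cst 1 z.1 * \1_(closure (Q : set 'rV[R]_d)) z.2.
  have tpsi : tensors DO DQ psi.
    by exists (cst 1), \1_(closure (Q : set 'rV[R]_d)); split=> //; [exact: (testO_one TF)|exact: (testQ_one TF)].
  have [_] := A f psi w tf tpsi Ow.
  have -> : f \* psi = f.
    have [g [h [_ Dh ->]]] := tf; apply/funext => z; rewrite /psi /= mul1r indicE.
    have [zQ|zQ] := boolP (_ \in _); first by rewrite mulr1.
    have [_ ->] := testQ_continuous TF Dh; last by move=> /mem_set; apply/negP.
    by rewrite !mulr0 ?mul0r.
  rewrite /mean_integral Rintegral_prod; last exact: bddm_integrable.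
  apply: cvg_comp => A0 [e /= e0 eA].
  have /cvgrPdist_lt /(_ _ e0) := epsc; apply: filterS => k kE.
  by apply: eA => //=; exact: eps0.
Qed.

Lemma mean_ergodic f : bddm f ->
  \int[P]_w `|Z f k w - \int[mu]_z f z| @[k --> \oo] --> 0.
Proof.
have ZL g k : bddm g -> P.-integrable setT (fun w => (Z g k w)%:E).
  move=> bg; apply: (@integrable_Rsection _ _ _ _ _ P mQ (g \o S (eps k)^-1)).
  by apply: bddm_integrable; exact: bddm_shear.
have ZI g k : bddm g -> P.-integrable setT (fun w => `|Z g k w - \int[mu]_z g z|%:E).
  move=> bg; apply: (@integrable_norm _ _ _ P setT (fun w => Z g k w - \int[mu]_z g z)).
  exact: (integrableB measurableT (ZL g k bg) (bddm_integrable P (@bddm_cst _ _ R (\int[mu]_z g z)))).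
have Qc g : Qspan (tensors DO DQ) g -> \int[P]_w `|Z g k w - \int[mu]_z g z| @[k --> \oo] --> 0.
  move=> Qg; have bg := Rspan_bddm (tensors_bddm TF) (Qspan_Rspan Qg).
  have [_ [M gM]] := bg.
  rewrite [X in _ --> X](_ : 0 = \int[P]_w cst 0 w); last by rewrite /Rintegral integral0.
  apply: (@dominated_Rintegral _ _ _ P _ _ (cst (M * fine (mQ setT) + `|\int[mu]_z g z|))).
  - by move=> k; have /integrableP[/measurable_EFinP] := ZI g k bg.
  - by [].
  - have [mO PO _] := adm.
    exists (~` Omega0); split; first exact: measurableC.
      by have := probability_setC P mO; rewrite PO subee.
    move=> w /= nc Ow; apply: nc; have := ergodic_points Qg Ow.
    move=> /cvgrPdist_le h; apply/cvgrPdist_le => e e0.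
    by apply: filterS (h e e0) => k; rewrite sub0r normrN normr_id distrC.
  - exact: (bddm_integrable P (@bddm_cst _ _ R _)).
  - move=> k w; rewrite normr_id; apply: le_trans (ler_normB _ _) _; rewrite lerD2r.
    have bk := bs k w bg.
    apply: le_trans (le_normr_Rintegral measurableT (bddm_integrable mQ bk)) _.
    rewrite -Rintegral_cst//; apply: le_Rintegral => //.
      by apply: (integrable_norm (bddm_integrable mQ bk)).
    exact: (bddm_integrable mQ (@bddm_cst _ _ R M)).
move=> bf; apply/cvgrPdist_le => e e0.
have e30 : 0 < e / 3 by rewrite divr_gt0.
have [g Qg fg] := tensors_dense TF bf e30.
have bg := Rspan_bddm (tensors_bddm TF) (Qspan_Rspan Qg).
have bfg := bddmB bf bg.
have nfg : nm mu 1 (fun z => f z - g z) = \int[mu]_z `|f z - g z|.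
  rewrite -[LHS]powRr1 ?nm_ge0// nm_pow//; last exact: bddm_Lfun.
  by apply: eq_Rintegral => z _; rewrite powRr1.
have /cvgrPdist_le /(_ _ e30) := Qc g Qg; apply: filterS => k.
have dist0 (x y : R) : 0 <= x -> 0 <= y -> (x <= e / 3 -> y <= e) -> `|0 - x| <= e / 3 -> `|0 - y| <= e.
  by move=> x0 y0; rewrite !sub0r !normrN !ger0_norm.
apply: dist0; [exact: Rintegral_ge0|exact: Rintegral_ge0|].
move=> gk.
have m12 : `|\int[mu]_z g z - \int[mu]_z f z| <= nm mu 1 (fun z => f z - g z).
  rewrite nfg distrC -RintegralB//; try exact: bddm_integrable.
  exact: (le_normr_Rintegral measurableT (bddm_integrable mu bfg)).
pose G w := \int[mQ]_x `|f (S (eps k)^-1 (w, x)) - g (S (eps k)^-1 (w, x))|.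
have bfg' := bddm_shear (epsV k) bfg.
have In := integrable_norm (bddm_integrable mu bfg').
(* The shear preserves the product measure, so the error of replacing [f] by [g] is the same for
   every [k]. *)
have GE : \int[P]_w G w = nm mu 1 (fun z => f z - g z).
  rewrite nfg -(@Rintegral_shear (eps k)^-1 (fun z => `|f z - g z|))//.
    exact: (@Rintegral_prod _ _ _ _ _ P mQ (fun z => `|f (S (eps k)^-1 z) - g (S (eps k)^-1 z)|)).
  by apply: measurableT_comp => //; have [] := bfg.
have GI : P.-integrable setT (EFin \o G) by exact: (@integrable_Rsection _ _ _ _ _ P mQ (fun z => `|f (S (eps k)^-1 z) - g (S (eps k)^-1 z)|)).
pose c := `|\int[mu]_z g z - \int[mu]_z f z|.
have cI : P.-integrable setT (EFin \o cst c) := bddm_integrable P (@bddm_cst _ _ R c).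
apply: (@le_trans _ _ (\int[P]_w (G w + `|Z g k w - \int[mu]_z g z| + c))).
  apply: le_Rintegral => //; first exact: ZI.
    exact: (integrableD measurableT (integrableD measurableT GI (ZI g k bg)) cI).
  move=> w _.
  rewrite (_ : _ - _ = (Z f k w - Z g k w) + (Z g k w - \int[mu]_z g z) + (\int[mu]_z g z - \int[mu]_z f z)); last by ring.
  apply: le_trans (ler_normD _ _) _; rewrite lerD2r.
  apply: le_trans (ler_normD _ _) _; rewrite lerD2r.
  rewrite -RintegralB//; try by apply: bddm_integrable; exact: bs.
  apply: (le_normr_Rintegral measurableT).
  exact: (bddm_integrable mQ (bddmB (bs k w bf) (bs k w bg))).
rewrite RintegralD//; last exact: (integrableD measurableT GI (ZI g k bg)).
rewrite RintegralD//; last exact: ZI.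
have PT : fine (P setT) = 1 by have -> := @probability_setT _ _ _ P.
rewrite GE Rintegral_cst// PT mulr1.
rewrite (_ : e = e / 3 + e / 3 + e / 3); last by field.
by apply: lerD; [apply: lerD => //; exact: ltW|rewrite /c (le_trans m12)// ltW].
Qed.

End mean_ergodic.

Section unfolding.
Context dO (Omega : measurableType dO) (R : realType) (d : nat).
Variables (P : probability Omega R) (tau : 'rV[R]_d -> Omega -> Omega).
Variables (Q : bounded_open R d) (p q : R) (p1 : 1 < p).
Hypotheses (q1 : 1 < q) (pq : p^-1 + q^-1 = 1).
Hypothesis sys : ergodic_system P tau.
Local Notation X := (Omega * RdL R d)%type.
Local Notation mQ := (lebesgue_on Q).
Local Notation mu := (prodfm P mQ).
Local Notation S := (shear tau).
Local Notation B := (LspaceType mu (EFin_ge1 p1)).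
Implicit Types (f : X -> R) (u : B).

Let p1w : 1 <= p := ltW p1.

Lemma Lfun_shear c f : c != 0 -> f \in Lfun mu p%:E -> f \o S c \in Lfun mu p%:E.
Proof.
move=> c0 fL; have mf := Lfun_measurable fL.
have mfs : measurable_fun setT (f \o S c) by apply: measurableT_comp => //; exact: (measurable_shear sys).
apply: Lfun_pow => //.
rewrite (@ge0_integral_shear _ _ _ _ _ _ sys mQ c (fun z => (`|f z| `^ p)%:E))//.
- by have -> := LnormE fL p1w; rewrite ltry.
- by apply/measurable_EFinP; exact: measurable_normpow.
Qed.

Lemma nm_shear c f : c != 0 -> f \in Lfun mu p%:E -> nm mu p (f \o S c) = nm mu p f.
Proof.
move=> c0 fL; have mf := Lfun_measurable fL; have fsL := Lfun_shear c0 fL.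
have p0 : p != 0 by rewrite gt_eqF// (lt_trans ltr01).
apply: (@powR_injective _ p); rewrite ?inE ?nnegrE ?nm_ge0 ?(lt_trans ltr01)//.
apply: EFin_inj; rewrite -(LnormE fsL p1w) -(LnormE fL p1w).
rewrite -[RHS](@ge0_integral_shear _ _ _ _ _ _ sys mQ c (fun z => (`|f z| `^ p)%:E))//.
by apply/measurable_EFinP; exact: measurable_normpow.
Qed.

Section fixed_scale.
Variable c : R.
Hypothesis c0 : c != 0.

Definition unfold u : B := Lspace_of (Lfun_Sub (EFin_ge1 p1) (Lfun_shear c0 (@LspaceL _ _ _ mu p p1 u))).

Lemma unfoldE u : (unfold u : X -> R) = (u : X -> R) \o S c %[ae mu].
Proof. exact: Lspace_ofE. Qed.

Lemma unfold_ae u f : (u : X -> R) = f %[ae mu] -> (unfold u : X -> R) = f \o S c %[ae mu].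
Proof.
move=> uf; have := ae_shear sys (m := mQ) c0 uf.
apply: filterS2 (unfoldE u) => z /= -> // h _; exact: h.
Qed.

Lemma unfold_linear : linear unfold.
Proof.
move=> a u v; apply: LspaceP.
have huv : {ae mu, forall z, unfold u z = u (S c z) /\ unfold v z = v (S c z)}.
  by apply: filterS2 (unfoldE u) (unfoldE v) => z /(_ Logic.I) hu /(_ Logic.I) hv.
apply: filterS3 huv (unfold_ae (Lspace_lincE a u v)) (Lspace_lincE a (unfold u) (unfold v)).
by move=> z [hu hv] /(_ Logic.I) h1 /(_ Logic.I) h2 _; rewrite h1 h2 /= hu hv.
Qed.

Lemma unfold_norm u : `|unfold u| = `|u|.
Proof.
rewrite (Lspace_norm_ae _ (unfoldE u)).
  by rewrite nm_shear//; exact: LspaceL.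
by have := Lfun_measurable (Lfun_shear c0 (@LspaceL _ _ _ mu p p1 u)).
Qed.

End fixed_scale.

Lemma unfoldK c c' (c0 : c != 0) (c0' : c' != 0) : c' = - c -> cancel (unfold c0) (unfold c0').
Proof.
move=> c'E u; apply: LspaceP; apply: filterS (unfold_ae c0' (unfoldE c0 u)) => z h _.
by rewrite h//=; congr (u _); have := shearK sys c' z; rewrite c'E opprK.
Qed.

(** [T] is composition with [shear (- eps^-1)]. The second clause is the change of variables by the
    opposite shear: weak convergence of an unfolded sequence becomes convergence of its pairings
    with oscillating test functions. *)
Lemma unfolding_exists (eps : R) : 0 < eps -> exists T : {linear Bspace P Q p1 -> Bspace P Q p1},
  is_unfolding tau eps T /\
  forall u f, bddm f -> pair (T u : B) f = \int[mu]_z (u z * f (S eps^-1 z)).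
Proof.
move=> e0; have c0 : - eps^-1 != 0 by rewrite oppr_eq0 invr_eq0 gt_eqF.
have c0' : - - eps^-1 != 0 by rewrite opprK invr_eq0 gt_eqF.
have c0'' : eps^-1 != 0 by rewrite invr_eq0 gt_eqF.
have bij : bijective (unfold c0).
  by exists (unfold c0'); apply: unfoldK; rewrite ?opprK.
have tens n (f : 'I_n -> Omega -> R) (g : 'I_n -> RdL R d -> R) (u : B) :
    (u : X -> R) = (fun z => \sum_(i < n) f i z.1 * g i z.2) %[ae mu] ->
    (unfold c0 u : X -> R) = (fun z => \sum_(i < n)
      f i (tau (- (eps^-1 *: (z.2 : 'rV[R]_d))) z.1) * g i z.2) %[ae mu].
  move=> uE; apply: filterS (unfold_ae c0 uE) => z h _.
  by rewrite h//=; apply: eq_bigr => i _; rewrite scaleNr.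
have dual u f : bddm f -> pair (unfold c0 u) f = \int[mu]_z (u z * f (S eps^-1 z)).
  move=> bf; have uL := LspaceL u.
  have mT := Lfun_measurable (Lfun_shear c0 uL).
  rewrite (pair_ae mT bf.1 (unfoldE c0 u)).
  rewrite -(Rintegral_shear Q sys c0'' (f := fun z => (u \o S (- eps^-1)) z * f z)).
    by apply: eq_Rintegral => z _ /=; rewrite (shearK sys).
  by apply: measurable_funM => //; exact: bf.1.
pose T : {linear B -> B} := HB.pack (unfold c0)
  (GRing.isLinear.Build R B B *:%R (unfold c0) (unfold_linear c0)).
(* [B] and [Bspace P Q p1] are convertible, but only as normed modules is this
   checked quickly. *)
pose N := {V : normedModType R & V -> B}.
pose V1 : N := existT _ (B : normedModType R) id.
pose V2 : N := existT _ (Bspace P Q p1 : normedModType R) id.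
have V12 : V1 = V2 by [].
pose H (V : N) := exists T : {linear projT1 V -> projT1 V},
  [/\ forall u : projT1 V, `|T u| = `|u|, bijective T &
    forall n (f : 'I_n -> Omega -> R) (g : 'I_n -> RdL R d -> R) (u : projT1 V),
      (forall i, f i \in Lfun P p%:E) ->
      (forall i, g i \in Lfun mQ p%:E) ->
      (projT2 V u : X -> R) = (fun z => \sum_(i < n) f i z.1 * g i z.2) %[ae mu] ->
      (projT2 V (T u) : X -> R) =
        (fun z => \sum_(i < n)
          f i (tau (- (eps^-1 *: (z.2 : 'rV[R]_d))) z.1) * g i z.2) %[ae mu]] /\
  forall (u : projT1 V) f, bddm f -> pair (projT2 V (T u)) f = \int[mu]_z (projT2 V u z * f (S eps^-1 z)).
suff : H V1 by rewrite V12.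
exists T; split; last exact: dual.
split; [exact: unfold_norm|exact: bij|].
by move=> n f g u _ _; exact: tens.
Qed.

Section realization.
Variables (eps : R) (f : X -> R).
Hypotheses (e0 : 0 < eps) (bf : bddm f).

Let c0 : eps^-1 != 0. Proof. by rewrite invr_eq0 gt_eqF. Qed.
Let bfs : bddm (f \o S eps^-1). Proof. exact: (bddm_shear sys). Qed.

Lemma bddm_Tstar w : bddm (fun x => Tstar tau eps f (w, x)).
Proof. exact: (bddm_section w bfs). Qed.

Lemma Tstar_integrable (u : X -> R) : u \in Lfun mu p%:E ->
  mu.-integrable setT (fun z => (u z * f (S eps^-1 z))%:E).
Proof. by move=> uL; apply: (hoelder_integrable p1 q1 pq) => //; apply: bddm_Lfun => //; exact: ltW. Qed.

Lemma measurable_Jeps (u : X -> R) : u \in Lfun mu p%:E ->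
  measurable_fun setT (fun w => Jeps tau Q eps w (fun x => u (w, x)) f).
Proof. by move=> /Tstar_integrable; exact: measurable_Rsection. Qed.

Lemma Jeps_integrable (u : X -> R) : u \in Lfun mu p%:E ->
  P.-integrable setT (fun w => (Jeps tau Q eps w (fun x => u (w, x)) f)%:E).
Proof. by move=> /Tstar_integrable; exact: integrable_Rsection. Qed.

Lemma Rintegral_Jeps (u : X -> R) : u \in Lfun mu p%:E ->
  \int[P]_w Jeps tau Q eps w (fun x => u (w, x)) f = \int[mu]_z (u z * f (S eps^-1 z)).
Proof. by move=> /Tstar_integrable; exact: Rintegral_prod. Qed.

Lemma Jeps_le w v : v \in Lfun mQ p%:E ->
  `|Jeps tau Q eps w v f| <= nm mQ p v * nm mQ q (fun x => Tstar tau eps f (w, x)).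
Proof.
move=> vL; apply: (hoelder_le p1 q1 pq) => //.
by apply: bddm_Lfun; [exact: ltW|exact: bddm_Tstar].
Qed.

Lemma Jeps_point_integrable w v : v \in Lfun mQ p%:E ->
  mQ.-integrable setT (fun x => (v x * Tstar tau eps f (w, x))%:E).
Proof.
move=> vL; apply: (hoelder_integrable p1 q1 pq) => //.
by apply: bddm_Lfun; [exact: ltW|exact: bddm_Tstar].
Qed.

End realization.

Lemma Jeps_lin eps w v (a : R) (f g : X -> R) : 0 < eps -> bddm f -> bddm g -> v \in Lfun mQ p%:E ->
  Jeps tau Q eps w v (fun z => a * f z + g z) = a * Jeps tau Q eps w v f + Jeps tau Q eps w v g.
Proof.
move=> e0 bf bg vL.
have If := Jeps_point_integrable e0 bf w vL; have Ig := Jeps_point_integrable e0 bg w vL.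
rewrite /Jeps -(@RintegralDZ _ _ _ mQ a)//.
by apply: eq_Rintegral => x _; rewrite /Tstar/=; ring.
Qed.

End unfolding.

(** * Construction of the Young measure *)

Section law.
Context d d' (T : measurableType d) (Y : measurableType d') (R : realType).
Local Notation I := (measurableTypeR R).
Variable V : T * I -> Y.
Hypothesis mV : measurable_fun setT V.

Lemma measurable_section w : measurable_fun setT (fun t : I => V (w, t)).
Proof. exact: measurableT_comp. Qed.

Definition lawf (w : T) : {mfun I >-> Y} := HB.pack_for {mfun I >-> Y} (fun t : I => V (w, t))
  (@isMeasurableFun.Build _ _ I Y (fun t : I => V (w, t)) (measurable_section w)).

Definition law (w : T) : {measure set Y -> \bar R} := distribution (@lam R) (lawf w).

Let measurable_law U : measurable U -> measurable_fun [set: T] (law ^~ U).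
Proof.
move=> mU.
have : measurable_fun setT (fun w => \int[@lam R]_t (\1_(V @^-1` U) (w, t))%:E)%E.
  apply: (@measurable_fun_fubini_tonelli_F _ _ _ _ _ (@lam R) (fun z => (\1_(V @^-1` U) z)%:E)).
  - apply/measurable_EFinP/measurable_indic.
    by rewrite -[X in measurable X]setTI; exact: mV.
  - by move=> z; rewrite lee_fin.
congr measurable_fun; apply/funext => w.
transitivity (@lam R ((fun t => V (w, t)) @^-1` U)) => //.
rewrite -[in RHS](setIT (_ @^-1` U)) -[RHS]integral_indic//.
by rewrite -[X in measurable X]setTI; exact: measurable_section.
Qed.

HB.instance Definition _ := isKernel.Build _ _ T Y R law measurable_law.

Let law_prob w : law w [set: Y] = 1%E.
Proof. by rewrite /law /= /distribution /pushforward preimage_setT lam_setT. Qed.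

HB.instance Definition _ := Kernel_isProbability.Build _ _ T Y R law law_prob.

Definition law_kernel : R.-pker T ~> Y := law.

Lemma law_integral w (F : Y -> \bar R) : measurable_fun setT F -> (forall y, 0 <= F y)%E ->
  (\int[law_kernel w]_y F y = \int[@lam R]_t F (V (w, t)))%E.
Proof.
move=> mF F0.
exact: (ge0_integral_distribution (lawf w)).
Qed.

Lemma law_Rintegral w (F : Y -> R) : measurable_fun setT F ->
  \int[law_kernel w]_y F y = \int[@lam R]_t F (V (w, t)).
Proof.
move=> mF; rewrite /Rintegral integralE [in RHS]integralE; congr (fine (_ - _)%E).
  rewrite law_integral//; last exact/measurable_funepos/measurable_EFinP.
  by apply: eq_integral => t _; rewrite !funeposE.
rewrite law_integral//; last exact/measurable_funeneg/measurable_EFinP.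
by apply: eq_integral => t _; rewrite !funenegE.
Qed.

Lemma law_ae w (A : set Y) : measurable A -> {ae @lam R, forall t, A (V (w, t))} ->
  {ae law_kernel w, forall y, A y}.
Proof.
move=> mA [N [mN N0 AN]]; exists (~` A); split; first exact: measurableC.
  apply/eqP; rewrite eq_le measure_ge0 andbT -N0.
  apply: (@le_trans _ _ (@lam R ((fun t => V (w, t)) @^-1` (~` A)))); first by [].
  apply: le_measure; rewrite ?inE//.
  by rewrite -[X in measurable X]setTI; apply: measurable_section => //; exact: measurableC.
by [].
Qed.

End law.

Section extraction.
Context dO (Omega : measurableType dO) (R : realType) (d : nat).
Variables (P : probability Omega R) (tau : 'rV[R]_d -> Omega -> Omega).
Variables (Q : bounded_open R d) (p q : R) (p1 : 1 < p).
Hypotheses (q1 : 1 < q) (pq : p^-1 + q^-1 = 1).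
Variables (DO : set (Omega -> R)) (DQ : set (RdL R d -> R)) (Omega0 : set Omega).
Hypothesis sys : ergodic_system P tau.
Hypothesis TF : test_families P Q DO DQ.
Hypothesis adm : admissible_points P tau Q p DO DQ Omega0.
Local Notation X := (Omega * RdL R d)%type.
Local Notation mQ := (lebesgue_on Q).
Local Notation mu := (prodfm P mQ).
Local Notation S := (shear tau).
Local Notation B := (LspaceType mu (EFin_ge1 p1)).
Local Notation M := (truncated (tensors DO DQ)).

Lemma test_space_M : test_space mu M.
Proof.
apply: test_space_truncated; [exact: tensors_countable TF|exact: tensors_bddm TF|].
exact: tensors_dense TF.
Qed.

Lemma M_nonempty : exists f, M f.
Proof.
exists (fun z => cst 1 z.1 * \1_(closure (Q : set 'rV[R]_d)) z.2); apply: sub_truncated.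
by exists (cst 1), \1_(closure (Q : set 'rV[R]_d)); split=> //; [exact: (testO_one TF)|exact: (testQ_one TF)].
Qed.

Lemma M_enum : exists m : nat -> X -> R, (forall n, M (m n)) /\ forall f, M f -> exists n, m n = f.
Proof. by have [f Mf] := M_nonempty; exact: countable_enum (ts_countable test_space_M) Mf. Qed.

Variable eps : nat -> R.
Hypothesis eps0 : forall k, 0 < eps k.
Hypothesis epsc : eps k @[k --> \oo] --> 0.
Variables (u : nat -> B) (C : R).
Hypothesis uC : forall k, `|u k| <= C.

Lemma half_cvg0 : (2^-1 : R) ^+ n @[n --> \oo] --> 0.
Proof. by apply: cvg_expr; rewrite ger0_norm// invf_lt1 ?ltr1n. Qed.

Lemma half_series : cvgn (series (fun n => (2^-1 : R) ^+ n)).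
Proof.
rewrite (_ : (fun n => _) = geometric 1 2^-1); last by apply/funext => n /=; rewrite mul1r.
by apply: is_cvg_geometric_series; rewrite ger0_norm// invf_lt1 ?ltr1n.
Qed.

Let q1w : 1 <= q := ltW q1.
Let q0 : 0 < q := lt_trans ltr01 q1.
Let c0 k : (eps k)^-1 != 0. Proof. by rewrite invr_eq0 gt_eqF. Qed.

Lemma pair_shear_le k f : bddm f -> `|\int[mu]_z (u k z * f (S (eps k)^-1 z))| <= C * nm mu q f.
Proof.
move=> bf; have fL := bddm_Lfun mu q1w bf.
have fsL := Lfun_shear q1 sys (c0 k) fL.
apply: le_trans (hoelder_le p1 q1 pq (LspaceL (u k)) fsL) _.
rewrite (nm_shear q1 sys (c0 k) fL); apply: ler_wpM2r; first exact: nm_ge0.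
by rewrite -Lspace_normE.
Qed.

Lemma subsequence_extraction : exists2 s : nat -> nat, {homo s : m n / (m < n)%N} &
  [/\ cvgn (fun k => `|u (s k)|),
      forall f, M f -> cvgn (fun k => \int[mu]_z (u (s k) z * f (S (eps (s k))^-1 z))) &
      {ae P, forall w, forall f, M f ->
         nm mQ q (fun x => Tstar tau (eps (s k)) f (w, x)) @[k --> \oo] --> nm mu q f}].
Proof.
have [m [Mm mM]] := M_enum.
have bm j : bddm (m j) := ts_bddm test_space_M (Mm j).
(* The mean ergodic theorem is applied to [|m j|^q], whose integrals over [Q] are the [q]-th powers
   of the norms in question. *)
pose psi j z := `|m j z| `^ q.
have bpsi j : bddm (psi j).
  have [mj [K jK]] := bm j; split; first exact: measurable_normpow.
  exists (`|K| `^ q) => z; rewrite ger0_norm ?powR_ge0//.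
  apply: ge0_ler_powR; rewrite ?nnegrE ?(ltW q0)//.
  exact: le_trans (jK z) (ler_norm _).
(* All bounded numerical sequences in one array: the norms at [j = 0], the pairing with [m j'] at
   [j = j'.+1]. *)
pose a k j := if j is j'.+1 then \int[mu]_z (u k z * m j' (S (eps k)^-1 z)) else `|u k|.
pose K j := if j is j'.+1 then C * nm mu q (m j') else C.
have aK k j : `|a k j| <= K j.
  by case: j => [|j]; [rewrite /a/= normr_id|exact: pair_shear_le].
have [x xP] := bounded_cluster aK.
pose er k j := \int[P]_w `|\int[mQ]_x psi j (S (eps k)^-1 (w, x)) - \int[mu]_z psi j z|.
have erc j : er k j @[k --> \oo] --> 0 by exact: (mean_ergodic sys TF adm eps0 epsc (bpsi j)).
have h0 n : 0 < (2^-1 : R) ^+ n by rewrite exprn_gt0.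
(* Smallness of the first ergodic errors and [k0 <= k] hold for all large [k]; closeness of the
   array to [x] is available along the cluster point. [bounded_cluster] provides one [k] with
   both. *)
have ex n k0 : exists2 k, (k0 <= k)%N & (forall j, (j <= n)%N -> er k j <= 2^-1 ^+ n) /\
    forall j, (j <= n)%N -> `|a k j - x j| <= 2^-1 ^+ n.
  have [] := xP n (fun k => (forall j, (j <= n)%N -> er k j <= 2^-1 ^+ n) /\ (k0 <= k)%N) _ _ (h0 n); last first.
    by move=> k [Ek k0k] kx; exists k.
  apply: filterI; last by exists k0.
  have : \forall k \near \oo, forall j : 'I_n.+1, er k j <= 2^-1 ^+ n.
    apply: filter_forall => j; have /cvgrPdist_le /(_ _ (h0 n)) := erc j.
    apply: filterS => k; rewrite sub0r normrN; apply: le_trans; exact: ler_norm.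
  by apply: filterS => k h j jn; exact: (h (Ordinal (jn : (j < n.+1)%N))).
have [s hs sP] := increasing_choice ex.
exists s => //.
have ac j : a (s n) j @[n --> \oo] --> x j.
  apply/cvgrPdist_le => e e0.
  have /cvgrPdist_le /(_ _ e0) [n0 _ n0P] := half_cvg0.
  exists (maxn n0 j) => // n /=; rewrite geq_max => /andP[n0n jn].
  rewrite distrC; apply: le_trans ((sP n).2 j jn) _.
  by have := n0P n n0n; rewrite sub0r normrN ger0_norm// ltW.
split.
- by apply/cvg_ex; exists (x 0%N); exact: (ac 0%N).
- by move=> f /mM[j <-]; apply/cvg_ex; exists (x j.+1); exact: (ac j.+1).
have : {ae P, forall w, forall j, nm mQ q (fun x => Tstar tau (eps (s k)) (m j) (w, x)) @[k --> \oo] --> nm mu q (m j)}.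
  apply: ae_foralln => j.
  (* Stage [n + j] controls the error of index [j] because [j <= n + j]; hence the shift. *)
  pose F n w := `|\int[mQ]_x psi j (S (eps (s (n + j)%N))^-1 (w, x)) - \int[mu]_z psi j z|.
  have ZI n : P.-integrable setT (fun w => (\int[mQ]_x psi j (S (eps (s (n + j)%N))^-1 (w, x)) - \int[mu]_z psi j z)%:E).
    have h : P.-integrable setT (fun w => (\int[mQ]_x psi j (S (eps (s (n + j)%N))^-1 (w, x)))%:E).
      apply: (@integrable_Rsection _ _ _ _ _ P mQ (psi j \o S (eps (s (n + j)%N))^-1)).
      by apply: bddm_integrable; exact: (bddm_shear sys).
    exact: (integrableB measurableT h (bddm_integrable P (@bddm_cst _ _ R (\int[mu]_z psi j z)))).
  have mF n : measurable_fun setT (F n).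
    apply: measurableT_comp => //; have /integrableP[/measurable_EFinP h _] := ZI n; exact: h.
  have Fb n : (\int[P]_w (F n w)%:E <= (2^-1 ^+ n)%:E)%E.
    have /integrable_fin_num := integrable_norm (ZI n) => /(_ measurableT) /fineK <-.
    rewrite lee_fin; apply: le_trans ((sP (n + j)%N).1 j (leq_addl _ _)) _.
    by rewrite exprD ler_piMr// ?exprn_ge0// exprn_ile1// invf_le1 ?ler1n.
  have := ae_cvg0_summable mF (fun n w => normr_ge0 _) Fb half_series.
  apply: filterS => w Fc.
  have {}Fc : \int[mQ]_x psi j (S (eps (s n))^-1 (w, x)) @[n --> \oo] --> \int[mu]_z psi j z.
    rewrite -(cvg_shiftn j); apply/subr_cvg0; apply/norm_cvg0P; exact: Fc.
  have nE n : nm mQ q (fun x => Tstar tau (eps (s n)) (m j) (w, x)) =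
      (\int[mQ]_x psi j (S (eps (s n))^-1 (w, x))) `^ q^-1.
    rewrite -(@nm_pow _ _ _ mQ q (fun x => Tstar tau (eps (s n)) (m j) (w, x)))//; last first.
      exact: (bddm_Lfun mQ q1w (bddm_Tstar sys (eps0 (s n)) (bm j) w)).
    by rewrite -powRrM mulfV ?gt_eqF// powRr1// nm_ge0.
  have -> : nm mu q (m j) = (\int[mu]_z psi j z) `^ q^-1.
    by rewrite -nm_pow//; [rewrite -powRrM mulfV ?gt_eqF// powRr1// nm_ge0|exact: bddm_Lfun].
  under eq_fun do rewrite nE.
  apply: cvg_powR => //; first by rewrite invr_gt0.
  by move=> n; apply: Rintegral_ge0 => y _; exact: powR_ge0.
by apply: filterS => w h f /mM[j <-].
Qed.

End extraction.

Section liminf.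
Context (R : realType).

Lemma limn_einf_lt (x : nat -> \bar R) (r : \bar R) : (limn_einf x < r)%E ->
  forall m, exists2 n, (m <= n)%N & (x n < r)%E.
Proof.
move=> xr m; have : (einfs x m < r)%E.
  apply: le_lt_trans xr; rewrite limn_einf_lim.
  by rewrite (cvg_lim (@ereal_hausdorff R) (@cvg_einfs_sup _ x)); apply: ereal_sup_ubound; exists m.
by move=> /ereal_inf_lt[_ [n /= mn <-] xn]; exists n.
Qed.

Lemma limn_einf_ge (x : nat -> \bar R) (l : \bar R) : (forall n, (l <= x n)%E) -> (l <= limn_einf x)%E.
Proof.
move=> lx; rewrite limn_einf_lim; apply: lime_ge; first exact: is_cvg_einfs.
by apply: nearW => n; apply: le_ereal_inf_tmp => _ [m /= _ <-].
Qed.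

Lemma limn_einf_le (x : nat -> \bar R) (l : \bar R) : (forall n, (x n <= l)%E) -> (limn_einf x <= l)%E.
Proof.
move=> lx; rewrite limn_einf_lim; apply: lime_le; first exact: is_cvg_einfs.
by apply: nearW => n; apply: le_trans (lx n); apply: ereal_inf_lbound; exists n => /=.
Qed.

Lemma cvg_index (T : topologicalType) (u : nat -> T) (l : T) (s : nat -> nat) :
  (forall n, (n <= s n)%N) -> u n @[n --> \oo] --> l -> u (s n) @[n --> \oo] --> l.
Proof.
move=> hs cu; apply: (cvg_comp s u _ cu) => A [N _ NA].
by exists N => // n /= Nn; apply: NA; apply: leq_trans Nn (hs n).
Qed.

End liminf.

Lemma ae_measurable_subset d (T : measurableType d) (R : realType) (mu : {measure set T -> \bar R})
    (A : set T) : {ae mu, forall x, A x} ->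
  exists2 G, measurable G & mu (~` G) = 0%E /\ G `<=` A.
Proof.
move=> [N [mN N0 AN]]; exists (~` N); first exact: measurableC.
by split=> [|x nN]; [rewrite setCK|apply: contrapT => /AN].
Qed.

Section ae_fst.
Context d1 d2 (T1 : measurableType d1) (T2 : measurableType d2) (R : realType).
Variables (m1 : {finite_measure set T1 -> \bar R}) (m2 : {finite_measure set T2 -> \bar R}).

Lemma ae_fst (A : set T1) : {ae m1, forall x, A x} -> {ae (m1 \x m2)%E, forall z, A z.1}.
Proof.
move=> [N [mN N0 AN]]; exists (N `*` setT); split.
- exact: measurableX.
- have := product_measure1E m1 m2 mN measurableT.
  by rewrite [X in _ = X](_ : _ = 0%E)//; apply/eqP; rewrite mule_eq0; apply/orP; left; apply/eqP.
- by move=> z /= nA; split=> //; exact: AN.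
Qed.

End ae_fst.

Section random_index_integral.
Context d (T : measurableType d) (R : realType) (P : probability T R).
Local Notation I := (measurableTypeR R).
Variables (N : nat -> nat) (a : nat -> nat -> R) (kap : nat -> T * I -> nat).
Hypothesis wa : forall n, convex_weights n (N n) (a n).
Hypothesis law : forall n w (F : nat -> \bar R), (forall k, 0 <= F k)%E ->
  (\int[@lam R]_t F (kap n (w, t)) = \sum_(k < N n) (a n k)%:E * F k)%E.
Hypothesis mkap : forall n k, measurable [set x | kap n x = k].

Lemma random_index_integral n (h : nat -> T -> \bar R) :
  (forall k w, 0 <= h k w)%E -> (forall k, measurable_fun setT (h k)) ->
  (\int[(P \x @lam R)%E]_z h (kap n z) z.1 = \sum_(k < N n) (a n k)%:E * \int[P]_w h k w)%E.
Proof.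
move=> h0 mh; have [a0 _ _ _] := wa n.
rewrite fubini_tonelli1//; first last.
  apply: (measurable_index (mkap n) (f := fun k z => h k z.1)) => k; exact: measurableT_comp.
under eq_integral do rewrite /fubini_F/= (law n _ (F := h ^~ _))//.
rewrite ge0_integral_sum//; last first.
- by move=> k w _; rewrite mule_ge0// lee_fin.
- by move=> k; apply: emeasurable_funM.
by apply: eq_bigr => k _; rewrite ge0_integralZl_EFin.
Qed.

End random_index_integral.

Section random_limit.
Context dO (Omega : measurableType dO) (R : realType) (d : nat).
Variables (P : probability Omega R) (tau : 'rV[R]_d -> Omega -> Omega).
Variables (Q : bounded_open R d) (p q : R) (p1 : 1 < p).
Hypotheses (q1 : 1 < q) (pq : p^-1 + q^-1 = 1).
Hypothesis sys : ergodic_system P tau.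
Local Notation X := (Omega * RdL R d)%type.
Local Notation mQ := (lebesgue_on Q).
Local Notation mu := (prodfm P mQ).
Local Notation S := (shear tau).
Local Notation B := (LspaceType mu (EFin_ge1 p1)).
Local Notation I := (measurableTypeR R).
Variable M : set (X -> R).
Hypothesis MT : test_space mu M.

(* Setting everything to [0] outside [G] makes the conclusions valid at every
   [w], and not only almost everywhere. *)
Record random_limit (eps : nat -> R) (u : nat -> B) (G : set Omega) (v : nat -> X -> R)
    (N : nat -> nat) (a : nat -> nat -> R) (kap : nat -> Omega * I -> nat)
    (V : Omega * I -> B) : Prop := {
  rl_mG : measurable G;
  rl_G : P (~` G) = 0%E;
  rl_measurable : forall k, measurable_fun setT (v k);
  rl_section : forall k w, (fun x => v k (w, x)) \in Lfun mQ p%:E;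
  rl_ae : forall k, (u k : X -> R) = v k %[ae mu];
  rl_v0 : forall k w x, ~ G w -> v k (w, x) = 0;
  rl_weights : forall n, convex_weights n (N n) (a n);
  rl_mkap : forall n k, measurable [set x | kap n x = k];
  rl_kap : forall n x, (n <= kap n x)%N;
  rl_law : forall n w (F : nat -> \bar R), (forall k, 0 <= F k)%E ->
    (\int[@lam R]_t F (kap n (w, t)) = \sum_(k < N n) (a n k)%:E * F k)%E;
  rl_mV : forall f, M f -> measurable_fun setT (fun z => pair (V z) f);
  rl_V0 : forall w t, ~ G w -> V (w, t) = 0;
  rl_lim : forall w, G w -> {ae @lam R, forall t,
    ((`|V (w, t)| `^ p)%:E <=
      limn_einf (fun n => (nm mQ p (fun x => v (kap n (w, t)) (w, x)) `^ p)%:E))%E /\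
    forall f, M f ->
      Jeps tau Q (eps (kap n (w, t))) w (fun x => v (kap n (w, t)) (w, x)) f
        @[n --> \oo] --> pair (V (w, t)) f} }.

Variables (eps : nat -> R) (u : nat -> B) (C : R) (Omega0 : set Omega).
Hypothesis eps0 : forall k, 0 < eps k.
Hypothesis uC : forall k, `|u k| <= C.
Hypothesis M0 : exists f, M f.
Hypothesis norm_cvg : {ae P, forall w, forall f, M f ->
  nm mQ q (fun x => Tstar tau (eps k) f (w, x)) @[k --> \oo] --> nm mu q f}.

Let p0 : 0 < p := lt_trans ltr01 p1.
Let p1w : 1 <= p := ltW p1.

Let cut (G : set Omega) k (z : X) : R := \1_G z.1 * u k z.

Let cut_in G k w : G w -> (fun x => cut G k (w, x)) = fun x => u k (w, x).
Proof. by move=> Gw; apply/funext => x; rewrite /cut indicE mem_set// mul1r. Qed.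

Let cut_out G k w x : ~ G w -> cut G k (w, x) = 0.
Proof. by move=> Gw; rewrite /cut indicE memNset// mul0r. Qed.

Let measurable_cut G k : measurable G -> measurable_fun setT (cut G k).
Proof.
move=> mG; apply: measurable_funM; last exact: measurable_Lspace.
by apply: measurableT_comp => //; exact: measurable_indic.
Qed.

Let cut_ae G k : P (~` G) = 0%E -> measurable G -> (u k : X -> R) = cut G k %[ae mu].
Proof.
move=> PG mG; have : {ae P, forall w, G w} by exists (~` G); split => //; exact: measurableC.
move=> /(ae_fst mQ); apply: filterS => -[w x] /= Gw _.
by rewrite /cut indicE mem_set// mul1r.
Qed.

(* On the good set the norms of the test functions converge, so that the
   limiting functional is bounded by the lower limit of the norms. *)
Let limit_point (w : Omega) (l : R) (k : nat -> nat) (v : nat -> RdL R d -> R) :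
  (forall n, (n <= k n)%N) -> (forall n, v n \in Lfun mQ p%:E) ->
  (forall f, M f -> nm mQ q (fun x => Tstar tau (eps k) f (w, x)) @[k --> \oo] --> nm mu q f) ->
  limn_einf (fun n => (nm mQ p (v n) `^ p)%:E) = l%:E ->
  (forall f, M f -> cvgn (fun n => Jeps tau Q (eps (k n)) w (v n) f)) ->
  exists V : B, `|V| `^ p <= l /\
    forall f, M f -> Jeps tau Q (eps (k n)) w (v n) f @[n --> \oo] --> pair V f.
Proof.
move=> nk vL Tc Ll Jc.
have l0 : 0 <= l by rewrite -lee_fin -Ll; apply: limn_einf_ge => n; rewrite lee_fin powR_ge0.
pose J f n := Jeps tau Q (eps (k n)) w (v n) f.
have JL f g c : M f -> M g -> limn (J (fun z => c * f z + g z)) = c * limn (J f) + limn (J g).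
  move=> Mf Mg; apply: cvg_lim => //.
  rewrite (_ : J _ = fun n => c * J f n + J g n).
    by apply: cvgD; [apply: cvgMr; exact: Jc|exact: Jc].
  apply/funext => n; exact: (Jeps_lin p1 q1 pq sys w c (eps0 _) (ts_bddm MT Mf) (ts_bddm MT Mg) (vL n)).
(* Along a subsequence the [p]-th powers of the norms fall below [r n], which decreases to the lower
   limit [l]. Hoelder's inequality then bounds the limiting functional by [l^(1/p)] times the
   norm. *)
pose r n : R := l + 2^-1 ^+ n.
have lr n : (limn_einf (fun n => (nm mQ p (v n) `^ p)%:E) < (r n)%:E)%E.
  by rewrite Ll lte_fin ltrDl exprn_gt0.
have [s hs sP] := increasing_choice (fun n => limn_einf_lt (lr n)).
have Ub f : M f -> `|limn (J f)| <= l `^ p^-1 * nm mu q f.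
  move=> Mf; have h1 : `|J f (s n)| @[n --> \oo] --> `|limn (J f)|.
    apply: cvg_norm; exact: cvg_subseq_homo (Jc f Mf).
  have h2 : r n `^ p^-1 * nm mQ q (fun x => Tstar tau (eps (k (s n))) f (w, x)) @[n --> \oo]
      --> l `^ p^-1 * nm mu q f.
    apply: cvgM.
      apply: cvg_powR; first by rewrite invr_gt0.
        by move=> n; rewrite addr_ge0// exprn_ge0.
      rewrite -[X in _ --> X]addr0; apply: cvgD; [exact: cvg_cst|exact: half_cvg0].
    apply: (cvg_index (u := fun k => nm mQ q (fun x => Tstar tau (eps k) f (w, x)))); last exact: Tc.
    by move=> n; apply: leq_trans (nk _); exact: homo_ge_id.
  apply: (ler_cvg_to h1 h2); apply: nearW => n.
  apply: le_trans (Jeps_le p1 q1 pq sys (eps0 _) (ts_bddm MT Mf) w (vL (s n))) _.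
  apply: ler_wpM2r; first exact: nm_ge0.
  rewrite -[leLHS](@powRr1 R)// ?nm_ge0// -(@mulfV _ p) ?gt_eqF// powRrM.
  apply: ge0_ler_powR; rewrite ?nnegrE ?powR_ge0 ?invr_ge0 ?(ltW p0)//.
    by rewrite addr_ge0// exprn_ge0.
  by have := sP n; rewrite lte_fin => /ltW.
have M00 : M (fun=> 0).
  have [f Mf] := M0; rewrite (_ : (fun=> 0) = fun z => ratr 0 * f z); first exact: (ts_scale MT).
  by apply/funext => z; rewrite rmorph0 mul0r.
have J0' : limn (J (fun=> 0)) = 0.
  have -> : J (fun=> 0) = fun=> 0.
    by apply/funext => n; rewrite /J /Jeps /Tstar/=; under eq_Rintegral do rewrite mulr0; rewrite /Rintegral integral0.
  by apply: cvg_lim => //; exact: cvg_cst.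
have UD f g : M f -> M g -> limn (J (fun z => f z + g z)) = limn (J f) + limn (J g).
  move=> Mf Mg; rewrite -{1}[limn (J f)]mul1r -JL//; congr (limn (J _)).
  by apply/funext => z; rewrite mul1r.
have UZ (c : rat) f : M f -> limn (J (fun z => ratr c * f z)) = ratr c * limn (J f).
  move=> Mf; rewrite -[RHS]addr0 -J0' -JL//; congr (limn (J _)).
  by apply/funext => z; rewrite addr0.
have [V [VC VU]] := riesz_Lspace p1 q1 pq MT (powR_ge0 _ _) UD UZ Ub.
exists V; split; last by move=> f Mf; rewrite VU//; exact: Jc.
rewrite -[leRHS](@powRr1 R)// -(@mulVf _ p) ?gt_eqF// powRrM.
by apply: ge0_ler_powR; rewrite ?nnegrE ?powR_ge0 ?(ltW p0).
Qed.

Lemma random_limit_exists : exists G v N a kap V, random_limit eps u G v N a kap V.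
Proof.
have [m [Mm mM]] : exists m : nat -> X -> R, (forall n, M (m n)) /\ forall f, M f -> exists n, m n = f.
  by have [f Mf] := M0; exact: countable_enum (ts_countable MT) Mf.
have uL k : (u k : X -> R) \in Lfun mu p%:E by exact: LspaceL.
have uS : {ae P, forall w, forall k, (fun x => u k (w, x)) \in Lfun mQ p%:E}.
  by apply: ae_foralln => k; exact: (Lfun_section p1w (uL k)).
have [G0 mG0 [PG0 GP]] := ae_measurable_subset (filterI uS norm_cvg).
have cutL G k : measurable G -> cut G k \in Lfun mu p%:E.
  move=> mG; apply: Lfun_pow => //; first exact: measurable_cut.
  have := Lfun_integrable p1w (uL k) => /integrableP[_]; apply: le_lt_trans.
  apply: ge0_le_integral => //.
  - by apply/measurable_EFinP/measurable_normpow; exact: measurable_cut.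
  - by apply: measurableT_comp => //; apply/measurable_EFinP/measurable_normpow; exact: Lfun_measurable (uL k).
  - move=> z _; rewrite lee_fin (ger0_norm (powR_ge0 _ _)).
    apply: ge0_ler_powR; rewrite ?nnegrE ?(ltW p0)//.
    rewrite /cut indicE normrM; case: (_ \in _); first by rewrite normr1 mul1r.
    by rewrite normr0 mul0r.
have cutS G k w : G `<=` G0 -> (fun x => cut G k (w, x)) \in Lfun mQ p%:E.
  move=> GG; have [Gw|Gw] := pselect (G w); first by rewrite cut_in//; exact: (GP w (GG w Gw)).1.
  rewrite (_ : (fun x => _) = cst 0); first by apply: bddm_Lfun => //; exact: (@bddm_cst _ _ R 0).
  by apply/funext => x; rewrite cut_out.
pose y k j w := Jeps tau Q (eps k) w (fun x => cut G0 k (w, x)) (m j).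
have my k j : measurable_fun setT (y k j).
  exact: (measurable_Jeps p1 q1 pq sys (eps0 k) (ts_bddm MT (Mm j)) (cutL G0 k mG0)).
have [N [a [kap [wa mkap nkap law aecvg]]]] := random_index_multi P my.
pose np k w := nm mQ p (fun x => cut G0 k (w, x)) `^ p.
have mnp k : measurable_fun setT (np k).
  apply: (measurable_nm_section (m2 := mQ) p1w (f := cut G0 k)); last exact: measurable_cut.
  by move=> w; exact: cutS.
pose L (z : Omega * I) := limn_einf (fun n => (np (kap n z) z.1)%:E).
have mnk n : measurable_fun setT (fun z : Omega * I => (np (kap n z) z.1)%:E).
  apply/measurable_EFinP.
  by apply: (measurable_index (mkap n) (f := fun k z => np k z.1)) => k; exact: measurableT_comp.
have mL : measurable_fun setT L by exact: measurable_limn_einf.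
have L0 z : (0 <= L z)%E by apply: limn_einf_ge => n; rewrite lee_fin powR_ge0.
have npC k : (\int[P]_w (np k w)%:E <= (C `^ p)%:E)%E.
  rewrite (nm_section_int P (m2 := mQ) p1w (f := cut G0 k)); last 2 first.
  - by move=> w; exact: cutS.
  - exact: measurable_cut.
  rewrite LnormE; [|exact: cutL|exact: p1w].
  rewrite lee_fin; apply: ge0_ler_powR; rewrite ?nnegrE ?nm_ge0 ?(ltW p0)//.
    exact: le_trans (normr_ge0 _) (uC 0%N).
  by rewrite -(Lspace_norm_ae (measurable_cut k mG0) (cut_ae k PG0 mG0)).
(* By Fatou's lemma the integral of [L] is at most [C^p]: for each [n], averaging over [kap n] gives
   a convex combination of integrals that do not exceed [C^p]. *)
have Llty : {ae (P \x @lam R)%E, forall z, (L z < +oo)%E}.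
  have : (P \x @lam R)%E.-integrable setT L.
    apply/integrableP; split=> //.
    apply: (@le_lt_trans _ _ (C `^ p)%:E); last exact: ltry.
    rewrite (eq_integral L); last by move=> z _; rewrite gee0_abs.
    apply: le_trans (fatou _ measurableT (f := fun n z => (np (kap n z) z.1)%:E) _ _) _.
    - exact: mnk.
    - by move=> n z _; rewrite lee_fin powR_ge0.
    apply: limn_einf_le => n.
    have np0 k w : (0 <= (np k w)%:E)%E by rewrite lee_fin powR_ge0.
    have mnp' k : measurable_fun setT (fun w => (np k w)%:E) by exact/measurable_EFinP.
    rewrite (random_index_integral P wa law mkap n np0 mnp').
    have [a0 _ _ a1] := wa n.
    apply: (@le_trans _ _ (\sum_(k < N n) (a n k)%:E * (C `^ p)%:E)%E).
      by apply: lee_sum => k _; apply: lee_pmul => //; rewrite ?lee_fin//; apply: integral_ge0 => w _; rewrite lee_fin powR_ge0.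
    rewrite -ge0_sume_distrl; last by move=> k _; rewrite lee_fin.
    by rewrite sumEFin a1 mul1e.
  move=> /(integrable_ae measurableT); apply: filterS => z /(_ Logic.I).
  by move=> /fin_numPlt/andP[].
pose H (z : Omega * I) := [/\ G0 z.1, (L z < +oo)%E & forall j, cvgn (fun n => y (kap n z) j z.1)].
have mH : measurable H.
  rewrite (_ : H = (fst @^-1` G0) `&` (L @^-1` (~` [set +oo%E])) `&` \bigcap_j [set z | cvgn (fun n => y (kap n z) j z.1)]).
    apply: measurableI; first apply: measurableI.
    - by rewrite -[X in measurable X]setTI; apply: measurable_fst.
    - by rewrite -[X in measurable X]setTI; apply: mL => //; exact: measurableC (emeasurable_set1 _).
    apply: bigcap_measurable => // j _.
    apply: (measurable_cvgn (f := fun n z => y (kap n z) j z.1)) => n.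
    by apply: (measurable_index (mkap n) (f := fun k z => y k j z.1)) => k; exact: measurableT_comp.
  apply/seteqP; split=> z.
    move=> [h1 h2 h3]; split; [split=> //= Lz|by move=> j _; exact: h3].
    by move: h2; rewrite Lz.
  move=> [[/= h1 h2] h3]; split=> //; last by move=> j; exact: h3.
  by rewrite ltey; apply/eqP.
have aeG : {ae P, forall w, G0 w} by exists (~` G0); split => //; exact: measurableC.
have aeH : {ae P, forall w, {ae @lam R, forall t, H (w, t)}}.
  apply: filterS (filterI (filterI aeG (ae_prod Llty)) aecvg) => w [[Gw hL] hc].
  apply: (@filterS2 _ _ (lam_ae_filter R) _ _ _ _ hL hc) => t Lt ct.
  split=> // j.
  (* Convergence of the pairings is granted only if they return infinitely often to a bounded set.
     They do: infinitely often the norm of the realization obeys a bound coming from the finite [L],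
     and the norms of the test function are bounded in [k]. *)
  have [Bj BjP] : exists K : R, forall k, nm mQ q (fun x => Tstar tau (eps k) (m j) (w, x)) <= K.
    have cT : cvgn (fun k => nm mQ q (fun x => Tstar tau (eps k) (m j) (w, x))).
      by apply/cvg_ex; exists (nm mu q (m j)); exact: ((GP w Gw).2 _ (Mm j)).
    have [K [_ KP]] := cvg_seq_bounded cT; exists (K + 1) => k.
    by apply: le_trans (ler_norm _) (KP (K + 1) _ k Logic.I); rewrite ltrDl.
  have [r Lr] : exists r : R, (L (w, t) < r%:E)%E.
    by exists (fine (L (w, t)) + 1); rewrite EFinD fineK ?ge0_fin_numE// lteDl// ?lte01// ge0_fin_numE.
  apply: (ct j (r `^ p^-1 * Bj)) => n0.
  have [n n0n nr] := limn_einf_lt Lr n0; exists n => //.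
  apply: le_trans (Jeps_le p1 q1 pq sys (eps0 _) (ts_bddm MT (Mm j)) w (cutS _ _ w (fun _ h => h))) _.
  apply: ler_pM; rewrite ?nm_ge0//.
  rewrite -[leLHS](@powRr1 R)// ?nm_ge0// -(@mulfV _ p) ?gt_eqF// powRrM.
  move: nr; rewrite lte_fin => /ltW nr.
  have np0 : 0 <= np (kap n (w, t)) w by exact: powR_ge0.
  by apply: ge0_ler_powR; rewrite ?nnegrE ?invr_ge0 ?(ltW p0)// (le_trans np0).
(* [G0] is shrunk to points at which almost every [t] is good; the realizations and [V] are set to 0
   outside this smaller set. *)
have [G mG [PG GP']] := ae_measurable_subset (filterI aeG aeH).
have GG0 : G `<=` G0 by move=> w /GP'[].
pose H' (z : Omega * I) := H z /\ G z.1.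
have mH' : measurable H'.
  by apply: measurableI => //; rewrite -[X in measurable X]setTI; apply: measurable_fst.
(* The value 0 outside the measurable set [H'] makes each pairing with [V] a limit of measurable
   functions at every point. *)
have VP z : exists V : B, (H' z -> ((`|V| `^ p)%:E <= L z)%E /\
    forall f, M f -> Jeps tau Q (eps (kap n z)) z.1 (fun x => cut G0 (kap n z) (z.1, x)) f @[n --> \oo] --> pair V f) /\
    (~ H' z -> V = 0).
  have [[[Gz Lz cz] G1z]|nH] := pselect (H' z); last by exists 0.
  have Lfin : L z = (fine (L z))%:E by rewrite fineK// ge0_fin_numE.
  have [|V [V1 V2]] := limit_point (w := z.1) (nkap^~ z) (fun n => cutS _ (kap n z) z.1 (fun _ h => h)) (GP _ Gz).2 Lfin.
    by move=> f /mM[j <-]; exact: cz.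
  exists V; split; last by move=> nH; exfalso; apply: nH.
  by move=> _; split=> //; rewrite Lfin lee_fin.
have [V VE] := choice VP.
exists G, (cut G), N, a, kap, V; split=> //.
- by move=> k; exact: measurable_cut.
- by move=> k w; exact: cutS.
- by move=> k; exact: cut_ae.
- by move=> k w x; exact: cut_out.
- move=> f /[dup] Mf /mM[j fj].
  apply: (measurable_fun_cvg (h := fun n z => \1_H' z * y (kap n z) j z.1)).
    move=> n; apply: measurable_funM; first exact: measurable_indic.
    by apply: (measurable_index (mkap n) (f := fun k z => y k j z.1)) => k; exact: measurableT_comp.
  move=> z _; have [hz|hz] := pselect (H' z).
    under eq_fun do rewrite indicE mem_set// mul1r.
    by rewrite -fj; apply: ((VE z).1 hz).2; exact: Mm.
  under eq_fun do rewrite indicE memNset// mul0r.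
  have fL := bddm_Lfun mu (ltW q1) (ts_bddm MT Mf).
  by rewrite (VE z).2// (pair0 p1 q1 pq fL); exact: cvg_cst.
- by move=> w t Gw; apply: (VE (w, t)).2 => -[].
- move=> w Gw; apply: filterS (GP' w Gw).2 => t Ht.
  have [h1 h2] := (VE (w, t)).1 (conj Ht Gw).
  have cutE k : (fun x => cut G k (w, x)) = (fun x => cut G0 k (w, x)).
    by rewrite !cut_in//; exact: GG0.
  split.
    rewrite (_ : (fun n => _) = fun n => (np (kap n (w, t)) w)%:E)//.
    by apply/funext => n; rewrite cutE.
  move=> f Mf; under eq_fun do rewrite cutE.
  exact: h2.
Qed.

End random_limit.

(** The bound depends on [f] only through a bound for its values, hence is uniform over the sections
    of an oscillating test function in [mean_cvg]. *)
Lemma nm_bounded d (T : measurableType d) (R : realType) (mu : {finite_measure set T -> \bar R})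
    (r K : R) (f : T -> R) : 1 <= r -> measurable_fun setT f -> (forall x, `|f x| <= K) ->
  nm mu r f <= (K `^ r * fine (mu setT)) `^ r^-1.
Proof.
move=> r1 mf fK; have r0 : 0 < r := lt_le_trans ltr01 r1.
have bf : bddm f by split => //; exists K.
rewrite -[leLHS]powRr1 ?nm_ge0// -(@mulfV _ r) ?gt_eqF// powRrM.
have K0 : 0 <= K := le_trans (normr_ge0 _) (fK point).
apply: ge0_ler_powR; rewrite ?nnegrE ?powR_ge0 ?invr_ge0 ?(ltW r0)//.
  by rewrite mulr_ge0 ?powR_ge0 ?fine_ge0.
rewrite nm_pow//; last exact: bddm_Lfun.
rewrite -Rintegral_cst//; apply: le_Rintegral => //.
- exact: (Lfun_integrable r1 (bddm_Lfun mu r1 bf)).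
- exact: (bddm_integrable mu (@bddm_cst _ _ R _)).
- by move=> x _; apply: ge0_ler_powR; rewrite ?nnegrE ?(ltW r0).
Qed.

Lemma measurable_cvg_to d (T : measurableType d) (R : realType) (f : nat -> T -> R) (g : T -> R) :
  (forall n, measurable_fun setT (f n)) -> measurable_fun setT g ->
  measurable [set x | f n x @[n --> \oo] --> g x].
Proof.
move=> mf mg.
rewrite (_ : [set x | _] = \bigcap_m \bigcup_N \bigcap_n
   [set x | `|f (N + n)%N x - g x| <= m.+1%:R^-1]).
  apply: bigcap_measurable => // m _; apply: bigcup_measurable => N _.
  apply: bigcap_measurable => // n _.
  rewrite -[X in measurable X]setTI.
  apply: (@measurable_fun_le _ _ _ _ (fun x => `|f (N + n)%N x - g x|) (cst m.+1%:R^-1)) => //.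
  by apply: measurableT_comp => //; exact: measurable_funB.
apply/seteqP; split=> x.
  move=> /= /cvgrPdist_le cx m _.
  have [N _ NP] := cx m.+1%:R^-1 ltac:(by rewrite invr_gt0).
  by exists N => // n _ /=; rewrite distrC; apply: NP => /=; exact: leq_addr.
move=> H; apply/cvgrPdist_le => e e0.
have [m _ /(_ m (leqnn m)) /= me] := near_infty_natSinv_lt (PosNum e0).
have [N _ NP] := H m Logic.I; exists N => // n /= Nn.
by have := NP (n - N)%N Logic.I; rewrite /= subnKC// distrC => /le_trans; apply; exact: ltW.
Qed.

(** The converse of [ae_prod]; measurability of [A] lets the measure of its complement be computed
    from the sections. *)
Lemma ae_prod_measurable d1 d2 (T1 : measurableType d1) (T2 : measurableType d2) (R : realType)
    (m1 : {finite_measure set T1 -> \bar R}) (m2 : {finite_measure set T2 -> \bar R}) (A : set (T1 * T2)) :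
  measurable A -> {ae m1, forall x, {ae m2, forall y, A (x, y)}} -> {ae (m1 \x m2)%E, forall z, A z}.
Proof.
move=> mA aeA; exists (~` A); split => //; first exact: measurableC.
rewrite /product_measure1 /=.
transitivity (\int[m1]_x (cst 0%E x))%E; last by rewrite integral0.
apply: ae_eq_integral => //.
- by apply: measurable_fun_xsection; exact: measurableC.
- apply: filterS aeA => x [N [mN N0 AN]] _ /=.
  apply/eqP; rewrite eq_le measure_ge0 andbT -N0.
  apply: le_measure; rewrite ?inE//.
    by apply: measurable_xsection; exact: measurableC.
  by move=> y; rewrite /xsection/= inE => nA; exact: AN.
Qed.

Section random_index_Rintegral.
Context d (T : measurableType d) (R : realType) (P : probability T R).
Local Notation I := (measurableTypeR R).
Variables (N : nat -> nat) (a : nat -> nat -> R) (kap : nat -> T * I -> nat).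
Hypothesis wa : forall n, convex_weights n (N n) (a n).
Hypothesis law : forall n w (F : nat -> \bar R), (forall k, 0 <= F k)%E ->
  (\int[@lam R]_t F (kap n (w, t)) = \sum_(k < N n) (a n k)%:E * F k)%E.
Hypothesis mkap : forall n k, measurable [set x | kap n x = k].

(** The law of [kap n] is given for nonnegative functions, hence the splitting into positive and
    negative parts. *)
Lemma random_index_Rintegral n (h : nat -> T -> R) :
  (forall k, P.-integrable setT (EFin \o h k)) ->
  \int[prodfm P (@lam R)]_z h (kap n z) z.1 = \sum_(k < N n) a n k * \int[P]_w h k w.
Proof.
move=> hi.
have mh k : measurable_fun setT (EFin \o h k) by have /integrableP[] := hi k.
have fp k : (\int[P]_w (EFin \o h k)^\+ w)%E \is a fin_num.
  exact: integrable_pos_fin_num.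
have fn k : (\int[P]_w (EFin \o h k)^\- w)%E \is a fin_num.
  exact: integrable_neg_fin_num.
transitivity (fine (\sum_(k < N n) (a n k)%:E * (\int[P]_w (EFin \o h k)^\+ w)
    - \sum_(k < N n) (a n k)%:E * (\int[P]_w (EFin \o h k)^\- w))%E).
  rewrite -(random_index_integral P wa law mkap n (fun k => funepos_ge0 (EFin \o h k)) (fun k => measurable_funepos (mh k))).
  rewrite -(random_index_integral P wa law mkap n (fun k => funeneg_ge0 (EFin \o h k)) (fun k => measurable_funeneg (mh k))).
  rewrite /Rintegral integralE; congr (fine (_ - _)%E); apply: eq_integral => z _.
    by rewrite !funeposE.
  by rewrite !funenegE.
transitivity (fine (\sum_(k < N n) (a n k * fine (\int[P]_w (EFin \o h k)^\+ w))%:E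
    - \sum_(k < N n) (a n k * fine (\int[P]_w (EFin \o h k)^\- w))%:E)%E).
  congr (fine (_ - _)%E); apply: eq_bigr => k _; rewrite EFinM fineK//.
rewrite !sumEFin -EFinB /= -sumrB; apply: eq_bigr => k _.
rewrite -mulrBr -fineB//; congr (_ * _).
by rewrite /Rintegral [in RHS]integralE.
Qed.

End random_index_Rintegral.

(** * Properties of the Young measure *)

Section young_measure.
Context dO (Omega : measurableType dO) (R : realType) (d : nat).
Variables (P : probability Omega R) (tau : 'rV[R]_d -> Omega -> Omega).
Variables (Q : bounded_open R d) (p q : R) (p1 : 1 < p).
Hypotheses (q1 : 1 < q) (pq : p^-1 + q^-1 = 1).
Hypothesis sys : ergodic_system P tau.
Local Notation X := (Omega * RdL R d)%type.
Local Notation mQ := (lebesgue_on Q).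
Local Notation mu := (prodfm P mQ).
Local Notation S := (shear tau).
Local Notation B := (LspaceType mu (EFin_ge1 p1)).
Local Notation I := (measurableTypeR R).
Variable M : set (X -> R).
Hypothesis MT : test_space mu M.
Variables (eps : nat -> R) (u : nat -> B) (C l : R) (G : set Omega) (v : nat -> X -> R).
Variables (N : nat -> nat) (a : nat -> nat -> R) (kap : nat -> Omega * I -> nat) (V : Omega * I -> B).
Hypothesis eps0 : forall k, 0 < eps k.
Hypothesis uC : forall k, `|u k| <= C.
Hypothesis ul : `|u k| @[k --> \oo] --> l.
Hypothesis RL : random_limit tau M eps u G v N a kap V.

Let p0 : 0 < p := lt_trans ltr01 p1.
Let p1w : 1 <= p := ltW p1.
Let C0 : 0 <= C := le_trans (normr_ge0 _) (uC 0%N).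
Local Notation lamP := (prodfm P (@lam R)).

Let mVb : measurable_fun setT (V : Omega * I -> weak_borel B).
Proof. exact: (measurable_weak_borel q1 pq MT (rl_mV RL)). Qed.

Definition young_kernel : R.-pker Omega ~> weak_borel B := law_kernel mVb.

Lemma measurable_Bnorm : measurable_fun setT (fun b : weak_borel B => `|b : B|).
Proof.
have E (b : B) : `|b| = `|b - 0| by rewrite subr0.
rewrite (_ : (fun b : weak_borel B => _) = fun b : weak_borel B => `|(b : B) - 0|); last by apply/funext => b; exact: E.
apply: (measurable_norm_sub q1 pq MT) => f Mf.
by apply: (weak_borel_pair q1 pq); apply: bddm_Lfun; [exact: ltW|exact: (ts_bddm MT Mf)].
Qed.

Lemma measurable_Vnorm : measurable_fun setT (fun z => `|V z|).
Proof. exact: (measurableT_comp measurable_Bnorm mVb). Qed.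

Let np k w := nm mQ p (fun x => v k (w, x)) `^ p.

Let vL k : v k \in Lfun mu p%:E.
Proof. exact: (Lfun_ae p1w (rl_measurable RL k) (rl_ae RL k) (LspaceL (u k))). Qed.

Lemma measurable_np k : measurable_fun setT (np k).
Proof. exact: (measurable_nm_section p1w (rl_section RL k) (rl_measurable RL k)). Qed.

Lemma integral_np k : (\int[P]_w (np k w)%:E = (`|u k| `^ p)%:E)%E.
Proof.
rewrite (nm_section_int P p1w (rl_section RL k) (rl_measurable RL k)).
rewrite LnormE; [|exact: vL|exact: p1w].
by rewrite (Lspace_norm_ae (rl_measurable RL k) (rl_ae RL k)).
Qed.

Let np0 k w : (0 <= (np k w)%:E)%E. Proof. by rewrite lee_fin powR_ge0. Qed.
Let mnp k : measurable_fun setT (fun w => (np k w)%:E).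
Proof. by apply/measurable_EFinP; exact: measurable_np. Qed.

Let integral_kap n : (\int[(P \x @lam R)%E]_z (np (kap n z) z.1)%:E =
  (\sum_(k < N n) a n k * `|u k| `^ p)%:E)%E.
Proof.
rewrite (random_index_integral P (rl_weights RL) (rl_law RL) (rl_mkap RL) n np0 mnp).
by rewrite -sumEFin; apply: eq_bigr => k _; rewrite integral_np EFinM.
Qed.

Let mnk n : measurable_fun setT (fun z : Omega * I => (np (kap n z) z.1)%:E).
Proof.
apply/measurable_EFinP.
apply: (measurable_index (rl_mkap RL n) (f := fun k z => np k z.1)) => k.
by apply: measurableT_comp => //; exact: measurable_np.
Qed.

Let mVp : measurable_fun setT (fun z => (`|V z| `^ p)%:E).
Proof.
apply/measurable_EFinP; apply: (measurableT_comp (measurable_powR _)).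
exact: measurable_Vnorm.
Qed.

Let aeG : {ae P, forall w, G w}.
Proof. by exists (~` G); split; [apply: measurableC; exact: (rl_mG RL)|exact: (rl_G RL)|]. Qed.

Lemma integral_Vnorm : (\int[(P \x @lam R)%E]_z (`|V z| `^ p)%:E <= (l `^ p)%:E)%E.
Proof.
pose L (z : Omega * I) := limn_einf (fun n => (np (kap n z) z.1)%:E).
have mL : measurable_fun setT L by exact: measurable_limn_einf.
have L0 z : (0 <= L z)%E by apply: limn_einf_ge => n; rewrite lee_fin powR_ge0.
apply: (@le_trans _ _ (\int[(P \x @lam R)%E]_z L z)%E).
  apply: ae_ge0_le_integral => //.
  apply: (@ae_prod_measurable _ _ _ _ _ P (@lam R) [set z | setT z -> ((`|V z| `^ p)%:E <= L z)%E]).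
    rewrite (_ : [set z | _] = [set z | ((`|V z| `^ p)%:E <= L z)%E]); last first.
      by apply/seteqP; split=> z /=; [exact|].
    by rewrite -[X in measurable X]setTI; exact: emeasurable_fun_le.
  apply: filterS aeG => w Gw; apply: filterS (rl_lim RL Gw) => t [h _] _; exact: h.
apply: le_trans (fatou _ measurableT (f := fun n z => (np (kap n z) z.1)%:E) _ _) _.
- exact: mnk.
- by move=> n z _; rewrite lee_fin powR_ge0.
(* The integral is a convex combination of the [p]-th powers of the norms of [u k] with [k >= n],
   and these powers tend to [l^p]. *)
have c : (\int[(P \x @lam R)%E]_z (np (kap n z) z.1)%:E)%E @[n --> \oo] --> (l `^ p)%:E.
  under eq_fun do rewrite integral_kap.
  apply: cvg_EFin; first exact: nearW.
  exact: (convex_cvg (rl_weights RL) (cvg_powR p0 (fun k => normr_ge0 (u k)) ul)).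
by have [-> _] := cvg_limn_einf_sup c.
Qed.

Lemma young_norm_le :
  (\int[P]_w \int[young_kernel w]_b (`|b : B| `^ p)%:E <= (l `^ p)%:E)%E.
Proof.
apply: le_trans integral_Vnorm.
rewrite fubini_tonelli1// le_eqVlt; apply/orP; left; apply/eqP; apply: eq_integral => w _.
rewrite law_integral//.
by apply/measurable_EFinP; apply: (measurableT_comp (measurable_powR _)); exact: measurable_Bnorm.
Qed.

Let le1p (x : R) : 0 <= x -> x <= 1 + x `^ p.
Proof.
move=> x0; have [x1|x1] := lerP x 1; first by rewrite (le_trans x1)// lerDl powR_ge0.
rewrite -[leLHS]powRr1//; apply: (@le_trans _ _ (x `^ p)); last by rewrite lerDr.
by rewrite ler_powR// ltW.
Qed.

Lemma Vnorm_integrable : lamP.-integrable setT (fun z => (`|V z|)%:E).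
Proof.
have mV := measurable_Vnorm.
apply/integrableP; split; first exact/measurable_EFinP.
have : (\int[(P \x @lam R)%E]_z ((cst 1%E z) + (`|V z| `^ p)%:E) < +oo)%E.
  rewrite ge0_integralD//.
  apply: lte_add_pinfty; last by apply: le_lt_trans integral_Vnorm _; exact: ltry.
  rewrite integral_cst// mul1e ltey_eq; apply/orP; left.
  exact: (fin_num_measure lamP).
apply: le_lt_trans; apply: ge0_le_integral => //.
- by apply: measurableT_comp => //; exact/measurable_EFinP.
- by apply: emeasurable_funD.
- by move=> z _; rewrite /= normr_id -EFinD lee_fin; exact: le1p.
Qed.

Lemma pair_V_integrable f : M f -> lamP.-integrable setT (fun z => (pair (V z) f)%:E).
Proof.
move=> Mf; have fL := bddm_Lfun mu (ltW q1) (ts_bddm MT Mf).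
apply: (@le_integrable _ _ _ lamP setT measurableT _ (fun z => (nm mu q f)%:E * (`|V z|)%:E)%E).
- by apply/measurable_EFinP; exact: (rl_mV RL Mf).
- move=> z _; rewrite /= lee_fin [leRHS]ger0_norm ?mulr_ge0 ?nm_ge0// mulrC.
  exact: (pair_le q1 pq).
- exact: (integrableZl measurableT (nm mu q f) Vnorm_integrable).
Qed.

(* Uniform integrability: the pairings are bounded in [L^p] because [f] is
   bounded. *)
Lemma mean_cvg f (x : R) : M f ->
  \int[mu]_z (u k z * f (S (eps k)^-1 z)) @[k --> \oo] --> x ->
  \int[lamP]_z pair (V z) f = x.
Proof.
move=> Mf ux; have bf := ts_bddm MT Mf; have [mf [K fK]] := bf.
pose J k w := Jeps tau Q (eps k) w (fun x => v k (w, x)) f.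
have mJ k : measurable_fun setT (J k).
  exact: (measurable_Jeps p1 q1 pq sys (eps0 k) bf (vL k)).
pose Z n (z : Omega * I) := J (kap n z) z.1.
have mZ n : measurable_fun setT (Z n).
  apply: (measurable_index (rl_mkap RL n) (f := fun k z => J k z.1)) => k.
  by apply: measurableT_comp.
(* Bounds the [L^q(Q)] norm of every oscillating section of [f], whatever the scale and the point
   [w]. *)
pose c := (K `^ q * fine (mQ setT)) `^ q^-1.
have Jle k w : `|J k w| `^ p <= c `^ p * np k w.
  rewrite /np -powRM ?powR_ge0 ?nm_ge0//.
  apply: ge0_ler_powR; rewrite ?nnegrE ?(ltW p0) ?mulr_ge0 ?nm_ge0 ?powR_ge0//.
  apply: le_trans (Jeps_le p1 q1 pq sys (eps0 k) bf w (rl_section RL k w)) _.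
  rewrite mulrC; apply: ler_wpM2r; first exact: nm_ge0.
  apply: nm_bounded; [exact: ltW|exact: (bddm_Tstar sys (eps0 k) bf w).1|].
  by move=> y; exact: fK.
have Zb n : (\int[lamP]_z (`|Z n z| `^ p)%:E <= (c `^ p * C `^ p)%:E)%E.
  apply: (@le_trans _ _ (\int[(P \x @lam R)%E]_z ((c `^ p)%:E * (np (kap n z) z.1)%:E))%E).
    apply: ge0_le_integral => //.
    - by apply/measurable_EFinP; exact: measurable_normpow.
    - by apply: emeasurable_funM => //; exact: mnk.
    - by move=> z _; rewrite -EFinM lee_fin; exact: Jle.
  rewrite ge0_integralZl_EFin ?powR_ge0//.
  rewrite integral_kap -EFinM lee_fin; apply: ler_wpM2l; first exact: powR_ge0.
  have [a0 _ _ a1] := rl_weights RL n.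
  rewrite -[leRHS]mul1r -a1 mulr_suml; apply: ler_sum => k _; apply: ler_wpM2l => //.
  by apply: ge0_ler_powR; rewrite ?nnegrE ?(ltW p0).
have aeZ : {ae lamP, forall z, Z n z @[n --> \oo] --> pair (V z) f}.
  apply: (@ae_prod_measurable _ _ _ _ _ P (@lam R) [set z | Z n z @[n --> \oo] --> pair (V z) f]).
    by apply: measurable_cvg_to => //; exact: (rl_mV RL Mf).
  apply: filterS aeG => w Gw; apply: filterS (rl_lim RL Gw) => t [_ h]; exact: h.
have c1 := Lp_bounded_cvg p1 mZ (rl_mV RL Mf) aeZ Zb.
have c2 : \int[lamP]_z Z n z @[n --> \oo] --> x.
  rewrite (_ : (fun n => _) = fun n => \sum_(k < N n) a n k * \int[mu]_z (u k z * f (S (eps k)^-1 z))).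
    exact: (convex_cvg (rl_weights RL) ux).
  apply/funext => n; rewrite (random_index_Rintegral (rl_weights RL) (rl_law RL) (rl_mkap RL) n); last first.
    by move=> k; exact: (Jeps_integrable p1 q1 pq sys (eps0 k) bf (vL k)).
  apply: eq_bigr => k _; congr (_ * _).
  rewrite (Rintegral_Jeps p1 q1 pq sys (eps0 k) bf (vL k)).
  have ek : (eps k)^-1 != 0 by rewrite invr_eq0 gt_eqF.
  have mfs := (bddm_shear sys ek bf).1.
  apply: ae_eq_Rintegral.
  - by apply: measurable_funM => //; exact: (rl_measurable RL).
  - by apply: measurable_funM => //; exact: measurable_Lspace.
  - by apply: filterS (rl_ae RL k) => z /= h _; rewrite h.
exact: (cvg_unique _ c1 c2).
Qed.

(** For almost every [w] the norm is integrable for the kernel at [w], which gives the inner Bochner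
    integral [b w]; the bound of its norm by [F w] makes [b] integrable in turn. Fubini's theorem
    for the pairings identifies the iterated integral. *)
Lemma barycenter_exists : exists2 u0 : B, is_barycenter P young_kernel u0 &
  forall f, M f -> pair u0 f = \int[lamP]_z pair (V z) f.
Proof.
pose F w := (\int[@lam R]_t (`|V (w, t)|)%:E)%E.
have mVn : measurable_fun setT (fun z => (`|V z|)%:E) by apply/measurable_EFinP; exact: measurable_Vnorm.
have mF : measurable_fun setT F.
  by apply: (@measurable_fun_fubini_tonelli_F _ _ _ _ _ (@lam R) (fun z => (`|V z|)%:E)).
have F0 w : (0 <= F w)%E by apply: integral_ge0.
have IF : (\int[P]_w F w < +oo)%E.
  have /integrableP[_] := Vnorm_integrable.
  under eq_integral do rewrite gee0_abs//.
  by rewrite (@fubini_tonelli1 _ _ _ _ _ P (@lam R) (fun z => (`|V z|)%:E)).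
pose A := [set w | (F w < +oo)%E].
have mA : measurable A.
  rewrite (_ : A = F @^-1` (~` [set +oo%E])).
    by rewrite -[X in measurable X]setTI; apply: mF => //; exact: measurableC (emeasurable_set1 _).
  by apply/seteqP; split=> w /=; rewrite /A/= ltey => /eqP.
have aeA : {ae P, forall w, A w}.
  have : P.-integrable setT F.
    by apply/integrableP; split=> //; under eq_integral do rewrite gee0_abs//.
  move=> /(integrable_ae measurableT); apply: filterS => w /(_ Logic.I).
  by move=> /fin_numPlt/andP[].
have mpair f : M f -> measurable_fun setT (fun b : weak_borel B => pair (b : B) f).
  by move=> Mf; apply: (weak_borel_pair q1 pq); apply: bddm_Lfun; [exact: ltW|exact: (ts_bddm MT Mf)].
(* Outside [A] the value 0 keeps the pairings with [b] measurable on the whole of [Omega]. *)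
have bP w : exists b : B, (A w -> is_bochner_integral (young_kernel w) (fun b : weak_borel B => (b : B)) b /\
    forall f, M f -> pair b f = \int[@lam R]_t pair (V (w, t)) f) /\ (~ A w -> b = 0).
  have [Aw|nA] := pselect (A w); last by exists 0.
  have [|b [b1 b2]] := @pettis_bochner _ _ _ mu p q p1 q1 pq M MT _ (weak_borel B)
     (distribution (@lam R) (lawf mVb w)) (fun b => b) mpair.
    rewrite (_ : (\int[_]_s _)%E = F w)//.
    apply: (@law_integral _ _ _ _ _ _ mVb w (fun b : weak_borel B => (`|b : B|)%:E)) => //.
    by apply/measurable_EFinP; exact: measurable_Bnorm.
  exists b; split; last by move=> nA; exfalso; apply: nA.
  move=> _; split=> // f Mf; rewrite b2//.
  exact: (@law_Rintegral _ _ _ _ _ _ mVb w (fun b : weak_borel B => pair (b : B) f)) (mpair f Mf).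
have [b bE] := choice bP.
have IV f : M f -> P.-integrable setT (fun w => (\int[@lam R]_t pair (V (w, t)) f)%:E).
  by move=> Mf; exact: (integrable_Rsection (pair_V_integrable Mf)).
have fL f : M f -> f \in Lfun mu q%:E.
  by move=> Mf; apply: bddm_Lfun; [exact: ltW|exact: (ts_bddm MT Mf)].
have bpE f w : M f -> pair (b w) f = \1_A w * \int[@lam R]_t pair (V (w, t)) f.
  move=> Mf; have [Aw|nA] := pselect (A w).
    by rewrite indicE mem_set// mul1r; exact: ((bE w).1 Aw).2.
  by rewrite indicE memNset// mul0r (bE w).2// (pair0 p1 q1 pq)//; exact: fL.
have mb f : M f -> measurable_fun setT (fun w => pair (b w) f).
  move=> Mf; under eq_fun do rewrite bpE//.
  apply: measurable_funM; first exact: measurable_indic.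
  by have /integrableP[/measurable_EFinP] := IV f Mf.
have bF w : ((`|b w|)%:E <= F w)%E.
  have [Aw|nA] := pselect (A w); last by rewrite (bE w).2// normr0.
  have Ffin : F w = (fine (F w))%:E by rewrite fineK// ge0_fin_numE.
  rewrite Ffin lee_fin; apply: (Lspace_norm_le q1 pq MT); first by rewrite fine_ge0.
  move=> f Mf; rewrite ((bE w).1 Aw).2//.
  have mVw : measurable_fun setT (fun t : I => V (w, t) : weak_borel B) by exact: measurable_section.
  have IVw : (@lam R).-integrable setT (fun t : I => (`|V (w, t)|)%:E).
    apply/integrableP; split.
      by apply/measurable_EFinP; exact: (measurableT_comp measurable_Bnorm mVw).
    by under eq_integral do rewrite gee0_abs//.
  have mp : measurable_fun setT (fun t : I => pair (V (w, t)) f).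
    exact: (measurableT_comp (mpair f Mf) mVw).
  have Ip : (@lam R).-integrable setT (fun t : I => (pair (V (w, t)) f)%:E).
    apply: (@le_integrable _ _ _ (@lam R) setT measurableT _ (fun t => (nm mu q f)%:E * (`|V (w, t)|)%:E)%E).
    - exact/measurable_EFinP.
    - move=> t _; rewrite /= lee_fin [leRHS]ger0_norm ?mulr_ge0 ?nm_ge0// mulrC.
      by apply: (pair_le q1 pq); exact: fL.
    - exact: (integrableZl measurableT (nm mu q f) IVw).
  apply: le_trans (le_normr_Rintegral measurableT Ip) _.
  rewrite [leRHS](_ : _ = \int[@lam R]_t (nm mu q f * `|V (w, t)|)); last first.
    by rewrite RintegralZl// mulrC.
  apply: le_Rintegral => //.
  - exact: (integrable_norm Ip).
  - by have := integrableZl measurableT (nm mu q f) IVw.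
  - by move=> t _; rewrite mulrC; apply: (pair_le q1 pq); exact: fL.
have mbn : measurable_fun setT (fun w => (`|b w|)%:E).
  apply/measurable_EFinP.
  by have := measurable_norm_sub q1 pq MT mb 0; under eq_fun do rewrite subr0.
have Ib : (\int[P]_w (`|b w|)%:E < +oo)%E.
  apply: le_lt_trans IF; apply: ge0_le_integral => //.
have [u0 [u1 u2]] := pettis_bochner q1 pq MT mb Ib.
exists u0.
  by exists b => //; apply: filterS aeA => w Aw; exact: ((bE w).1 Aw).1.
move=> f Mf; rewrite u2// -(Rintegral_prod (pair_V_integrable Mf)).
apply: ae_eq_Rintegral; first exact: mb.
  by have /integrableP[/measurable_EFinP] := IV f Mf.
by apply: filterS aeA => w Aw _; rewrite bpE// indicE mem_set// mul1r.
Qed.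

End young_measure.

(** * Two-scale limits in the mean *)

Section mean_two_scale_limit.
Context dO (Omega : measurableType dO) (R : realType) (d : nat).
Variables (P : probability Omega R) (tau : 'rV[R]_d -> Omega -> Omega).
Variables (Q : bounded_open R d) (p q : R) (p1 : 1 < p).
Hypotheses (q1 : 1 < q) (pq : p^-1 + q^-1 = 1).
Hypothesis sys : ergodic_system P tau.
Local Notation X := (Omega * RdL R d)%type.
Local Notation mu := (prodfm P (lebesgue_on Q)).
Local Notation B := (LspaceType mu (EFin_ge1 p1)).
Variable M : set (X -> R).
Hypothesis MT : test_space mu M.

Lemma mean_two_scale_limit (eps : nat -> R) (u : nat -> B) (u0 : B) (C : R) :
  (forall k, 0 < eps k) -> (forall k, `|u k| <= C) ->
  (forall f, M f -> \int[mu]_z (u k z * f (shear tau (eps k)^-1 z)) @[k --> \oo] --> pair u0 f) ->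
  mean_two_scale tau eps (u : nat -> Bspace P Q p1) (u0 : Bspace P Q p1).
Proof.
move=> eps0 uC uf; have [T_ TP] := choice (fun k => unfolding_exists Q p1 sys (eps0 k)).
pose w k : B := T_ k (u k).
have wC k : `|w k| <= C.
  by have [[h _ _] _] := TP k; apply: le_trans (uC k); rewrite /w; have := h (u k) => /= ->.
have wf f : M f -> pair (w k) f @[k --> \oo] --> pair u0 f.
  move=> Mf; rewrite (_ : (fun k => _) = fun k => \int[mu]_z (u k z * f (shear tau (eps k)^-1 z))); first exact: uf.
  by apply/funext => k; apply: (TP k).2; exact: (ts_bddm MT Mf).
have h := weak_cvg q1 pq MT wC wf.
exists T_; split; first by move=> k; exact: (TP k).1.
(* The weak limit is carried to [Bspace P Q p1] along an equality of packaged modules, as in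
   [unfolding_exists]. *)
pose N := {V : normedModType R & (nat -> V) * V}%type.
pose z1 : N := existT _ (B : normedModType R) (w, u0).
pose z2 : N := existT _ (Bspace P Q p1 : normedModType R) (w, u0).
have z12 : z1 = z2 by [].
pose H (z : N) := ((projT2 z).1 k : weak_space (projT1 z)) @[k --> \oo] --> ((projT2 z).2 : weak_space (projT1 z)).
have Hz1 : H z1 by exact: h.
by rewrite z12 in Hz1.
Qed.

End mean_two_scale_limit.

(** * The metric on functionals *)

Section dist_Lin.
Context dO (Omega : measurableType dO) (R : realType) (d : nat).
Local Notation X := (Omega * RdL R d)%type.

(** The terms of index at most [n] add up to at most [2 * 2^-n], the remaining ones to at most
    [2^-n]. *)
Lemma dist_Lin_le (phi_ : nat -> X -> R) (U V : (X -> R) -> R) n :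
  (forall j, (j <= n)%N -> `|U (phi_ j) - V (phi_ j)| <= 2^-1 ^+ n) ->
  dist_Lin phi_ U V <= 3 * 2^-1 ^+ n.
Proof.
move=> UV; rewrite /dist_Lin; set t := fun j => _.
pose x j := `|U (phi_ j) - V (phi_ j)|.
have x0 j : 0 <= x j by exact: normr_ge0.
have h0 k : 0 < (2^-1 : R) ^+ k by rewrite exprn_gt0.
have t0 j : 0 <= t j by rewrite /t mulr_ge0 ?(ltW (h0 _))// divr_ge0// addr_ge0.
have tx j : x j / (x j + 1) <= x j.
  by rewrite ler_pdivrMr ?ltr_wpDl// ler_peMr// lerDr.
have t1 j : x j / (x j + 1) <= 1 by rewrite ler_pdivrMr ?ltr_wpDl// mul1r lerDl.
(* A closed form bounding the sum of the first [N] terms: [2^-n] times the sum of [2^-j] over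
   [j < N], increased, once [N] exceeds [n.+1], by the sum of [2^-j] over [n < j < N]. *)
pose g N : R := 2^-1 ^+ n * (2 * (1 - 2^-1 ^+ N)) + (if (N <= n.+1)%N then 0 else 2^-1 ^+ n - 2 * 2^-1 ^+ N).
have sg N : series t N <= g N.
  elim: N => [|N IH]; first by rewrite /series /= big_geq// /g /= expr0 subrr !mulr0 addr0.
  rewrite seriesSr; apply: le_trans (lerD IH (lexx _)) _.
  have tN : t N <= 2^-1 ^+ N * (if (N <= n)%N then 2^-1 ^+ n else 1).
    rewrite /t ler_wpM2l ?(ltW (h0 _))//; case: ifPn => [Nn|_]; last exact: t1.
    by apply: le_trans (tx _) _; exact: UV.
  apply: le_trans (lerD (lexx _) tN) _; rewrite /g !exprS ltnS.
  case: (ltngtP N n.+1) => Nn.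
  - move: Nn; rewrite ltnS => Nn; rewrite Nn.
    set a := 2^-1 ^+ n; set b := 2^-1 ^+ N; lra.
  - have -> : (N <= n)%N = false by apply/negbTE; rewrite -ltnNge ltnW.
    set a := 2^-1 ^+ n; set b := 2^-1 ^+ N.
    have : 0 <= a * b by rewrite /a /b mulr_ge0 ?(ltW (h0 _)).
    nra.
  - rewrite Nn ltnn !exprS; set a := 2^-1 ^+ n.
    have : 0 <= a * a by rewrite /a mulr_ge0 ?(ltW (h0 _)).
    nra.
have g3 N : g N <= 3 * 2^-1 ^+ n.
  have := h0 N; have := h0 n; rewrite /g; set a := 2^-1 ^+ n; set b := 2^-1 ^+ N => a0 b0.
  have ab : 0 <= a * b by rewrite mulr_ge0// ltW.
  by case: ifP => _; nra.
apply: limr_le; last by apply: nearW => N; exact: le_trans (sg N) (g3 N).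
apply: nondecreasing_is_cvgn; first by apply: nondecreasing_series => i _ _.
by exists (3 * 2^-1 ^+ n) => _ [N _ <-]; exact: le_trans (sg N) (g3 N).
Qed.

End dist_Lin.

(** * Cluster points, and quenched limits for Dirac laws *)

Section quenched.
Context dO (Omega : measurableType dO) (R : realType) (d : nat).
Variables (P : probability Omega R) (tau : 'rV[R]_d -> Omega -> Omega).
Variables (Q : bounded_open R d) (p q : R) (p1 : 1 < p).
Hypotheses (q1 : 1 < q) (pq : p^-1 + q^-1 = 1).
Hypothesis sys : ergodic_system P tau.
Local Notation X := (Omega * RdL R d)%type.
Local Notation mQ := (lebesgue_on Q).
Local Notation mu := (prodfm P mQ).
Local Notation S := (shear tau).
Local Notation B := (LspaceType mu (EFin_ge1 p1)).
Local Notation I := (measurableTypeR R).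
Variables (M T : set (X -> R)).
Hypothesis MT : test_space mu M.
Hypothesis TM : T `<=` M.
Variables (eps : nat -> R) (u : nat -> B) (C : R) (G : set Omega) (v : nat -> X -> R).
Variables (N : nat -> nat) (a : nat -> nat -> R) (kap : nat -> Omega * I -> nat) (V : Omega * I -> B).
Hypothesis eps0 : forall k, 0 < eps k.
Hypothesis epsc : eps k @[k --> \oo] --> 0.
Hypothesis uC : forall k, `|u k| <= C.
Hypothesis M0 : exists f, M f.
Hypothesis RL : random_limit tau M eps u G v N a kap V.

Let p0 : 0 < p := lt_trans ltr01 p1.
Let p1w : 1 <= p := ltW p1.
Let bM f : M f -> bddm f := ts_bddm MT (f := f).
Let bT f : Rspan T f -> bddm f.
Proof. by apply: Rspan_bddm => g /TM; exact: bM. Qed.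
Let bL f : bddm f -> f \in Lfun mu q%:E.
Proof. by apply: bddm_Lfun; exact: ltW. Qed.
Local Notation J k w := (Jeps tau Q (eps k) w (fun x => v k (w, x))).
Local Notation nu := (young_kernel q1 pq MT RL).

Lemma J0E (b : B) f : bddm f -> J0 (b : Bspace P Q p1) f = pair b f.
Proof. by move=> /bL fL; rewrite /J0 /mean_integral (Rintegral_prod (pair_integrable q1 pq b fL)). Qed.

Lemma J0_Lin (b : B) : Lin (Rspan T) (J0 (b : Bspace P Q p1)).
Proof.
move=> c f g /bT bf /bT bg; have bcf := bddmZ c bf.
rewrite !J0E//; last exact: bddmD.
by rewrite (pair_addr q1 pq b (bL bcf) (bL bg)) (pair_scaler q1 pq b c (bL bf)).
Qed.

Let JZ k w c f : bddm f -> J k w (fun z => c * f z) = c * J k w f.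
Proof.
move=> bf; have b0 : bddm (fun _ : X => 0 : R) by exact: (@bddm_cst _ X R 0).
have := Jeps_lin p1 q1 pq sys w c (eps0 k) bf b0 (rl_section RL k w).
under [X in Jeps _ _ _ _ _ X]eq_fun do rewrite addr0.
move=> ->; rewrite [X in _ + X](_ : _ = 0) ?addr0//.
by rewrite /Jeps /Tstar /=; under eq_Rintegral do rewrite mulr0; rewrite /Rintegral integral0.
Qed.

Lemma young_cluster (phi_ : nat -> X -> R) (w0 : Omega) :
  (forall j, exists c f, M f /\ phi_ j = fun z => c * f z) ->
  {ae nu w0, forall b, cluster_points tau (Rspan T) phi_ eps w0
     (fun k x => v k (w0, x)) (b : Bspace P Q p1)}.
Proof.
move=> phiM.
have bphi j : bddm (phi_ j) by have [c [f [/bM bf ->]]] := phiM j; exact: bddmZ.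
have h0 n : 0 < (2^-1 : R) ^+ n by rewrite exprn_gt0.
pose cond (b : B) n j i := `|J j w0 (phi_ i) - pair b (phi_ i)| <= 2^-1 ^+ n.
(* Approximation of finitely many pairings at arbitrarily late indices. This implies membership in
   the cluster set and is a countable combination of measurable conditions, as [law_ae] requires. *)
pose A := [set b : weak_borel B | forall n m, exists2 j, (m <= j)%N & forall i, (i <= n)%N -> cond b n j i].
have mA : measurable A.
  rewrite (_ : A = \bigcap_n \bigcap_m \bigcup_j \bigcap_i
    (if (m <= j)%N then if (i <= n)%N then [set b : weak_borel B | cond b n j i] else setT else set0)).
    apply: bigcap_measurable => // n _; apply: bigcap_measurable => // m _.
    apply: bigcup_measurable => j _; apply: bigcap_measurable => // i _.
    case: ifP => // _; case: ifP => // _.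
    rewrite -[X in measurable X]setTI.
    apply: (measurable_fun_le measurableT) => //; apply: measurableT_comp => //.
    apply: measurable_funB => //.
    by apply: (weak_borel_pair q1 pq); exact: bL.
  apply/seteqP; split=> b.
    move=> Ab n _ m _; have [j mj jP] := Ab n m; exists j => // i _; rewrite mj.
    by case: ifP => // jn; exact: jP.
  move=> Ab n m; have [j _ jP] := Ab n Logic.I m Logic.I.
  have := jP 0%N Logic.I; case: ifPn => // mj _; exists j => // i jn.
  by have := jP i Logic.I; rewrite mj jn.
have aeA : {ae nu w0, forall b, A b}.
  (* Outside [G] both [V] and the realizations vanish, so all pairings are 0 and the conditions hold
     at every index. *)
  apply: law_ae => //; have [Gw|nG] := pselect (G w0); last first.
    apply: aeW => t n m; exists m => // i _.
    rewrite /cond (rl_V0 RL)// (pair0 p1 q1 pq (bL (bphi i))).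
    rewrite [X in `|X - _|](_ : _ = 0) ?subrr ?normr0 ?(ltW (h0 n))//.
    rewrite /Jeps; under eq_Rintegral do rewrite (rl_v0 RL)// mul0r.
    by rewrite /Rintegral integral0.
  apply: (@filterS _ _ (lam_ae_filter R)) (rl_lim RL Gw) => t [_ ht] n m.
  have cvi i : J (kap l (w0, t)) w0 (phi_ i) @[l --> \oo] --> pair (V (w0, t)) (phi_ i).
    have [c [f [Mf ->]]] := phiM i; have bf := bM Mf.
    rewrite (pair_scaler q1 pq _ c (bL bf)).
    rewrite (_ : (fun l => _) = fun l => c * J (kap l (w0, t)) w0 f); last by apply/funext => l; rewrite JZ.
    by apply: cvgMr; exact: ht.
  have [l [ml lP]] : exists l, (m <= l)%N /\ forall i : 'I_n.+1, cond (V (w0, t)) n (kap l (w0, t)) i.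
    have : \forall l \near \oo, (m <= l)%N /\ forall i : 'I_n.+1, cond (V (w0, t)) n (kap l (w0, t)) i.
      apply: filterI; first by exists m.
      suff H (i : 'I_n.+1) : \forall l \near \oo, cond (V (w0, t)) n (kap l (w0, t)) i by exact: filter_forall H.
      have /cvgrPdist_le /(_ _ (h0 n)) := cvi i.
      by apply: filterS => l; rewrite distrC.
    by move=> [l0 _ lP]; exists l0; exact: (lP l0 (leqnn l0)).
  exists (kap l (w0, t)); first exact: leq_trans ml (rl_kap RL l _).
  by move=> i jn; exact: (lP (Ordinal (jn : (i < n.+1)%N))).
apply: filterS aeA => b Ab k; split; first exact: J0_Lin.
move=> e e0.
have e30 : 0 < e / 3 by rewrite divr_gt0.
have [n _ /(_ n (leqnn n))] := (cvgrPdist_lt _ _).1 (@half_cvg0 R) _ e30.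
rewrite sub0r normrN ger0_norm ?(ltW (h0 n))// => ne.
have k0 : 0 < k.+1%:R^-1 :> R by rewrite invr_gt0.
(* Indices from [m] on have scales below [1 / (k + 1)], as the definition of cluster points
   demands. *)
have [m _ mP] := (cvgrPdist_lt _ _).1 epsc _ k0.
have [j mj jP] := Ab n m.
exists (J j w0); first by exists j => //=; have := mP j mj; rewrite sub0r normrN ger0_norm// ltW.
apply: (@le_lt_trans _ _ (3 * 2^-1 ^+ n)); last by rewrite mulrC -ltr_pdivlMr.
apply: dist_Lin_le => i jn; rewrite J0E// distrC; exact: jP.
Qed.

Lemma young_dirac (vv : Omega -> weak_borel B) : measurable_fun setT vv ->
  {ae P, forall w, forall A, measurable A -> nu w A = dirac (vv w) A} ->
  exists2 rho : nat -> nat, {homo rho : m n / (m < n)%N} &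
    {ae P, forall w,
      quenched_limit tau (Rspan T) (eps \o rho) w (fun k x => v (rho k) (w, x)) (vv w : Bspace P Q p1) /\
      exists2 kappa : nat -> nat, {homo kappa : m n / (m < n)%N} &
        quenched_two_scale tau (Rspan T) (eps \o rho \o kappa) w
          (fun k x => v (rho (kappa k)) (w, x)) (vv w : Bspace P Q p1)}.
Proof.
move=> mvv nuvv.
have [m [Mm mM]] : exists m : nat -> X -> R, (forall n, M (m n)) /\ forall f, M f -> exists n, m n = f.
  by have [f Mf] := M0; exact: countable_enum (ts_countable MT) Mf.
have vL k : v k \in Lfun mu p%:E.
  exact: (Lfun_ae p1w (rl_measurable RL k) (rl_ae RL k) (LspaceL (u k))).
have h0 n : 0 < (2^-1 : R) ^+ n by rewrite exprn_gt0.
have mpair j : measurable_fun setT (fun b : weak_borel B => pair (b : B) (m j)).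
  by apply: (weak_borel_pair q1 pq); apply: bL; exact: bM.
pose z j w := pair (vv w : B) (m j).
have mz j : measurable_fun setT (z j) by exact: (measurableT_comp (mpair j) mvv).
(* A Dirac law does not charge the set where the pairing with [m j] differs from its value at
   [vv w]; countably many [j] are treated at once. *)
have aeV : {ae P, forall w, {ae @lam R, forall t, forall j, pair (V (w, t)) (m j) = z j w}}.
  apply: filterS nuvv => w nuw; apply: ae_foralln => j.
  pose A := [set b : weak_borel B | pair (b : B) (m j) = z j w].
  have mA : measurable A.
    rewrite -[X in measurable X]setTI; exact: (mpair j measurableT [set z j w] (measurable_set1 _)).
  have := nuw (~` A) (measurableC mA).
  rewrite diracE memNset ?mulr0n//=; last by apply.
  move=> nA; exists ((fun t => V (w, t)) @^-1` (~` A)); split => //.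
  rewrite -[X in measurable X]setTI.
  apply: (measurable_section (measurable_weak_borel q1 pq MT (rl_mV RL)) w) => //.
  exact: measurableC.
(* The cut at 1 lets dominated convergence apply with a constant, since no uniform bound on the
   pairings is available. *)
pose D j k w := Num.min 1 `|J k w (m j) - z j w|.
have D0 j k w : 0 <= D j k w by rewrite le_min ler01 normr_ge0.
have D1 j k w : D j k w <= 1 by rewrite ge_min lexx.
have mJ j k : measurable_fun setT (fun w => J k w (m j)).
  exact: (measurable_Jeps p1 q1 pq sys (eps0 k) (bM (Mm j)) (vL k)).
have mD j k : measurable_fun setT (D j k).
  apply: measurable_minr => //; apply: measurableT_comp => //.
  exact: measurable_funB.
have bD j k : bddm (D j k) by split=> //; exists 1 => w; rewrite ger0_norm.
have minc (x : nat -> R) : (forall n, 0 <= x n) -> Num.min 1 (x n) @[n --> \oo] --> 0 -> x n @[n --> \oo] --> 0.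
  move=> x0 cx; apply/cvgrPdist_lt => e e0.
  have e10 : 0 < Num.min 1 e by rewrite lt_min ltr01.
  have /cvgrPdist_lt /(_ _ e10) := cx; apply: filterS => n.
  rewrite !sub0r !normrN !ger0_norm// ?le_min ?ler01 ?x0//.
  by rewrite lt_min !gt_min ltxx /= => /andP[x1 /orP[/(lt_trans x1)|]].
have cminc (x : nat -> R) : x n @[n --> \oo] --> 0 -> Num.min 1 `|x n| @[n --> \oo] --> 0.
  move=> cx; apply/cvgrPdist_le => e e0.
  have /cvgrPdist_le /(_ _ e0) := cx; apply: filterS => n.
  rewrite !sub0r !normrN (ger0_norm (x := Num.min _ _)) ?le_min ?ler01 ?normr_ge0// => xe.
  by rewrite ge_min xe orbT.
have aeG : {ae P, forall w, G w}.
  by exists (~` G); split; [apply: measurableC; exact: (rl_mG RL)|exact: (rl_G RL)|].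
have cD j : \sum_(k < N n) a n k * \int[P]_w D j k w @[n --> \oo] --> 0.
  rewrite (_ : (fun n => _) = fun n => \int[prodfm P (@lam R)]_y D j (kap n y) y.1); last first.
    apply/funext => n.
    rewrite (random_index_Rintegral (rl_weights RL) (rl_law RL) (rl_mkap RL) n (h := D j))//.
    by move=> k; exact: bddm_integrable.
  rewrite [X in _ --> X](_ : 0 = \int[prodfm P (@lam R)]_y cst 0 y); last by rewrite /Rintegral integral0.
  have mDk n : measurable_fun setT (fun y : Omega * I => D j (kap n y) y.1).
    apply: (measurable_index (rl_mkap RL n) (f := fun k y => D j k y.1)) => k.
    exact: measurableT_comp.
  apply: (@dominated_Rintegral _ _ _ (prodfm P (@lam R)) _ _ (cst 1)) => //.
  - apply: (@ae_prod_measurable _ _ _ _ _ P (@lam R) [set y | D j (kap n y) y.1 @[n --> \oo] --> cst 0 y]).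
      exact: measurable_cvg_to.
    apply: filterS (filterI aeG aeV) => w [Gw hV].
    apply: (@filterS2 _ _ (lam_ae_filter R) _ _ _ _ (rl_lim RL Gw) hV) => t [_ hJ] hz.
    rewrite /=; apply: cminc; apply/subr_cvg0; rewrite -(hz j); apply: hJ; exact: Mm.
  - exact: (bddm_integrable _ (@bddm_cst _ _ R 1)).
  - by move=> n y; rewrite ger0_norm.
(* Summing the first [n.+1] errors yields one index [k] that suits them all; along [rho] the errors
   of a fixed [j] are then summable from stage [j] on. *)
pose er k n := \sum_(j < n.+1) \int[P]_w D j k w.
have ex n k0 : exists2 k, (k0 <= k)%N & er k n < 2^-1 ^+ n.
  have c : \sum_(k < N l) a l k * er k n @[l --> \oo] --> 0.
    rewrite (_ : (fun l => _) = fun l => \sum_(j < n.+1) \sum_(k < N l) a l k * \int[P]_w D j k w); last first.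
      by apply/funext => l; rewrite exchange_big /=; apply: eq_bigr => k _; rewrite mulr_sumr.
    rewrite [X in _ --> X](_ : 0 = \sum_(j < n.+1) (0 : R)); last by rewrite big1.
    by apply: cvg_big => [|j _]; [exact: add_continuous|exact: cD].
  have [l0 _ l0P] := (cvgrPdist_lt _ _).1 c _ (h0 n).
  have := l0P (maxn l0 k0) (leq_maxl _ _); rewrite sub0r normrN => /(le_lt_trans (ler_norm _)).
  move=> /(convex_exists (rl_weights RL) (c := fun k => er k n))[k lk ek].
  by exists k => //; apply: leq_trans lk; exact: leq_maxr.
have [rho hrho rhoP] := increasing_choice ex; exists rho => //.
have aec : {ae P, forall w, forall j, J (rho n) w (m j) @[n --> \oo] --> z j w}.
  apply: ae_foralln => j.
  have Fb n : (\int[P]_w (D j (rho (n + j)%N) w)%:E <= (2^-1 ^+ n)%:E)%E.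
    have /integrable_fin_num := bddm_integrable P (bD j (rho (n + j)%N)) => /(_ measurableT) /fineK <-.
    rewrite lee_fin; apply: (@le_trans _ _ (er (rho (n + j)%N) (n + j)%N)).
      have jn : (j < (n + j).+1)%N by rewrite ltnS leq_addl.
      rewrite /er (bigD1 (Ordinal jn))//= lerDl; apply: sumr_ge0 => i _.
      by apply: Rintegral_ge0 => w _.
    apply: le_trans (ltW (rhoP (n + j)%N)) _.
    by rewrite exprD ler_piMr// ?exprn_ge0// exprn_ile1// invf_le1 ?ler1n.
  have h := ae_cvg0_summable (fun n => mD j (rho (n + j)%N)) (fun n w => D0 j (rho (n + j)%N) w) Fb (@half_series R).
  apply: filterS (h) => w; rewrite (cvg_shiftn j (fun n => D j (rho n) w)) => /minc.
  move=> /(_ (fun n => normr_ge0 _)) /norm_cvg0P {}h.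
  by apply/subr_cvg0.
(* The realizations at a given [w] may be unbounded along [rho]. The lower limit of their norms is
   finite by Fatou's lemma and supplies the bounded further subsequence [kappa], which depends on
   [w]. *)
have aeL : {ae P, forall w, (limn_einf (fun n => (nm mQ p (fun x => v (rho n) (w, x)) `^ p)%:E) < +oo)%E}.
  have mn n : measurable_fun setT (fun w => (nm mQ p (fun x => v (rho n) (w, x)) `^ p)%:E).
    by apply/measurable_EFinP; exact: (measurable_np RL).
  have : P.-integrable setT (fun w => limn_einf (fun n => (nm mQ p (fun x => v (rho n) (w, x)) `^ p)%:E)).
    apply/integrableP; split; first exact: measurable_limn_einf.
    apply: (@le_lt_trans _ _ (C `^ p)%:E); last exact: ltry.
    have L0 w : (0 <= limn_einf (fun n => (nm mQ p (fun x => v (rho n) (w, x)) `^ p)%:E))%E.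
      by apply: limn_einf_ge => n; rewrite lee_fin powR_ge0.
    under eq_integral do rewrite gee0_abs//.
    apply: le_trans (fatou _ measurableT (f := fun n w => (nm mQ p (fun x => v (rho n) (w, x)) `^ p)%:E) _ _) _ => //.
      by move=> n w _; rewrite lee_fin powR_ge0.
    apply: limn_einf_le => n; rewrite (integral_np RL) lee_fin.
    apply: ge0_ler_powR; rewrite ?nnegrE ?(ltW p0)//.
    exact: le_trans (normr_ge0 _) (uC 0%N).
  move=> /(integrable_ae measurableT); apply: filterS => w /(_ Logic.I).
  by move=> /fin_numPlt/andP[].
apply: filterS2 aec aeL => w cJ Lw.
have ql : quenched_limit tau (Rspan T) (eps \o rho) w (fun k x => v (rho k) (w, x)) (vv w : Bspace P Q p1).
  move=> f Tf; rewrite J0E//; last exact: bT.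
  suff H : Rspan T `<=` [set f | bddm f /\ J (rho n) w f @[n --> \oo] --> pair (vv w : B) f] by exact: (H f Tf).2.
  apply: Rspan_ind.
  - have b0 : bddm (fun _ : X => 0 : R) by exact: (@bddm_cst _ X R 0).
    split=> //; rewrite [X in _ --> X](_ : _ = 0); last first.
      by rewrite /pair; under eq_Rintegral do rewrite mulr0; rewrite /Rintegral integral0.
    rewrite (_ : (fun n => _) = cst 0); first exact: cvg_cst.
    apply/funext => n; rewrite /Jeps /Tstar /=; under eq_Rintegral do rewrite mulr0.
    by rewrite /Rintegral integral0.
  - move=> f1 f2 [bf cf] [bg cg]; split; first exact: bddmD.
    rewrite (pair_addr q1 pq _ (bL bf) (bL bg)).
    rewrite (_ : (fun n => _) = fun n => J (rho n) w f1 + J (rho n) w f2); first exact: cvgD.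
    apply/funext => n.
    have := Jeps_lin p1 q1 pq sys w 1 (eps0 (rho n)) bf bg (rl_section RL (rho n) w).
    by rewrite mul1r; under [X in Jeps _ _ _ _ _ X]eq_fun do rewrite mul1r.
  - move=> c f1 /TM Mf; have bf := bM Mf; split; first exact: bddmZ.
    rewrite (pair_scaler q1 pq _ c (bL bf)).
    rewrite (_ : (fun n => _) = fun n => c * J (rho n) w f1); last by apply/funext => n; rewrite JZ.
    by apply: cvgMr; have [j <-] := mM f1 Mf; exact: cJ.
split=> //.
have [r Lr] : exists r : R, (limn_einf (fun n => (nm mQ p (fun x => v (rho n) (w, x)) `^ p)%:E) < r%:E)%E.
  have L0 : (0 <= limn_einf (fun n => (nm mQ p (fun x => v (rho n) (w, x)) `^ p)%:E))%E.
    by apply: limn_einf_ge => n; rewrite lee_fin powR_ge0.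
  exists (fine (limn_einf (fun n => (nm mQ p (fun x => v (rho n) (w, x)) `^ p)%:E)) + 1).
  by rewrite EFinD fineK ?ge0_fin_numE// lteDl// ?lte01// ge0_fin_numE.
have [kappa hk kP] := increasing_choice (fun _ : nat => limn_einf_lt Lr).
exists kappa => //; split.
  exists (r `^ p^-1) => k; rewrite -nmE; last exact: (rl_section RL).
  rewrite lee_fin.
  rewrite -[leLHS](@powRr1 R)// ?nm_ge0// -(@mulfV _ p) ?gt_eqF// powRrM.
  have := kP k; rewrite lte_fin => /ltW nr.
  have np0 : 0 <= nm mQ p (fun x => v (rho (kappa k)) (w, x)) `^ p by exact: powR_ge0.
  by apply: ge0_ler_powR; rewrite ?nnegrE ?invr_ge0 ?(ltW p0)// (le_trans np0).
by move=> f Tf; exact: (cvg_subseq_homo hk (ql f Tf)).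
Qed.

End quenched.

(** * Representatives and existence of the Young limit *)

Lemma representative_exists dO (Omega : measurableType dO) (R : realType) (d : nat)
    (P : probability Omega R) (Q : bounded_open R d) (p : R) (p1 : 1 < p)
    (b : Bspace P Q p1) : exists f, representative b f.
Proof.
have p1w := ltW p1.
have bS := @Lfun_section _ _ _ _ _ P (lebesgue_on Q) p p1w b (LspaceL (b : LspaceType (prodfm P (lebesgue_on Q)) (EFin_ge1 p1))).
have [G mG [PG GS]] := ae_measurable_subset bS.
have aeG : {ae P, forall w, G w} by exists (~` G); split => //; exact: measurableC.
exists (fun z => \1_G z.1 * (b : _ -> R) z); split.
- apply: measurable_funM; last exact: measurable_Lspace.
  by apply: measurableT_comp => //; exact: measurable_indic.
- move=> w; have [Gw|Gw] := pselect (G w).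
    under eq_fun do rewrite indicE mem_set// mul1r.
    exact: (GS w Gw).
  under eq_fun do rewrite indicE memNset// mul0r.
  by apply: bddm_Lfun => //; exact: (@bddm_cst _ _ R 0).
- apply: filterS (ae_fst (lebesgue_on Q) aeG) => z /= Gz _.
  by rewrite indicE mem_set// mul1r.
Qed.

(* [Bspace P Q p1] and [L^p] of [prodfm P (lebesgue_on Q)] are convertible, but
   checking this on kernels is slow.  The conclusion is therefore abstracted over
   a normed module [V], where the identification is cheap. *)
Definition young_limit dO (Omega : measurableType dO) (R : realType) (d : nat)
    (P : probability Omega R) (tau : 'rV[R]_d -> Omega -> Omega)
    (Q : bounded_open R d) (p : R) (p1 : 1 < p) (T : set (Omega * RdL R d -> R))
    (Omega0 : set Omega) (phi_ : nat -> (Omega * RdL R d) -> R)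
    (eps_ : nat -> R) (u_ : nat -> Bspace P Q p1)
    (V : normedModType R) (j : V -> Bspace P Q p1) :=
  exists (sigma : nat -> nat) (nu : R.-pker Omega ~> weak_borel V)
         (w_ : nat -> (Omega * RdL R d) -> R),
    {homo sigma : m n / (m < n)%N} /\
    (forall k, representative (u_ k) (w_ k)) /\
    (forall w0, Omega0 w0 ->
      {ae nu w0, forall v,
        cluster_points tau (Rspan T) phi_ (eps_ \o sigma) w0
          (fun k x => w_ (sigma k) (w0, x)) (j v)}) /\
    ((\int[P]_w \int[nu w]_v (`|v : V| `^ p)%:E)%E
       <= limn_einf (fun k => (`|u_ (sigma k)| `^ p)%:E))%E /\
    (exists2 u : V,
      is_barycenter P nu u &
      mean_two_scale tau (eps_ \o sigma) (u_ \o sigma) (j u)) /\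
    (forall v : Omega -> weak_borel V,
      measurable_fun setT v ->
      {ae P, forall w, forall A, measurable A -> nu w A = dirac (v w) A} ->
      exists2 rho : nat -> nat, {homo rho : m n / (m < n)%N} &
        {ae P, forall w,
          quenched_limit tau (Rspan T) (eps_ \o sigma \o rho) w
            (fun k x => w_ (sigma (rho k)) (w, x)) (j (v w)) /\
          exists2 kappa : nat -> nat, {homo kappa : m n / (m < n)%N} &
            quenched_two_scale tau (Rspan T)
              (eps_ \o sigma \o rho \o kappa) w
              (fun k x => w_ (sigma (rho (kappa k))) (w, x)) (j (v w))}).

Lemma young_limit_exists dO (Omega : measurableType dO) (R : realType) (d : nat)
    (P : probability Omega R) (tau : 'rV[R]_d -> Omega -> Omega)
    (Q : bounded_open R d) (p : R) (p1 : 1 < p)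
    (DO : set (Omega -> R)) (DQ : set (RdL R d -> R)) (Omega0 : set Omega)
    (phi_ : nat -> (Omega * RdL R d) -> R)
    (eps_ : nat -> R) (u_ : nat -> Bspace P Q p1) :
  ergodic_system P tau ->
  test_families P Q DO DQ ->
  admissible_points P tau Q p DO DQ Omega0 ->
  enumerates_normalized P Q p (Qspan (tensors DO DQ)) phi_ ->
  (forall k, 0 < eps_ k) ->
  eps_ k @[k --> \oo] --> 0 ->
  (exists C : R, forall k, `|u_ k| <= C) ->
  young_limit tau (tensors DO DQ) Omega0 phi_ eps_ u_
    (fun b : LspaceType (prodfm P (lebesgue_on Q)) (EFin_ge1 p1) => b).
Proof.
move=> sys TF adm phiE eps0 epsc [C uC].
have p0 : 0 < p := lt_trans ltr01 p1.
pose q := p / (p - 1).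
have pB : 0 < p - 1 by rewrite subr_gt0.
have q1 : 1 < q by rewrite /q ltr_pdivlMr// mul1r ltrBlDr ltrDl.
have pq : p^-1 + q^-1 = 1 by rewrite /q invf_div; field; rewrite gt_eqF.
pose M := truncated (tensors DO DQ).
have MT : test_space (prodfm P (lebesgue_on Q)) M := test_space_M TF.
have M0 : exists f, M f := M_nonempty TF.
have TM : tensors DO DQ `<=` M by move=> f; exact: sub_truncated.
pose u : nat -> LspaceType (prodfm P (lebesgue_on Q)) (EFin_ge1 p1) := u_.
have uC' k : `|u k| <= C := uC k.
have [sigma hs [/cvg_ex[l ul] us nqs]] := subsequence_extraction q1 pq sys TF adm eps0 epsc uC'.
pose eps := eps_ \o sigma; pose us_ := u \o sigma.
have eps0' k : 0 < eps k := eps0 (sigma k).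
have epsc' : eps k @[k --> \oo] --> 0 by exact: (cvg_subseq_homo hs epsc).
have uCs k : `|us_ k| <= C := uC (sigma k).
have [G [v [N [a [kap [V RL]]]]]] := random_limit_exists q1 pq sys MT eps0' uCs M0 nqs.
have si : injective sigma by move=> i j ij; case: (ltngtP i j) => // /hs; rewrite ij ltnn.
(* Representatives are prescribed along [sigma] only. Other indices receive an arbitrary one, and
   injectivity of [sigma] makes the prescription unambiguous. *)
have wex j : exists f : (Omega * RdL R d) -> R,
    representative (u_ j) f /\ forall k, sigma k = j -> f = v k.
  have [[k kj]|nk] := pselect (exists k, sigma k = j); last first.
    have [f fP] := representative_exists (u_ j).
    by exists f; split=> // k kj; exfalso; apply: nk; exists k.
  exists (v k); split; last by move=> k' k'j; congr v; apply: si; rewrite kj.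
  rewrite -kj; split; [exact: (rl_measurable RL)|exact: (rl_section RL)|exact: (rl_ae RL)].
have [w_ wP] := choice wex.
have wsE : v = fun k => w_ (sigma k) by apply/funext => k; rewrite ((wP (sigma k)).2 k).
rewrite wsE in RL.
have [u0 nu_u0 pu0] := barycenter_exists q1 pq MT ul RL.
(* The extraction only ensures that the oscillating pairings converge; [mean_cvg] identifies their
   limits with the pairings of the barycenter. *)
have mean : mean_two_scale tau eps us_ (u0 : Bspace P Q p1).
  apply: (mean_two_scale_limit q1 pq sys MT eps0' uCs) => f Mf.
  have /cvg_ex[x xf] := us f Mf.
  by rewrite pu0// (mean_cvg q1 pq sys MT eps0' uCs RL Mf xf).
have norm_le : (\int[P]_w \int[young_kernel q1 pq MT RL w]_b (`|b : LspaceType _ _| `^ p)%:E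
    <= limn_einf (fun k => (`|us_ k| `^ p)%:E))%E.
  have c : (`|us_ k| `^ p)%:E @[k --> \oo] --> (l `^ p)%:E.
    apply: cvg_EFin; first exact: nearW.
    exact: (cvg_powR p0 (fun k => normr_ge0 (us_ k)) ul).
  have [-> _] := cvg_limn_einf_sup c.
  exact: (young_norm_le q1 pq MT ul RL).
have phiM j : exists c f, M f /\ phi_ j = fun z => c * f z.
  have [phi [Dphi _ ->]] : [set psi | exists phi, [/\ Qspan (tensors DO DQ) phi,
    product_norm P Q (p / (p - 1)) phi <> 0%E &
    psi = fun z => phi z / fine (product_norm P Q (p / (p - 1)) phi)]] (phi_ j).
    by rewrite -phiE; exists j.
  exists (fine (product_norm P Q (p / (p - 1)) phi))^-1, phi; split.
    suff : Qspan (tensors DO DQ) `<=` M by apply.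
    apply: Qspan_ind.
    - have [f Mf] := M0; have := ts_scale MT 0 Mf.
      by under eq_fun do rewrite rmorph0 mul0r.
    - exact: (ts_add MT).
    - by move=> c f /TM; exact: (ts_scale MT c).
  by apply/funext => z; rewrite mulrC.
exists sigma, (young_kernel q1 pq MT RL), w_.
split; first exact: hs.
split; first by move=> k; exact: (wP k).1.
split; first by move=> w0 _; exact: young_cluster.
split; first exact: norm_le.
split; first by exists u0.
by move=> vv mvv nuvv; apply: young_dirac mvv nuvv.
Qed.

Theorem theorem4p11
  (dO : measure_display) (Omega : measurableType dO) (R : realType) (d : nat)
  (P : probability Omega R) (tau : 'rV[R]_d -> Omega -> Omega)
  (Q : bounded_open R d) (p : R) (p1 : 1 < p)
  (DO : set (Omega -> R)) (DQ : set (RdL R d -> R)) (Omega0 : set Omega)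
  (phi_ : nat -> (Omega * RdL R d) -> R)
  (eps_ : nat -> R) (u_ : nat -> Bspace P Q p1) :
  countably_generated Omega ->
  ergodic_system P tau ->
  test_families P Q DO DQ ->
  admissible_points P tau Q p DO DQ Omega0 ->
  enumerates_normalized P Q p (Qspan (tensors DO DQ)) phi_ ->
  (forall k, 0 < eps_ k) ->
  eps_ k @[k --> \oo] --> 0 ->
  (exists C : R, forall k, `|u_ k| <= C) ->
  exists (sigma : nat -> nat) (nu : R.-pker Omega ~> weak_borel (Bspace P Q p1))
         (w_ : nat -> (Omega * RdL R d) -> R),
    {homo sigma : m n / (m < n)%N} /\
    (forall k, representative (u_ k) (w_ k)) /\
    (forall w0, Omega0 w0 ->
      {ae nu w0, forall v,
        cluster_points tau (Rspan (tensors DO DQ)) phi_ (eps_ \o sigma) w0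
          (fun k x => w_ (sigma k) (w0, x)) v}) /\
    ((\int[P]_w \int[nu w]_v (`|v : Bspace P Q p1| `^ p)%:E)%E
       <= limn_einf (fun k => (`|u_ (sigma k)| `^ p)%:E))%E /\
    (exists2 u : Bspace P Q p1,
      is_barycenter P nu u &
      mean_two_scale tau (eps_ \o sigma) (u_ \o sigma) u) /\
    (forall v : Omega -> weak_borel (Bspace P Q p1),
      measurable_fun setT v ->
      {ae P, forall w, forall A, measurable A -> nu w A = dirac (v w) A} ->
      exists2 rho : nat -> nat, {homo rho : m n / (m < n)%N} &
        {ae P, forall w,
          quenched_limit tau (Rspan (tensors DO DQ)) (eps_ \o sigma \o rho) w
            (fun k x => w_ (sigma (rho k)) (w, x)) (v w) /\
          exists2 kappa : nat -> nat, {homo kappa : m n / (m < n)%N} &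
            quenched_two_scale tau (Rspan (tensors DO DQ))
              (eps_ \o sigma \o rho \o kappa) w
              (fun k x => w_ (sigma (rho (kappa k))) (w, x)) (v w)}).
Proof.
move=> _ sys TF adm phiE eps0 epsc uC.
(* The equality [V1 = V2] carries the result over to [Bspace P Q p1] without comparing kernels on
   the two spaces. *)
pose N := {V : normedModType R & V -> Bspace P Q p1}.
pose V1 : N := existT _ (LspaceType (prodfm P (lebesgue_on Q)) (EFin_ge1 p1) : normedModType R) id.
pose V2 : N := existT _ (Bspace P Q p1 : normedModType R) id.
have V12 : V1 = V2 by [].
pose H (V : N) := young_limit tau (tensors DO DQ) Omega0 phi_ eps_ u_ (projT2 V).
suff : H V1 by rewrite V12.
exact: (young_limit_exists sys TF adm phiE eps0 epsc uC).
Qed.
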